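(* Put $$E_{2,8}^{(0)}(\tau)=\eta(\tau)^8\eta(2\tau)^{-4},\qquad E_{2,8}^{(1)}(\tau)=\eta(2\tau)^{-4}\eta(4\tau)^8,\qquad E_{2,8}^{(2)}(\tau)=\Delta_8(\tau)=\eta(4\tau)^{-4}\eta(8\tau)^8,$$ and $$E_{4,8}^{(1)}=E_{2,8}^{(0)}E_{2,8}^{(1)},\quad E_{4,8}^{(2)}=E_{2,8}^{(0)}E_{2,8}^{(2)},\quad E_{4,8}^{(3)}=E_{2,8}^{(1)}E_{2,8}^{(2)},\quad E_{4,8}^{(4)}=[E_{2,8}^{(2)}]^2.$$ The space $S_4(\Gamma_0(8))$ is one-dimensional and its unitary generator is $$F_{4,8}^{(1)}=E_{4,8}^{(1)}+8E_{4,8}^{(2)}+32E_{4,8}^{(3)}-128E_{4,8}^{(4)}.$$ For every integer $k\ge2$ and every unitary upper triangular basis $\mathcal{B}_{2k-4}$ of $M_{2k-4}(\Gamma_0(8))$, the family $F_{4,8}^{(1)}\cdot\mathcal{B}_{2k-4}$ is a unitary upper triangular basis of $S_{2k}(\Gamma_0(8))$.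
   Context: $\tau$ is in the upper half-plane, $q=e^{2i\pi\tau}$, and $\eta$ is Dedekind's eta function. $M_{2k}(\Gamma_0(N))$, $S_{2k}(\Gamma_0(N))$ are the spaces of modular and cusp forms of weight $2k$, with $M_0=\mathbb{C}$. The valuation of a nonzero form is its order in $q$ at $\infty$; a form is unitary if its leading $q$-coefficient is $1$; a family is unitary upper triangular if all members are unitary and their valuations are strictly increasing. $F\cdot(b_i)$ denotes $(Fb_i)$. *)

(* Defs.v *)
From HB Require Import structures.
From mathcomp Require Import all_boot all_order all_algebra.
From mathcomp Require Import complex ring.
From mathcomp Require Import all_classical all_reals all_analysis.
Set Implicit Arguments.
Unset Strict Implicit.
Unset Printing Implicit Defensive.
Import Order.TTheory GRing.Theory Num.Theory.
Import numFieldNormedType.Exports.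
Local Open Scope classical_set_scope.
Local Open Scope ring_scope.
Local Open Scope complex_scope.

(* The alias [^o] is what carries the topology and the normed module structure
   over itself; hence [derivable f z 1] is complex differentiability. *)
Notation cplx R := (R[i]^o).

Definition uhp (R : realType) := {z : cplx R | 0 < complex.Im z}.

Definition cexp (R : realType) (z : cplx R) : cplx R :=
  (expR (complex.Re z) * cos (complex.Im z)) +i*
  (expR (complex.Re z) * sin (complex.Im z)).

(* nome h z = exp(2 pi i z / h); thus q = nome 1 z. *)
Definition nome (R : realType) (h : nat) (z : cplx R) : cplx R :=
  cexp ((2 * pi)%:C * 'i%C * z / h%:R).

Definition eta (R : realType) (z : cplx R) : cplx R :=
  nome 24 z *
  lim ((fun n => \prod_(1 <= m < n.+1) (1 - nome 1 z ^+ m)) @ \oo).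

Definition SL2Z := {g : 'M[int]_2 | \det g == 1}.
Definition SL2Z_mx (g : SL2Z) : 'M[int]_2 := val g.
Coercion SL2Z_mx : SL2Z >-> matrix.

Definition Gamma0 (N : nat) : set SL2Z :=
  [set g : SL2Z | (N%:Z %| g 1%R 0%R)%Z].

Section Slash.
Variable R : realType.
Implicit Types (g : SL2Z) (z : uhp R) (f : uhp R -> cplx R).

Definition autf g z : cplx R := (g 1 0)%:~R * val z + (g 1 1)%:~R.


Lemma Im_mobius (a b c d x y : R) : a * d - b * c = 1 -> 0 < y ->
  0 < complex.Im ((a%:C * (x +i* y) + b%:C) / (c%:C * (x +i* y) + d%:C)).
Proof.
move=> det1 y0 /=; rewrite !mul0r !subr0 !addr0.
set den := (_ ^+ 2 + _ ^+ 2).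
have den0 : 0 < den.
  rewrite /den lt_def addr_ge0 ?sqr_ge0 // andbT paddr_eq0 ?sqr_ge0 //.
  rewrite !sqrf_eq0 mulf_eq0 (gt_eqF y0) orbF.
  apply/negP => /andP[+ /eqP c0]; rewrite c0 mul0r add0r => /eqP d0.
  by move: det1; rewrite c0 d0 !mulr0 subr0 => /eqP; rewrite eq_sym oner_eq0.
rewrite [X in 0 < X](_ : _ = y / den); first exact: divr_gt0.
by rewrite -[y in RHS]mulr1 -det1; ring.
Qed.

Lemma mobius_subproof g z :
  0 < complex.Im (((g 0 0)%:~R * val z + (g 0 1)%:~R) / autf g z).
Proof.
have intrE (k : int) : (k%:~R : R[i]) = (k%:~R : R)%:C.
  by rewrite (rmorph_int (real_complex R)).
rewrite /autf !intrE; case: z => [[x y] /= y0]; apply: Im_mobius => //.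
rewrite -!rmorphM -rmorphB -[RHS](rmorph1 (intr : int -> R)); congr (_ %:~R).
rewrite -(eqP (valP g)) /SL2Z_mx (expand_det_row _ 0).
rewrite !big_ord_recl big_ord0 /cofactor !det_mx11 !mxE /=.
have e01 : lift 0 0 = 1 :> 'I_2 by apply: val_inj.
have e10 : lift 1 0 = 0 :> 'I_2 by apply: val_inj.
by rewrite !e01 e10 addn0 expr0 expr1 mul1r mulN1r mulrN addr0.
Qed.

Definition mobius g z : uhp R :=
  exist _ (((g 0 0)%:~R * val z + (g 0 1)%:~R) / autf g z) (mobius_subproof g z).

(* The weight w slash operator (f|_w g)(z) = (cz+d)^(-w) f(gz); it suffices to
   have w : nat since only nonnegative weights occur. *)
Definition slash (w : nat) f g : uhp R -> cplx R :=
  fun z => autf g z ^- w * f (mobius g z).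

Definition extend f (z : cplx R) : cplx R := oapp f 0 (insub z).

(* The upper half-plane is open, so the values of [extend f] outside of it play
   no role. *)
Definition holomorphic f : Prop :=
  forall z : uhp R, derivable (extend f) (val z) 1.

(* f = \sum_n a_n q_h^n on the whole upper half-plane, with
   q_h = exp(2 pi i z / h); no negative exponents. *)
Definition fourier (h : nat) (a : nat -> cplx R) f : Prop :=
  forall z : uhp R, series (fun n => a n * nome h (val z) ^+ n) @ \oo --> f z.

(* Holomorphy (vanishing) at all cusps is expressed by the expansions at
   infinity of all the translates f|g, g in SL_2(Z). *)
Definition modular_forms (N w : nat) : set (uhp R -> cplx R) := [set f |
  [/\ holomorphic f,
      forall g, Gamma0 N g -> slash w f g = f
    & forall g, exists h (a : nat -> cplx R),
        (0 < h)%N /\ fourier h a (slash w f g)]].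

Definition cusp_forms (N w : nat) : set (uhp R -> cplx R) := [set f |
  [/\ holomorphic f,
      forall g, Gamma0 N g -> slash w f g = f
    & forall g, exists h (a : nat -> cplx R),
        [/\ (0 < h)%N, a 0%N = 0 & fourier h a (slash w f g)]]].

Definition valuation f (v : nat) : Prop :=
  exists a, [/\ fourier 1 a f, forall m, (m < v)%N -> a m = 0 & a v != 0].

Definition unitary f : Prop :=
  exists a v, [/\ fourier 1 a f, forall m, (m < v)%N -> a m = 0 & a v = 1].

Definition unitary_upper_triangular n (b : 'I_n -> uhp R -> cplx R) : Prop :=
  (forall i, unitary (b i)) /\
  exists v : 'I_n -> nat, (forall i, valuation (b i) (v i)) /\
    {homo v : i j / (i < j)%N}.

Definition is_basis (V : set (uhp R -> cplx R)) n
    (b : 'I_n -> uhp R -> cplx R) : Prop :=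
  [/\ forall i, V (b i),
      forall c : 'I_n -> cplx R,
        \sum_i c i *: b i = 0 -> forall i, c i = 0
    & forall f, V f -> exists c : 'I_n -> cplx R, f = \sum_i c i *: b i].

End Slash.

Section Level8.
Variable R : realType.

Definition E2_8_0 (tau : uhp R) : cplx R :=
  eta (val tau) ^+ 8 * eta (2 * val tau) ^- 4.
Definition E2_8_1 (tau : uhp R) : cplx R :=
  eta (2 * val tau) ^- 4 * eta (4 * val tau) ^+ 8.
Definition E2_8_2 (tau : uhp R) : cplx R :=
  eta (4 * val tau) ^- 4 * eta (8 * val tau) ^+ 8.

Definition E4_8_1 (tau : uhp R) : cplx R := E2_8_0 tau * E2_8_1 tau.
Definition E4_8_2 (tau : uhp R) : cplx R := E2_8_0 tau * E2_8_2 tau.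
Definition E4_8_3 (tau : uhp R) : cplx R := E2_8_1 tau * E2_8_2 tau.
Definition E4_8_4 (tau : uhp R) : cplx R := E2_8_2 tau ^+ 2.

Definition F4_8_1 (tau : uhp R) : cplx R :=
  E4_8_1 tau + 8 * E4_8_2 tau + 32 * E4_8_3 tau - 128 * E4_8_4 tau.

End Level8.

(* Main.v *)
Require Import Defs.
From mathcomp Require Import all_boot all_order all_algebra.
From mathcomp Require Import complex ring lra zify.
From mathcomp Require Import all_classical all_reals all_analysis.
Set Implicit Arguments.
Unset Strict Implicit.
Unset Printing Implicit Defensive.
Import Order.TTheory GRing.Theory Num.Theory.
Import numFieldNormedType.Exports.
Local Open Scope classical_set_scope.
Local Open Scope ring_scope.
Local Open Scope complex_scope.

(* F(z) = q t(q) v(q^2), where v(q) = eta(z)^8 / eta(2z)^4 = theta_4(q)^4 and q t(q)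
   = eta(4z)^8 / eta(2z)^4 = theta_2(q)^4 / 16, with theta_4(q) = sum_(n in Z)
   (-1)^n q^(n^2). As an eta quotient F does not vanish on the upper half-plane, and
   the action of SL_2(Z) on theta_2^4, theta_3^4, theta_4^4 shows that it has a
   simple zero, in the local parameter, at every cusp of Gamma_0(8). So division by
   F maps S_2k onto M_(2k-4), which gives the result for all k; for k = 2 one also
   needs that M_0 consists of constants.

   The fourth powers of the theta constants are introduced as Lambert series, for
   which the behaviour under z |-> -1/z results from summing a series over a lattice
   in two orders. To identify them with eta quotients, both are shown to satisfy the
   same two functional equations relating the values at w, -w, w^2, -w^2, one linear
   and one quadratic, and these have only one power series solution starting with 1
   - 8 w. For the Lambert series the linear equation is termwise and the quadratic
   one holds by the valence formula; for the products the quadratic one is termwise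
   and the linear one follows from Gauss' identity sum_(n in Z) (-1)^n w^(n^2) =
   prod_(m >= 1) (1 - w^m) / (1 + w^m). *)

(** * Complex limits and series *)

(** All analysis is done with power series on the unit disc. The definition of a modular form gives
    every translate an expansion in a nome, so forms become power series at once; averages over
    roots of unity give Cauchy's estimates, and from these follow the maximum principle, the closure
    of analytic functions under normally convergent series, and the uniqueness of coefficients.
    Fourth powers of theta constants are convenient because their weight is 2: no square root of z
    and no eighth roots of unity appear, and SL_2(Z) only permutes them up to sign and weight
    factor. The obstacle in the division is that the period [h] of an expansion of f|g is arbitrary
    and need not be the width of the cusp. At a cusp of width m, F|g is [nome 8 ^ e] times a unit,
    with e m = 8; invariance of f|g under z |-> z + m forces an expansion without constant term to
    start at that same exponent or later. The coefficients 8, 32, -128 of F are those for which the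
    relations between theta constants at q and q^2 collapse the four products to a single one. *)

Section ComplexModulus.
Variable R : realType.
Notation C := (cplx R).
Implicit Types (x y z : C) (u : nat -> C) (b : nat -> R).

(* On R[i] the notation `|z| has values in R[i]; this is the modulus as an element
   of R. *)
Definition nm (z : C) : R := ComplexField.Normc.normc z.

Lemma nmE z : `|z| = (nm z)%:C. Proof. by []. Qed.
Lemma nm_ge0 z : 0 <= nm z. Proof. by rewrite -ler0c -nmE. Qed.
Lemma nm0 : nm 0 = 0. Proof. exact: ComplexField.Normc.normc0. Qed.
Lemma nm1 : nm 1 = 1. Proof. exact: ComplexField.Normc.normc1. Qed.
Lemma nmM x y : nm (x * y) = nm x * nm y.
Proof. exact: ComplexField.Normc.normcM. Qed.
Lemma nmV x : nm x^-1 = (nm x)^-1.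
Proof. exact: ComplexField.Normc.normcV. Qed.
Lemma nmN x : nm (- x) = nm x.
Proof. by apply: complexI; rewrite -!nmE normrN. Qed.
Lemma nmB x y : nm (x - y) = nm (y - x).
Proof. by rewrite -nmN opprB. Qed.
Lemma nmD x y : nm (x + y) <= nm x + nm y.
Proof. by rewrite -lecR rmorphD /= -!nmE ler_normD. Qed.
Lemma nmX x n : nm (x ^+ n) = nm x ^+ n.
Proof. by elim: n => [|n IH]; rewrite ?expr0 ?nm1 // !exprS nmM IH. Qed.
Lemma nm_eq0 z : (nm z == 0) = (z == 0).
Proof. by apply/eqP/eqP => [/ComplexField.Normc.eq0_normc //|->]; exact: nm0. Qed.
Lemma nm_gt0 z : (0 < nm z) = (z != 0).
Proof. by rewrite lt_def nm_ge0 andbT nm_eq0. Qed.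
Lemma nm_real (r : R) : nm r%:C = `|r|.
Proof. by rewrite /nm /= expr0n /= addr0 sqrtr_sqr. Qed.
Lemma nm_sqr z : nm z ^+ 2 = complex.Re z ^+ 2 + complex.Im z ^+ 2.
Proof. by case: z => a b; rewrite /nm /= sqr_sqrtr // addr_ge0 // sqr_ge0. Qed.
Lemma nm_nat n : nm n%:R = n%:R.
Proof. by rewrite -(rmorph_nat (real_complex R)) nm_real normr_nat. Qed.
Lemma nm_sub x y : nm x - nm y <= nm (x - y).
Proof. by rewrite lerBlDr -{1}(subrK y x); exact: nmD. Qed.
Lemma nm_subr x y : nm x - nm y <= nm (x + y).
Proof. by rewrite -{2}(opprK y) -[nm y]nmN nm_sub. Qed.
Lemma nm_Re z : `|complex.Re z| <= nm z.
Proof.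
by rewrite -(ler_pXn2r (n := 2)) ?nnegrE ?nm_ge0 // nm_sqr real_normK ?num_real // lerDl sqr_ge0.
Qed.
Lemma nm_Im z : `|complex.Im z| <= nm z.
Proof.
by rewrite -(ler_pXn2r (n := 2)) ?nnegrE ?nm_ge0 // nm_sqr real_normK ?num_real // lerDr sqr_ge0.
Qed.
Lemma nm_ReIm z : nm z <= `|complex.Re z| + `|complex.Im z|.
Proof.
rewrite -(ler_pXn2r (n := 2)) ?nnegrE ?nm_ge0 ?addr_ge0 // nm_sqr.
rewrite -(real_normK (num_real (complex.Re z))) -(real_normK (num_real (complex.Im z))).
by rewrite sqrrD lerD2r lerDl mulrn_wge0 // mulr_ge0.
Qed.
Lemma nm_sum I (r : seq I) (P : pred I) (F : I -> C) :
  nm (\sum_(i <- r | P i) F i) <= \sum_(i <- r | P i) nm (F i).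
Proof.
elim/big_rec2: _ => [|i y z _ le]; first by rewrite nm0.
by apply: le_trans (nmD _ _) _; rewrite lerD2l.
Qed.
Lemma nm_prod I (r : seq I) (P : pred I) (F : I -> C) :
  nm (\prod_(i <- r | P i) F i) = \prod_(i <- r | P i) nm (F i).
Proof. by apply: (big_morph nm nmM nm1). Qed.

Lemma cvgCP u (l : C) : u @ \oo --> l <->
  forall e : R, 0 < e -> exists N, forall n, (N <= n)%N -> nm (u n - l) < e.
Proof.
split=> [/cvgrPdist_lt H e e0|H].
  have e0C : 0 < (e%:C : C) by rewrite ltcR.
  have [N _ HN] := H _ e0C.
  exists N => n Nn; have := HN n Nn; rewrite /= nmE ltcR; by rewrite nmB.
apply/cvgrPdist_lt => -[e i]; rewrite ltcE /= => /andP[/eqP -> e0].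
have [N HN] := H e e0.
exists N => // n /= Nn; rewrite nmE ltcR nmB; exact: HN.
Qed.

Lemma cvgRP (a : nat -> R) (l : R) : a @ \oo --> l <->
  forall e : R, 0 < e -> exists N, forall n, (N <= n)%N -> `|a n - l| < e.
Proof.
split=> [/cvgrPdist_lt H e e0|H].
  have [N _ HN] := H _ e0.
  by exists N => n Nn; have := HN n Nn; rewrite /= distrC.
apply/cvgrPdist_lt => e e0; have [N HN] := H e e0.
by exists N => // n /= Nn; rewrite distrC; exact: HN.
Qed.

Lemma cvgC_unique u (l l' : C) : u @ \oo --> l -> u @ \oo --> l' -> l = l'.
Proof. by apply: cvg_unique; exact: norm_hausdorff. Qed.

Lemma cvgC_squeeze u (l : C) (a : nat -> R) :
  (exists N, forall n, (N <= n)%N -> nm (u n - l) <= a n) -> a @ \oo --> (0 : R) ->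
  u @ \oo --> l.
Proof.
move=> [N HN] /cvgRP a0; apply/cvgCP => e /a0[M HM].
exists (maxn N M) => n; rewrite geq_max => /andP[Nn Mn].
apply: le_lt_trans (HN _ Nn) _; apply: le_lt_trans (HM _ Mn).
by rewrite subr0 ler_norm.
Qed.

Lemma cvgC_nm_le u (l : C) (B : R) : u @ \oo --> l ->
  (exists N, forall n, (N <= n)%N -> nm (u n) <= B) -> nm l <= B.
Proof.
move=> /cvgCP ul [N HN]; apply/ler_addgt0Pr => e /ul[M HM].
have := HM _ (leq_maxr N M); have := HN _ (leq_maxl N M).
move: (maxn N M) => n h1 h2.
rewrite -(subrK (u n) l); apply: le_trans (nmD _ _) _.
by rewrite addrC lerD // nmB ltW.
Qed.

Lemma cvgC_eq u v (l : C) : (exists N, forall n, (N <= n)%N -> u n = v n) ->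
  u @ \oo --> l -> v @ \oo --> l.
Proof.
move=> [N HN] /cvgCP ul; apply/cvgCP => e /ul[M HM].
exists (maxn N M) => n; rewrite geq_max => /andP[Nn Mn].
by rewrite -HN // HM.
Qed.

Lemma cvgCD u v (l m : C) : u @ \oo --> l -> v @ \oo --> m ->
  (fun n => u n + v n) @ \oo --> l + m.
Proof. by move=> ul vm; exact: (cvgD ul vm). Qed.
Lemma cvgCB u v (l m : C) : u @ \oo --> l -> v @ \oo --> m ->
  (fun n => u n - v n) @ \oo --> l - m.
Proof. by move=> ul vm; exact: (cvgB ul vm). Qed.
Lemma cvgCM u v (l m : C) : u @ \oo --> l -> v @ \oo --> m ->
  (fun n => u n * v n) @ \oo --> l * m.
Proof. by move=> ul vm; exact: (cvgM ul vm). Qed.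
Lemma cvgC_cst (l : C) : (fun=> l) @ \oo --> l.
Proof. exact: cvg_cst. Qed.
Lemma cvgCZ u (l c : C) : u @ \oo --> l -> (fun n => c * u n) @ \oo --> c * l.
Proof. by move=> ul; exact: (@cvgCM (fun=> c) u _ _ (@cvgC_cst c) ul). Qed.
Lemma cvgCBl u (l c : C) : u @ \oo --> l -> (fun n => u n - c) @ \oo --> l - c.
Proof. by move=> ul; exact: (@cvgCB u (fun=> c) _ _ ul (@cvgC_cst c)). Qed.
Lemma cvgCBr u (l c : C) : u @ \oo --> l -> (fun n => c - u n) @ \oo --> c - l.
Proof. by move=> ul; exact: (@cvgCB (fun=> c) u _ _ (@cvgC_cst c) ul). Qed.
Lemma cvgC_sum (f : nat -> nat -> C) (g : nat -> C) N :
  (forall k, f k @ \oo --> g k) ->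
  (fun n => \sum_(k < N) f k n) @ \oo --> \sum_(k < N) g k.
Proof.
move=> fg; elim: N => [|N IH].
  rewrite big_ord0; apply: (cvgC_eq (u := fun=> 0)); last exact: cvgC_cst.
  by exists 0%N => n _; rewrite big_ord0.
rewrite big_ord_recr; have := cvgCD IH (fg N); apply: cvgC_eq.
by exists 0%N => n _; rewrite big_ord_recr.
Qed.

Lemma cvgC_inv1 u : u @ \oo --> (1 : C) -> (fun n => (u n)^-1) @ \oo --> (1 : C).
Proof.
move=> h; have e1 : (1 : C)^-1 = 1 by rewrite invr1.
have h1 : (fun n => (u n)^-1) @ \oo --> (1 : C)^-1 by apply: (cvgV (oner_neq0 C) h).
by rewrite e1 in h1.
Qed.

Lemma cvgC_ReIm u (a b : R) : (fun n => complex.Re (u n)) @ \oo --> a ->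
  (fun n => complex.Im (u n)) @ \oo --> b -> u @ \oo --> (a +i* b : C).
Proof.
move=> /cvgRP ha /cvgRP hb; apply/cvgCP => e e0.
have e20 : 0 < e / 2 by rewrite divr_gt0.
have [N HN] := ha _ e20; have [M HM] := hb _ e20.
exists (maxn N M) => n; rewrite geq_max => /andP[Nn Mn].
apply: le_lt_trans (nm_ReIm _) _; rewrite [e]splitr.
have -> : complex.Re (u n - (a +i* b)) = complex.Re (u n) - a by case: (u n).
have -> : complex.Im (u n - (a +i* b)) = complex.Im (u n) - b by case: (u n).
by rewrite ltrD // ?HN ?HM.
Qed.

Lemma seriesCE u n : series u n = \sum_(k < n) u k.
Proof. by rewrite /series /= big_mkord. Qed.
Lemma seriesRE b n : series b n = \sum_(k < n) b k.
Proof. by rewrite /series /= big_mkord. Qed.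

Lemma nm_series u b n : (forall n, nm (u n) <= b n) -> nm (series u n) <= series b n.
Proof. by move=> ub; rewrite seriesCE seriesRE; apply: le_trans (nm_sum _ _ _) (ler_sum _ _). Qed.

(** Completeness is applied to the real and imaginary parts separately, each dominated by [b]. *)
Lemma abs_cvg u b : (forall n, nm (u n) <= b n) -> cvgn (series b) ->
  exists l : C, series u @ \oo --> l.
Proof.
move=> ub cb.
have cRe : cvgn (series (fun n => complex.Re (u n))).
  apply: normed_cvg; apply: (series_le_cvg _ _ _ cb) => n //=.
    by apply: le_trans (ub n); exact: nm_ge0.
  by apply: le_trans (ub n); exact: nm_Re.
have cIm : cvgn (series (fun n => complex.Im (u n))).
  apply: normed_cvg; apply: (series_le_cvg _ _ _ cb) => n //=.
    by apply: le_trans (ub n); exact: nm_ge0.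
  by apply: le_trans (ub n); exact: nm_Im.
exists (limn (series (fun n => complex.Re (u n))) +i* limn (series (fun n => complex.Im (u n)))).
apply: cvgC_ReIm.
  have -> : (fun n => complex.Re (series u n)) = series (fun n => complex.Re (u n)).
    apply/funext => n; rewrite seriesCE seriesRE.
    by apply: (big_morph (@complex.Re R)) => // -[? ?] [? ?].
  exact: cRe.
have -> : (fun n => complex.Im (series u n)) = series (fun n => complex.Im (u n)).
  apply/funext => n; rewrite seriesCE seriesRE.
  by apply: (big_morph (@complex.Im R)) => // -[? ?] [? ?].
exact: cIm.
Qed.

Lemma series_le_lim b s n : (forall n, 0 <= b n) -> series b @ \oo --> s ->
  series b n <= s.
Proof.
move=> b0 bs; rewrite -(cvg_lim (@Rhausdorff _) bs).
apply: nondecreasing_cvgn_le; last by apply/cvg_ex; exists s.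
by apply/nondecreasing_seqP => m; rewrite !seriesRE big_ord_recr /= lerDl.
Qed.

Lemma nm_series_le u b (l : C) (s : R) : (forall n, nm (u n) <= b n) ->
  series u @ \oo --> l -> series b @ \oo --> s -> nm l <= s.
Proof.
move=> ub ul bs; apply: (cvgC_nm_le ul); exists 0%N => n _.
apply: le_trans (nm_series _ ub) _; apply: series_le_lim bs => k.
by apply: le_trans (ub k); exact: nm_ge0.
Qed.

Lemma addDBK (V : zmodType) (x y : V) : x + y - x = y.
Proof. by rewrite addrAC subrr add0r. Qed.

Lemma series_tail (V : zmodType) (f : nat -> V) M L : (M <= L)%N ->
  series f L = series f M + \sum_(M <= k < L) f k.
Proof. by move=> ML; rewrite /series /= (@big_cat_nat _ _ _ M). Qed.

(** Dominated convergence for sums whose length grows with the parameter: beyond [M] the sums and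
    the limit series are controlled by the tail of [b], so only finitely many terms have to
    converge. It turns the finite sums of [csc2_sym] into a series. *)
Lemma tannery (f : nat -> nat -> C) (g : nat -> C) (K : nat -> nat) b (l : C) :
  (forall k, (fun n => f k n) @ \oo --> g k) ->
  (forall k n, (k < K n)%N -> nm (f k n) <= b k) ->
  (forall M, exists N, forall n, (N <= n)%N -> (M <= K n)%N) ->
  cvgn (series b) -> series g @ \oo --> l ->
  (fun n => \sum_(k < K n) f k n) @ \oo --> l.
Proof.
move=> fg fb Kn /cvg_ex[/= s bs] gl.
have b0 k : 0 <= b k.
  have [N HN] := Kn k.+1; apply: le_trans (nm_ge0 (f k N)) (fb _ _ _); exact: HN.
have gb k : nm (g k) <= b k.
  apply: (cvgC_nm_le (fg k)); have [N HN] := Kn k.+1.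
  by exists N => n Nn; apply: fb; exact: HN.
apply/cvgCP => e e0.
have e40 : 0 < e / 4 by rewrite divr_gt0.
have [M0 HM0] := (iffLR (cvgRP _ _)) bs _ e40.
set M := M0.
have tail L : (M <= L)%N -> \sum_(M <= k < L) b k < e / 4.
  move=> ML; have := HM0 _ (leqnn M); have := series_le_lim L b0 bs.
  rewrite (series_tail _ ML) => h1; rewrite distrC ger0_norm.
    by rewrite -/M; lra.
  rewrite subr_ge0; exact: series_le_lim.
have tl u L : (forall k, (k < L)%N -> nm (u k) <= b k) -> (M <= L)%N -> nm (\sum_(M <= k < L) u k) < e / 4.
  move=> ub ML; apply: le_lt_trans (tail _ ML); apply: le_trans (nm_sum _ _ _) _.
  by rewrite !big_nat; apply: ler_sum => k /andP[_ kL]; exact: ub.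
have fin : (fun n => \sum_(k < M) f k n) @ \oo --> series g M.
  rewrite seriesCE; exact: (@cvgC_sum f g).
have [N1 HN1] := (iffLR (cvgCP _ _)) fin _ e40.
have [N2 HN2] := Kn M.
exists (maxn N1 N2) => n; rewrite geq_max => /andP[n1 n2].
have hf : nm (\sum_(k < K n) f k n - \sum_(k < M) f k n) < e / 4.
  have -> : \sum_(k < K n) f k n - \sum_(k < M) f k n = \sum_(M <= k < K n) f k n.
    rewrite -!(big_mkord xpredT (fun k => f k n)) (@big_cat_nat _ _ _ M) //= ?HN2 //.
    by rewrite addDBK.
  by apply: tl => [k kK|]; [exact: fb|exact: HN2].
have hg : nm (series g M - l) <= e / 4.
  rewrite nmB.
  have gl' : (fun L => series g L - series g M) @ \oo --> l - series g M.
    exact: (@cvgCBl (series g) l (series g M) gl).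
  apply: (cvgC_nm_le gl'); exists M => L ML.
  rewrite (series_tail _ ML) addDBK ltW //; apply: tl => // k _; exact: gb.
have h3 : nm (\sum_(k < M) f k n - series g M) < e / 4 := HN1 _ n1.
have -> : \sum_(k < K n) f k n - l = (\sum_(k < K n) f k n - \sum_(k < M) f k n) +
   ((\sum_(k < M) f k n - series g M) + (series g M - l)) by ring.
apply: le_lt_trans (nmD _ _) _.
have := nmD (\sum_(k < M) f k n - series g M) (series g M - l).
by move=> h4; move: e0 hf h3 hg h4; clear; lra.
Qed.

(** A majorant of product form is available in every application. Truncating all rows at [N] costs
    at most [al m] times the tail of [be] in row [m], hence [sa] times that tail in total, and this
    tends to 0. *)
Lemma fubini_prod (a : nat -> nat -> C) (al be : nat -> R) (r c : nat -> C) :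
  (forall m, 0 <= al m) -> (forall n, 0 <= be n) ->
  (forall m n, nm (a m n) <= al m * be n) ->
  cvgn (series al) -> cvgn (series be) ->
  (forall m, series (a m) @ \oo --> r m) ->
  (forall n, series (fun m => a m n) @ \oo --> c n) ->
  exists S : C, series r @ \oo --> S /\ series c @ \oo --> S.
Proof.
move=> al0 be0 ab /cvg_ex[/= sa ha] /cvg_ex[/= sb hb] hr hc.
have sZ (b : nat -> R) k s : series b @ \oo --> s ->
    series (fun n => k * b n) @ \oo --> k * s.
  move=> hs; have -> : series (fun n => k * b n) = (fun n => k * series b n).
    by apply/funext => n; rewrite !seriesRE mulr_sumr.
  by apply: cvgM => //; exact: cvg_cst.
have rb m : nm (r m) <= sb * al m.
  by rewrite mulrC; apply: (nm_series_le (ab m) (hr m)); exact: sZ.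
have /abs_cvg[|S hS] := rb; first by apply/cvg_ex; exists (sb * sa); exact: sZ.
exists S; split => //.
apply: (cvgC_squeeze (a := fun N => sa * (sb - series be N))); last first.
  rewrite -[0](mulr0 sa) -(subrr sb); exact: (cvgM (cvg_cst sa) (cvgB (cvg_cst sb) hb)).
exists 0%N => N _; rewrite nmB.
have h1 : series (fun m => r m - \sum_(n < N) a m n) @ \oo --> S - series c N.
  have -> : series (fun m => r m - \sum_(n < N) a m n) =
      (fun M => series r M - \sum_(n < N) series (a^~ n) M).
    apply/funext => M; rewrite !seriesCE sumrB exchange_big /=; congr (_ - _).
    by apply: eq_bigr => n _; rewrite seriesCE.
  apply: (@cvgCB (series r) (fun M => \sum_(n < N) series (a^~ n) M) S (series c N) hS).
  rewrite seriesCE.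
  exact: (@cvgC_sum (fun n => series (a^~ n)) c).
have h2 : series (fun m => (sb - series be N) * al m) @ \oo --> (sb - series be N) * sa.
  exact: sZ.
rewrite mulrC; apply: (nm_series_le _ h1 h2) => m.
have h3 : (fun L => series (a m) L - series (a m) N) @ \oo --> r m - series (a m) N.
  exact: (@cvgCBl (series (a m)) (r m) (series (a m) N) (hr m)).
rewrite -seriesCE; apply: (cvgC_nm_le h3); exists N => L NL.
rewrite (series_tail _ NL) addDBK; apply: le_trans (nm_sum _ _ _) _.
apply: (@le_trans _ _ (\sum_(N <= k < L) al m * be k)).
  by apply: ler_sum => k _; exact: ab.
rewrite -mulr_sumr mulrC ler_wpM2r //.
by rewrite lerBrDl -(series_tail _ NL); exact: series_le_lim.
Qed.

End ComplexModulus.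

(** * Analytic functions on the unit disc *)

Section PowerSeries.
Variable R : realType.
Notation C := (cplx R).
Implicit Types (x y z w : C) (a b : nat -> C) (f g h : C -> C) (r s : R).

Lemma cexpD z w : cexp (z + w) = cexp z * cexp w :> C.
Proof.
case: z w => [a b] [c d]; rewrite /cexp /= expRD cosD sinD.
apply/eqP; rewrite eq_complex /=; apply/andP; split; apply/eqP; ring.
Qed.
Lemma cexp0 : cexp 0 = 1 :> C.
Proof. by rewrite /cexp /= expR0 cos0 sin0 mul1r mulr0. Qed.
Lemma nm_cexp z : nm (cexp z) = expR (complex.Re z).
Proof.
apply/eqP; rewrite -(eqrXn2 (n := 2)) ?nm_ge0 ?expR_ge0 //.
by rewrite nm_sqr /= !exprMn -mulrDr cos2Dsin2 mulr1.
Qed.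
Lemma cexp_neq0 z : cexp z != 0.
Proof. by rewrite -nm_eq0 nm_cexp gt_eqF ?expR_gt0. Qed.
Lemma cexpN z : cexp (- z) = (cexp z)^-1.
Proof. by apply: (mulfI (cexp_neq0 z)); rewrite -cexpD subrr cexp0 mulfV ?cexp_neq0. Qed.
Lemma cexpMn z n : cexp (n%:R * z) = cexp z ^+ n.
Proof.
by elim: n => [|n IH]; rewrite ?mul0r ?cexp0 // -natr1 mulrDl mul1r cexpD IH exprSr.
Qed.
Lemma cexp_pi : cexp (0 +i* pi) = -1 :> C.
Proof.
rewrite /cexp /= expR0 cospi sinpi !mul1r; apply/eqP; rewrite eq_complex /=.
by rewrite oppr0 !eqxx.
Qed.

Lemma geo_cvg (B rho : R) : 0 <= rho < 1 ->
  series (fun n => B * rho ^+ n) @ \oo --> B * (1 - rho)^-1.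
Proof. by move=> /andP[r0 r1]; apply: (@cvg_geometric_series R B rho); rewrite ger0_norm. Qed.
Lemma geo_cvgn (B rho : R) : 0 <= rho < 1 -> cvgn (series (fun n => B * rho ^+ n)).
Proof. by move=> h; apply/cvg_ex; eexists; exact: geo_cvg h. Qed.

Arguments geo_cvg B {rho} _.
Arguments geo_cvgn B {rho} _.

(** This says that the radius of convergence is at least 1. Boundedness is what the convergence of a
    Fourier series at a single point yields directly. *)
Definition psb a := forall r, 0 < r < 1 -> exists B, forall n, nm (a n) * r ^+ n <= B.
Definition hasps a f := psb a /\
  forall w, nm w < 1 -> series (fun n => a n * w ^+ n) @ \oo --> f w.
(* Only the values of [f] on the open unit disc matter. *)
Definition ana f := exists a, hasps a f.

(** A radius strictly between [s] and 1 turns boundedness into geometric decay; the midpoint [r]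
    gives the ratio [s / r]. *)
Lemma psb_dom a s : psb a -> 0 <= s < 1 -> exists B rho : R,
  [/\ 0 <= B, 0 <= rho < 1 & forall n, nm (a n) * s ^+ n <= B * rho ^+ n].
Proof.
move=> ha /andP[s0 s1]; set r := (s + 1) / 2.
have r0 : 0 < r by rewrite /r; lra.
have [|B HB] := ha r; first by rewrite /r; lra.
exists B, (s / r); split.
- by apply: le_trans (HB 0%N); rewrite mulr_ge0 ?nm_ge0 ?exprn_ge0 ?ltW.
- apply/andP; split; first by rewrite divr_ge0 // ltW.
  by rewrite ltr_pdivrMr // mul1r /r; lra.
- move=> n; rewrite expr_div_n mulrA ler_pdivlMr ?exprn_gt0 // mulrAC.
  by rewrite ler_wpM2r ?exprn_ge0.
Qed.

Lemma psb_cvg a w : psb a -> nm w < 1 -> exists l : C,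
  series (fun n => a n * w ^+ n) @ \oo --> l.
Proof.
move=> ha w1; have [|B [rho [B0 rho1 H]]] := psb_dom (s := nm w) ha; first by rewrite nm_ge0.
by apply: (abs_cvg _ (geo_cvgn B rho1)) => n; rewrite nmM nmX.
Qed.

Lemma hasps_ex a : psb a -> exists f, hasps a f.
Proof.
move=> ha; exists (fun w => lim (series (fun n => a n * w ^+ n) @ \oo)); split => // w w1.
by have [l hl] := psb_cvg ha w1; rewrite (cvg_lim _ hl) //; exact: norm_hausdorff.
Qed.

Lemma hasps_ext a f g : (forall w, nm w < 1 -> f w = g w) -> hasps a f -> hasps a g.
Proof.
move=> fg [ha H]; split; first exact: ha.
by move=> w w1; rewrite -(fg w w1); exact: (H w w1).
Qed.
Lemma ana_ext f g : (forall w, nm w < 1 -> f w = g w) -> ana f -> ana g.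
Proof. by move=> fg [a ha]; exists a; exact: hasps_ext ha. Qed.

Lemma hasps_bnd a f r : hasps a f -> 0 <= r < 1 ->
  exists B, forall w, nm w <= r -> nm (f w) <= B.
Proof.
move=> [ha H] /andP[r0 r1].
have [|B [rho [B0 rho1 HB]]] := psb_dom (s := r) ha; first by rewrite r0.
exists (B * (1 - rho)^-1) => w wr.
apply: (nm_series_le _ (H w (le_lt_trans wr r1)) (geo_cvg B rho1)) => n.
rewrite nmM nmX; apply: le_trans (HB n); rewrite ler_wpM2l ?nm_ge0 //.
by rewrite lerXn2r ?nnegrE ?nm_ge0.
Qed.
Lemma ana_bnd f r : ana f -> 0 <= r < 1 -> exists B, forall w, nm w <= r -> nm (f w) <= B.
Proof. by move=> [a ha]; exact: hasps_bnd ha. Qed.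

(** Write [d] as 2^v times an odd number, with v at most [j]. If [z ^ d] were 1, raising it to the
    power 2^(j - v) would give an odd power of -1 equal to 1. *)
Lemma root2_prim (z : C) j d : z ^+ (2 ^ j) = -1 -> (0 < d < 2 ^ j.+1)%N -> z ^+ d != 1.
Proof.
move=> zj /andP[d0 dj]; apply/eqP => zd.
have [od cod] := pfactor_coprime (isT : prime 2) d0; move: (logn 2 d) => v hov.
have oo : odd od by rewrite -coprime2n.
have vj : (v <= j)%N.
  rewrite -ltnS -(ltn_exp2l _ _ (isT : (1 < 2)%N)); apply: leq_ltn_trans dj.
  rewrite hov leq_pmull //; by case: (od) oo.
have : z ^+ (d * 2 ^ (j - v)) = 1 by rewrite exprM zd expr1n.
rewrite hov -mulnA -expnD subnKC // mulnC exprM zj -signr_odd oo expr1.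
move=> /eqP; rewrite eq_sym -subr_eq0 opprK -(natrD _ 1 1) pnatr_eq0 //.
Qed.

Lemma nm_mul1 x y : nm y <= 1 -> nm (x * y) <= nm x.
Proof. by move=> y1; rewrite nmM ler_piMr ?nm_ge0. Qed.

Lemma sum_root (x : C) N : x != 1 -> x ^+ N = 1 -> \sum_(j < N) x ^+ j = 0.
Proof.
move=> x1 xN; have := subrX1 x N; rewrite xN subrr => /esym/eqP.
by rewrite mulf_eq0 subr_eq0 (negPf x1) => /eqP.
Qed.

(* Averaging f over the N-th roots of unity, N a power of 2, isolates a n up to
   coefficients of index at least N. *)
Lemma cauchy_est a f r (M : R) n : hasps a f -> 0 < r < 1 ->
  (forall t : R, nm (f (r%:C * cexp (0 +i* t))) <= M) -> nm (a n) * r ^+ n <= M.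
Proof.
move=> [ha H] /andP[r0 r1] fM.
have [|B [rho [B0 rho1 HB]]] := psb_dom (s := r) ha; first by rewrite ltW.
apply/ler_addgt0Pr => e e0.
have [N1 HN1] := (iffLR (cvgRP _ _)) (geo_cvg B rho1) _ e0.
pose j := maxn N1 n; pose N := (2 ^ j.+1)%N.
have N0 : (0 < N)%N by rewrite expn_gt0.
have jN : (j < N)%N by apply: ltn_trans (ltnSn j) (ltn_expl _ _).
have nN : (n < N)%N by apply: leq_ltn_trans jN; exact: leq_maxr.
have N1N : (N1 <= N)%N by apply: leq_trans (ltnW jN); exact: leq_maxl.
have NC0 : (N%:R : C) != 0 by rewrite pnatr_eq0 -lt0n.
pose t : R := pi / (2 ^ j)%:R.
pose z : C := cexp (0 +i* t).
have zX k : z ^+ k = cexp (0 +i* (k%:R * t)).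
  by rewrite -cexpMn; congr cexp; apply/eqP; rewrite eq_complex /= -(rmorph_nat (real_complex R)) /= !mul0r subr0 mulr0 addr0 !eqxx.
have zj : z ^+ (2 ^ j) = -1.
  by rewrite zX /t mulrC divfK ?pnatr_eq0 -?lt0n ?expn_gt0 // cexp_pi.
have zN : z ^+ N = 1 by rewrite /N expnSr exprM zj sqrrN expr1n.
have z0 : z != 0 by exact: cexp_neq0.
have nz : nm z = 1 by rewrite nm_cexp /= expR0.
pose xx k := z ^+ k / z ^+ n.
(* [ek k] is the average of z^(k - n) over the roots of unity: 1 for [k = n], 0 for the other
   [k < N], of modulus at most 1 in general. Hence the discrete Cauchy integral [L] below differs
   from [a n * r ^ n] by a tail of small modulus. *)
pose ek k : C := N%:R^-1 * \sum_(i < N) xx k ^+ i.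
have xN k : xx k ^+ N = 1 by rewrite /xx expr_div_n -!exprM !(mulnC _ N) !exprM zN !expr1n divr1.
have en : ek n = 1.
  rewrite /ek /xx (eq_bigr (fun=> 1)); last by move=> i _; rewrite mulfV ?expf_neq0 // expr1n.
  by rewrite sumr_const card_ord mulVf.
have zlt m k : (m < k)%N -> (k < N)%N -> z ^+ k != z ^+ m.
  move=> mk kN; rewrite -(subnKC (ltnW mk)) exprD -[X in _ != X]mulr1 (inj_eq (mulfI (expf_neq0 _ z0))).
  by apply: (root2_prim zj); rewrite subn_gt0 mk /= (leq_ltn_trans (leq_subr _ _)).
have e0k k : (k < N)%N -> k != n -> ek k = 0.
  move=> kN kn; rewrite /ek sum_root ?mulr0 // /xx.
  apply/eqP => /(congr1 (fun u => u * z ^+ n)); rewrite mul1r divfK ?expf_neq0 //.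
  move: kn; rewrite neq_ltn => /orP[lt|lt] /eqP; last by apply/negP; exact: zlt.
  by rewrite eq_sym; apply/negP; exact: zlt.
have nek k : nm (ek k) <= 1.
  rewrite /ek nmM nmV nm_nat mulrC ler_pdivrMr ?ltr0n // mul1r.
  apply: le_trans (nm_sum _ _ _) _.
  rewrite (eq_bigr (fun=> 1)); first by rewrite sumr_const card_ord.
  by move=> i _; rewrite nmX /xx nmM nmV !nmX nz !expr1n invr1 mulr1 expr1n.
pose pt i := r%:C * z ^+ i.
have npt i : nm (pt i) = r by rewrite nmM nm_real nmX nz expr1n mulr1 gtr0_norm.
pose L : C := N%:R^-1 * \sum_(i < N) f (pt i) * (z ^+ n) ^- i.
have LM : nm L <= M.
  rewrite /L nmM nmV nm_nat mulrC ler_pdivrMr ?ltr0n //.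
  apply: le_trans (nm_sum _ _ _) _.
  apply: (@le_trans _ _ (\sum_(i < N) M)); last by rewrite sumr_const card_ord mulr_natr.
  apply: ler_sum => i _; rewrite nmM nmV !nmX nz !expr1n invr1 mulr1 /pt zX; exact: fM.
have hL : series (fun k => a k * r%:C ^+ k * ek k) @ \oo --> L.
  have -> : series (fun k => a k * r%:C ^+ k * ek k) = (fun K => N%:R^-1 *
      \sum_(i < N) (z ^+ n) ^- i * series (fun k => a k * pt i ^+ k) K).
    apply/funext => K; rewrite seriesCE.
    transitivity (N%:R^-1 * \sum_(i < N) \sum_(k < K) (z ^+ n) ^- i * (a k * pt i ^+ k)).
      rewrite exchange_big mulr_sumr; apply: eq_bigr => k _.
      rewrite /ek mulrCA; congr (_ * _); rewrite mulr_sumr; apply: eq_bigr => i _.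
      rewrite /xx /pt expr_div_n exprMn -!exprM (mulnC i k); ring.
    by congr (_ * _); apply: eq_bigr => i _; rewrite seriesCE mulr_sumr.
  rewrite /L; under eq_bigr do rewrite mulrC.
  apply: (@cvgCZ _ (fun K => \sum_(i < N) (z ^+ n) ^- i * series (fun k => a k * pt i ^+ k) K)).
  apply: (@cvgC_sum _ (fun i K => (z ^+ n) ^- i * series (fun k => a k * pt i ^+ k) K)
    (fun i => (z ^+ n) ^- i * f (pt i))) => i.
  apply: (@cvgCZ _ (series (fun k => a k * pt i ^+ k))); apply: H; by rewrite npt.
have hd := @cvgCBl _ _ _ (a n * r%:C ^+ n) hL.
have tl : nm (L - a n * r%:C ^+ n) <= e.
  apply: (cvgC_nm_le hd); exists N => K NK.
  rewrite (series_tail _ NK).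
  have -> : series (fun k => a k * r%:C ^+ k * ek k) N = a n * r%:C ^+ n.
    rewrite seriesCE (bigD1 (Ordinal nN)) //= en mulr1 big1 ?addr0 // => i ni.
    by rewrite e0k ?mulr0.
  rewrite addDBK; apply: le_trans (nm_sum _ _ _) _.
  apply: (@le_trans _ _ (\sum_(N <= k < K) B * rho ^+ k)).
    apply: ler_sum => k _; apply: le_trans (HB k).
    apply: le_trans (nm_mul1 _ (nek k)) _.
    by rewrite nmM nmX nm_real gtr0_norm.
  rewrite -(addDBK (series (fun k => B * rho ^+ k) N) (\sum_(N <= k < K) _)) -series_tail //.
  have b0 k : 0 <= B * rho ^+ k by rewrite mulr_ge0 ?exprn_ge0 //; case/andP: rho1.
  have h1 := series_le_lim K b0 (geo_cvg B rho1).
  have := HN1 _ N1N; have h2 := series_le_lim N b0 (geo_cvg B rho1).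
  by rewrite distrC ger0_norm ?subr_ge0 //; move: h1 h2; clear; lra.
have -> : nm (a n) * r ^+ n = nm (a n * r%:C ^+ n).
  by rewrite nmM nmX nm_real gtr0_norm.
have := nm_sub (a n * r%:C ^+ n) L; rewrite nmB.
by move: tl LM; clear; lra.
Qed.

End PowerSeries.

Arguments geo_cvg {R} B {rho} _.
Arguments geo_cvgn {R} B {rho} _.

(** * Closure properties of analytic functions *)

Section Analytic.
Variable R : realType.
Notation C := (cplx R).
Implicit Types (x y z w : C) (a b : nat -> C) (f g h : C -> C) (r s : R).

(** The hypothesis of the Weierstrass test, with geometric majorants uniform on each smaller
    disc. *)
Definition mbound (g : nat -> C -> C) := forall r, 0 < r < 1 -> exists K rho : R,
  0 <= rho < 1 /\ forall m w, nm w <= r -> nm (g m w) <= K * rho ^+ m.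

Lemma mid_lt1 w : nm w < 1 -> exists r : R, [/\ 0 < r < 1, nm w < r & nm w <= r].
Proof.
move=> w1; have w0 := nm_ge0 w; exists ((nm w + 1) / 2).
by split; [apply/andP; split| |]; lra.
Qed.

(** Weierstrass' theorem: Cauchy's estimates transfer the majorant of [g m] to its coefficients, and
    then the sum over [m] and the sum over the powers of [w] may be exchanged. *)
Lemma ana_mtest (g : nat -> C -> C) f : (forall m, ana (g m)) -> mbound g ->
  (forall w, nm w < 1 -> series (fun m => g m w) @ \oo --> f w) -> ana f.
Proof.
move=> hg gb gf; have [am ham] := choice hg.
have cau r : 0 < r < 1 -> exists K rho : R, [/\ 0 <= K, 0 <= rho < 1 &
    forall m n, nm (am m n) * r ^+ n <= K * rho ^+ m].
  move=> r01; have [K [rho [rho1 HK]]] := gb r r01; exists K, rho; split => //.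
    have := HK 0%N 0; rewrite expr0 mulr1 nm0 => /(_ _)/(le_trans (nm_ge0 _)); apply.
    by case/andP: r01 => /ltW.
  move=> m n; apply: (cauchy_est n (ham m) r01) => t; apply: HK.
  case/andP: r01 => r0 _; rewrite nmM nm_real nm_cexp /= expR0 mulr1 gtr0_norm //.
have rowc n : exists l : C, series (fun m => am m n) @ \oo --> l.
  have [|K [rho [K0 rho1 HK]]] := cau (1 / 2); first by apply/andP; split; lra.
  apply: (@abs_cvg _ _ (fun m => K / (1 / 2) ^+ n * rho ^+ m)); last exact: geo_cvgn.
  by move=> m; rewrite mulrAC ler_pdivlMr ?exprn_gt0 //; lra.
have [c hc] := choice rowc.
exists c; split.
  move=> r r01; have [K [rho [K0 rho1 HK]]] := cau r r01.
  exists (K * (1 - rho)^-1) => n; have r0 : 0 < r ^+ n by case/andP: r01 => r0 _; exact: exprn_gt0.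
  rewrite -ler_pdivlMr // mulrAC.
  apply: (nm_series_le _ (hc n) (geo_cvg (K / r ^+ n) rho1)) => m.
  by rewrite mulrAC ler_pdivlMr.
move=> w w1; have [r [r01 wr _]] := mid_lt1 w1.
have [K [rho [K0 rho1 HK]]] := cau r r01.
have r0 : 0 < r by case/andP: r01.
have wr1 : 0 <= nm w / r < 1.
  by rewrite divr_ge0 ?nm_ge0 ?(ltW r0) //= ltr_pdivrMr // mul1r.
have [] := @fubini_prod _ (fun m n => am m n * w ^+ n) (fun m => K * rho ^+ m)
  (fun n => 1 * (nm w / r) ^+ n) (fun m => g m w) (fun n => c n * w ^+ n).
- by move=> m; rewrite mulr_ge0 ?exprn_ge0 //; case/andP: rho1.
- by move=> n; rewrite mul1r exprn_ge0 //; case/andP: wr1.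
- move=> m n; rewrite nmM nmX mul1r expr_div_n mulrA ler_pdivlMr ?exprn_gt0 // mulrAC.
  by rewrite ler_wpM2r ?exprn_ge0 ?nm_ge0.
- exact: geo_cvgn.
- exact: geo_cvgn.
- by move=> m; case: (ham m) => _; apply.
- move=> n; have := @cvgCZ _ _ _ (w ^+ n) (hc n); rewrite (mulrC (w ^+ n)).
  apply: cvgC_eq; exists 0%N => M _; rewrite !seriesCE mulr_sumr.
  by apply: eq_bigr => m _; rewrite mulrC.
move=> S [h1 h2]; by rewrite (cvgC_unique (gf w w1) h1).
Qed.

Lemma mbound_cvg (g : nat -> C -> C) w : mbound g -> nm w < 1 -> exists l : C, series (fun m => g m w) @ \oo --> l.
Proof.
move=> gb w1; have [r [r01 _ wr]] := mid_lt1 w1.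
have [K [rho [rho1 HK]]] := gb r r01.
by apply: (abs_cvg _ (geo_cvgn K rho1)) => m; exact: HK.
Qed.

Lemma ana_mtest_ex (g : nat -> C -> C) : (forall m, ana (g m)) -> mbound g ->
  exists f, ana f /\ forall w, nm w < 1 -> series (fun m => g m w) @ \oo --> f w.
Proof.
move=> hg gb; pose f w : C := lim (series (fun m => g m w) @ \oo).
have hf w : nm w < 1 -> series (fun m => g m w) @ \oo --> f w.
  by move=> w1; have [l hl] := mbound_cvg gb w1; rewrite /f (cvg_lim _ hl) //; exact: norm_hausdorff.
by exists f; split => //; exact: (ana_mtest hg gb hf).
Qed.

Lemma ana_mono (c : C) k : ana (fun w => c * w ^+ k).
Proof.
exists (fun n => if n == k then c else 0); split.
  move=> r /andP[r0 r1]; exists (nm c) => n; case: eqP => _.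
    by rewrite ler_piMr ?nm_ge0 // exprn_ile1 ?ltW.
  by rewrite nm0 mul0r nm_ge0.
move=> w _; apply: (@cvgC_eq _ (fun=> c * w ^+ k)); last exact: cvgC_cst.
exists k.+1 => n kn; rewrite seriesCE (bigD1 (Ordinal kn)) //= eqxx big1 ?addr0 // => i ik.
by rewrite ifN ?mul0r.
Qed.

Lemma ana_cst (c : C) : ana (fun=> c).
Proof. by apply: ana_ext (ana_mono c 0) => w _; rewrite expr0 mulr1. Qed.

Lemma ana_id : ana (fun w => w).
Proof. by apply: ana_ext (ana_mono 1 1) => w _; rewrite expr1 mul1r. Qed.

Lemma haspsD a b f g : hasps a f -> hasps b g -> hasps (fun n => a n + b n) (fun w => f w + g w).
Proof.
move=> [ha Ha] [hb Hb]; split.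
  move=> r r01; have [A HA] := ha r r01; have [B HB] := hb r r01; exists (A + B) => n.
  have r0 : 0 <= r ^+ n by case/andP: r01 => /ltW r0 _; rewrite exprn_ge0.
  apply: (@le_trans _ _ ((nm (a n) + nm (b n)) * r ^+ n)); first by rewrite ler_wpM2r ?nmD.
  by rewrite mulrDl lerD.
move=> w w1; have := cvgCD (Ha w w1) (Hb w w1); apply: cvgC_eq; exists 0%N => n _.
by rewrite !seriesCE -big_split; apply: eq_bigr => i _; rewrite mulrDl.
Qed.

Lemma haspsZ a f (c : C) : hasps a f -> hasps (fun n => c * a n) (fun w => c * f w).
Proof.
move=> [ha Ha]; split.
  move=> r r01; have [A HA] := ha r r01; exists (nm c * A) => n.
  by rewrite nmM -mulrA ler_wpM2l ?nm_ge0.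
move=> w w1; have := @cvgCZ _ _ _ c (Ha w w1); apply: cvgC_eq; exists 0%N => n _.
by rewrite !seriesCE mulr_sumr; apply: eq_bigr => i _; rewrite mulrA.
Qed.

Lemma anaD f g : ana f -> ana g -> ana (fun w => f w + g w).
Proof. by move=> [a ha] [b hb]; eexists; exact: haspsD ha hb. Qed.
Lemma anaZ (c : C) f : ana f -> ana (fun w => c * f w).
Proof. by move=> [a ha]; eexists; exact: haspsZ ha. Qed.
Lemma anaN f : ana f -> ana (fun w => - f w).
Proof. by move=> /(anaZ (-1)); apply: ana_ext => w _; rewrite mulN1r. Qed.
Lemma anaB f g : ana f -> ana g -> ana (fun w => f w - g w).
Proof. by move=> hf /anaN; exact: anaD. Qed.

Lemma mono_mbound a k : psb a -> mbound (fun m w => a m * w ^+ (m + k)).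
Proof.
move=> ha r /andP[r0 r1]; have [|B [rho [B0 rho1 HB]]] := psb_dom (s := r) ha.
  by rewrite ltW.
exists B, rho; split => // m w wr; rewrite nmM nmX; apply: le_trans (HB m).
rewrite ler_wpM2l ?nm_ge0 // exprD -[X in _ <= X]mulr1.
have wk : nm w ^+ k <= 1 by rewrite exprn_ile1 ?nm_ge0 // (le_trans wr) ?ltW.
by apply: ler_pM; rewrite ?exprn_ge0 ?nm_ge0 // lerXn2r // nnegrE ?nm_ge0 // ltW.
Qed.

Lemma ana_monoM k h : ana h -> ana (fun w => w ^+ k * h w).
Proof.
move=> [a [ha Ha]].
apply: (ana_mtest (g := fun m w => a m * w ^+ (m + k))).
- by move=> m; exact: ana_mono.
- exact: mono_mbound.
- move=> w w1; have := @cvgCZ _ _ _ (w ^+ k) (Ha w w1); apply: cvgC_eq; exists 0%N => n _.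
  by rewrite !seriesCE mulr_sumr; apply: eq_bigr => i _; rewrite exprD; ring.
Qed.

(** No Cauchy product is formed: the product is the series of the functions a_m w^m h(w), to which
    the Weierstrass test applies. *)
Lemma anaM f h : ana f -> ana h -> ana (fun w => f w * h w).
Proof.
move=> [a [ha Ha]] hh.
apply: (ana_mtest (g := fun m w => a m * (w ^+ m * h w))).
- by move=> m; apply: anaZ; exact: ana_monoM.
- move=> r r01; have [K [rho [rho1 HK]]] := mono_mbound 0 ha r01.
  have [|B HB] := ana_bnd (r := r) hh; first by case/andP: r01 => /ltW -> ->.
  exists (K * B), rho; split => // m w wr.
  have := HK m w wr; rewrite addn0 => h1.
  rewrite mulrAC mulrA nmM; apply: ler_pM; rewrite ?nm_ge0 //; exact: HB.
- move=> w w1; have := @cvgCZ _ _ _ (h w) (Ha w w1); rewrite mulrC; apply: cvgC_eq; exists 0%N => n _.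
  by rewrite !seriesCE mulr_sumr; apply: eq_bigr => i _; ring.
Qed.

Lemma anaX f n : ana f -> ana (fun w => f w ^+ n).
Proof.
move=> hf; elim: n => [|n IH]; first by apply: ana_ext (ana_cst 1) => w _; rewrite expr0.
by apply: ana_ext (anaM hf IH) => w _; rewrite exprS.
Qed.

Lemma ana_prod (I : Type) (s : seq I) (P : pred I) (F : I -> C -> C) : (forall i, ana (F i)) ->
  ana (fun w => \prod_(i <- s | P i) F i w).
Proof.
move=> hF; elim: s => [|i s IH].
  by apply: ana_ext (ana_cst 1) => w _; rewrite big_nil.
case Pi: (P i); last by apply: ana_ext IH => w _; rewrite big_cons Pi.
by apply: ana_ext (anaM (hF i) IH) => w _; rewrite big_cons Pi.
Qed.

(** Rotations and powers of the variable are what real translations and integer multiples of the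
    upper half-plane variable induce on nomes. *)
Lemma ana_comp (z : C) k f : (0 < k)%N -> nm z <= 1 -> ana f -> ana (fun w => f (z * w ^+ k)).
Proof.
move=> k0 z1 [a [ha Ha]].
have le w r : 0 <= r < 1 -> nm w <= r -> nm (z * w ^+ k) <= r.
  move=> /andP[r0 r1] wr; rewrite nmM nmX -[r]mul1r ler_pM ?nm_ge0 ?exprn_ge0 ?nm_ge0 //.
  rewrite -(prednK k0) exprS; apply: (le_trans _ wr); rewrite ler_piMr ?nm_ge0 //.
  by rewrite exprn_ile1 ?nm_ge0 // (le_trans wr) // ltW.
apply: (ana_mtest (g := fun m w => a m * (z * w ^+ k) ^+ m)).
- move=> m; apply: ana_ext (ana_mono (a m * z ^+ m) (k * m)) => w _.
  by rewrite exprMn exprM mulrA.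
- move=> r r01; have [K [rho [rho1 HK]]] := mono_mbound 0 ha r01.
  exists K, rho; split => // m w wr; have := HK m (z * w ^+ k); rewrite addn0; apply.
  by apply: le => //; case/andP: r01 => /ltW -> ->.
- move=> w w1; apply: Ha; apply: (le_lt_trans _ w1); apply: le => //.
  by rewrite nm_ge0 w1.
Qed.

Lemma expC_cvg0 w : nm w < 1 -> (fun n => w ^+ n) @ \oo --> (0 : C).
Proof.
move=> w1; apply: (cvgC_squeeze (a := fun n => nm w ^+ n)).
  by exists 0%N => n _; rewrite subr0 nmX.
by apply: (@cvg_expr R (nm w)); rewrite ger0_norm ?nm_ge0.
Qed.

Lemma ana_inv1B : ana (fun w => (1 - w)^-1).
Proof.
exists (fun=> 1); split.
  by move=> r /andP[r0 r1]; exists 1 => n; rewrite nm1 mul1r exprn_ile1 ?ltW.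
move=> w w1; have w10 : 1 - w != 0.
  by rewrite subr_eq0; apply/eqP => e; move: w1; rewrite -e nm1 ltxx.
have := @cvgCZ _ _ _ (1 - w)^-1 (@cvgCBr _ _ _ 1 (expC_cvg0 w1)).
rewrite subr0 mulr1; apply: cvgC_eq; exists 0%N => n _.
apply: (mulfI w10); rewrite mulVKf // seriesCE.
rewrite -opprB subrX1 -mulNr opprB; congr (_ * _); by apply: eq_bigr => i _; rewrite mul1r.
Qed.

End Analytic.

(** * Divided differences, zeros and the maximum principle *)

Section AnalyticOrder.
Variable R : realType.
Notation C := (cplx R).
Implicit Types (x y z w : C) (a b : nat -> C) (f g h : C -> C) (r s : R).

(** The factor m is absorbed by passing from [s] to a larger radius [t]: m copies of u^(m-1), with u
    = s / t, are at most 1 + u + ... + u^(m-1). This bounds the divided differences of x^m. *)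
Lemma natX_le s t m : 0 <= s -> s < t -> m%:R * s ^+ m.-1 <= (1 - s / t)^-1 * t^-1 * t ^+ m.
Proof.
move=> s0 st; have t0 : 0 < t by exact: le_lt_trans st.
have u1 : s / t < 1 by rewrite ltr_pdivrMr // mul1r.
have u0 : 0 <= s / t by rewrite divr_ge0 // ltW.
case: m => [|m]; first by rewrite mul0r !mulr_ge0 ?invr_ge0 ?exprn_ge0 ?subr_ge0 // ltW.
rewrite /= exprS mulrA mulfVK ?gt_eqF // -ler_pdivrMr ?exprn_gt0 // -mulrA -expr_div_n.
rewrite -[X in _ <= X]mul1r ler_pdivlMr ?subr_gt0 //.
apply: (@le_trans _ _ ((\sum_(i < m.+1) (s / t) ^+ i) * (1 - s / t))).
  rewrite ler_wpM2r ?subr_ge0 ?(ltW u1) // mulr_natl -[X in _ *+ X](card_ord m.+1) -sumr_const.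
  apply: ler_sum => i _; rewrite ler_wiXn2l ?(ltW u1) //; by rewrite -ltnS.
rewrite mulrC -opprB mulNr -subrX1 opprB lerBlDr lerDl exprn_ge0 //.
Qed.

Lemma ana_sum (I : Type) (s : seq I) (P : pred I) (F : I -> C -> C) : (forall i, ana (F i)) ->
  ana (fun w => \sum_(i <- s | P i) F i w).
Proof.
move=> hF; elim: s => [|i s IH].
  by apply: ana_ext (ana_cst 0) => w _; rewrite big_nil.
case Pi: (P i); last by apply: ana_ext IH => w _; rewrite big_cons Pi.
by apply: ana_ext (anaD (hF i) IH) => w _; rewrite big_cons Pi.
Qed.

(** The quotient is the series of the divided differences of x^m. This factorization stands in for
    differentiation: continuity, complex derivatives and the removal of zeros all come from it. *)
Lemma ana_factor f w : ana f -> nm w < 1 -> exists k, ana k /\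
  forall x, nm x < 1 -> f x - f w = (x - w) * k x.
Proof.
move=> [a [ha Ha]] w1.
pose g m x : C := a m * \sum_(i < m) x ^+ (m.-1 - i) * w ^+ i.
have gana m : ana (g m).
  apply: anaZ; apply: (@ana_sum _ _ _ (fun (i : 'I_m) x => x ^+ (m.-1 - i) * w ^+ i)) => i.
  by apply: ana_ext (ana_mono (w ^+ i) (m.-1 - i)) => x _; rewrite mulrC.
have gb : mbound g.
  move=> r /andP[r0 r1]; have [r' [/andP[r'0 r'1] _ wr']] := mid_lt1 w1.
  pose s := Num.max r r'; have s0 : 0 < s by rewrite lt_max r0.
  have s1 : s < 1 by rewrite gt_max r1.
  pose t := (s + 1) / 2; have st : s < t by rewrite /t; lra.
  have t1 : t < 1 by rewrite /t; lra.
  have t0 : 0 < t by exact: lt_trans st.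
  have [|B [rho [B0 rho1 HB]]] := psb_dom (s := t) ha; first by rewrite ltW.
  pose D := (1 - s / t)^-1 * t^-1.
  have D0 : 0 <= D by rewrite mulr_ge0 ?invr_ge0 ?(ltW t0) // subr_ge0 ler_pdivrMr // mul1r ltW.
  exists (D * B), rho; split => // m x xr; rewrite nmM.
  have xs : nm x <= s by rewrite le_max xr.
  have ws : nm w <= s by rewrite le_max wr' orbT.
  have h1 : nm (\sum_(i < m) x ^+ (m.-1 - i) * w ^+ i) <= D * t ^+ m.
    apply: le_trans (natX_le m (ltW s0) st); apply: le_trans (nm_sum _ _ _) _.
    rewrite mulr_natl -[X in _ *+ X](card_ord m) -sumr_const; apply: ler_sum => i _.
    rewrite nmM !nmX.
    have -> : s ^+ m.-1 = s ^+ (m.-1 - i) * s ^+ i.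
      by rewrite -exprD subnK // -ltnS prednK ?ltn_ord // (leq_ltn_trans _ (ltn_ord i)).
    by apply: ler_pM; rewrite ?exprn_ge0 ?nm_ge0 // lerXn2r // nnegrE ?nm_ge0 // ltW.
  apply: (@le_trans _ _ (nm (a m) * (D * t ^+ m))); first by rewrite ler_wpM2l ?nm_ge0.
  by rewrite mulrCA -(mulrA D B) ler_wpM2l.
have [k [kana hk]] := ana_mtest_ex gana gb.
exists k; split => // x x1.
apply: (@cvgC_unique _ _ _ _ (cvgCB (Ha x x1) (Ha w w1))).
have := @cvgCZ _ _ _ (x - w) (hk x x1); apply: cvgC_eq; exists 0%N => n _.
rewrite !seriesCE mulr_sumr -sumrB; apply: eq_bigr => m _.
rewrite /g -mulrBr mulrCA; congr (_ * _); rewrite subrXX; congr (_ * _).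
Qed.

Lemma hasps0 a f : hasps a f -> f 0 = a 0%N.
Proof.
move=> [ha Ha]; have z1 : nm (0 : C) < 1 by rewrite nm0.
apply: (@cvgC_unique _ _ _ _ (Ha 0 z1)).
apply: (@cvgC_eq _ (fun=> a 0%N)); last exact: cvgC_cst.
exists 1%N => -[//|n] _; rewrite seriesCE big_ord_recl expr0 mulr1 big1 ?addr0 // => i _.
by rewrite expr0n mulr0.
Qed.

(** Cauchy's estimate with bound 0, applied to the difference. *)
Lemma hasps_uniq a b f g : hasps a f -> hasps b g ->
  (forall w, nm w < 1 -> f w = g w) -> a = b.
Proof.
move=> ha hb fg; apply/funext => n.
have hd := haspsD ha (haspsZ (-1) hb).
have h2 : 0 < (1 / 2 : R) < 1 by apply/andP; split; lra.
have := @cauchy_est _ _ _ _ 0 n hd h2.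
rewrite pmulr_lle0 ?exprn_gt0 ?divr_gt0 // => h.
have : nm (a n + -1 * b n) = 0.
  apply/eqP; rewrite eq_le nm_ge0 andbT; apply: h => t.
  rewrite fg ?mulN1r ?subrr ?nm0 // nmM nm_real nm_cexp /= expR0 mulr1 ger0_norm; lra.
by move=> /eqP; rewrite nm_eq0 mulN1r subr_eq0 => /eqP.
Qed.

Lemma hasps_shift a f n : hasps a f -> (forall k, (k < n)%N -> a k = 0) ->
  exists f1, hasps (fun k => a (n + k)%N) f1 /\ forall w, nm w < 1 -> f w = w ^+ n * f1 w.
Proof.
move=> [ha Ha] a0.
have hb : psb (fun k => a (n + k)%N).
  move=> r r01; have [B HB] := ha r r01; exists (B / r ^+ n) => k.
  have r0 : 0 < r ^+ n by case/andP: r01 => r0 _; exact: exprn_gt0.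
  by rewrite ler_pdivlMr // -mulrA -exprD addnC.
have [f1 hf1] := hasps_ex hb; exists f1; split => // w w1.
apply: (@cvgC_unique _ _ _ _ (Ha w w1)).
have /cvgCP hs := @cvgCZ _ _ _ (w ^+ n) (proj2 hf1 w w1).
apply/cvgCP => e /hs [N HN]; exists (N + n)%N => m Nm.
have nm' : (n <= m)%N by apply: leq_trans Nm; exact: leq_addl.
have := HN (m - n)%N; rewrite leq_subRL // addnC => /(_ Nm).
suff -> : series (fun k => a k * w ^+ k) m = w ^+ n * series (fun k => a (n + k)%N * w ^+ k) (m - n)%N by [].
rewrite !seriesCE -[in LHS](subnKC nm') big_split_ord /= big1 ?add0r => [|i _]; last by rewrite a0 ?mul0r.
by rewrite mulr_sumr; apply: eq_bigr => i _; rewrite exprD; ring.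
Qed.

Lemma hasps_unshift b f1 n : hasps b f1 ->
  hasps (fun m => if (m < n)%N then 0 else b (m - n)%N) (fun w => w ^+ n * f1 w).
Proof.
move=> [hb Hb]; split.
  move=> r r01; have [B HB] := hb r r01; exists B => m; case/andP: r01 => r0 r1.
  case: ltnP => [_|nm'].
    by rewrite nm0 mul0r; apply: le_trans (HB 0%N); rewrite mulr_ge0 ?nm_ge0 ?exprn_ge0 // ltW.
  apply: le_trans (HB (m - n)%N); rewrite ler_wpM2l ?nm_ge0 // ler_wiXn2l ?(ltW r0) ?(ltW r1) //.
  exact: leq_subr.
move=> w w1; have /cvgCP hs := @cvgCZ _ _ _ (w ^+ n) (Hb w w1).
apply/cvgCP => e /hs [N HN]; exists (N + n)%N => m Nm.
have nm' : (n <= m)%N by apply: leq_trans Nm; exact: leq_addl.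
have := HN (m - n)%N; rewrite leq_subRL // addnC => /(_ Nm).
suff -> : series (fun m => (if (m < n)%N then 0 else b (m - n)%N) * w ^+ m) m =
    w ^+ n * series (fun k => b k * w ^+ k) (m - n)%N by [].
rewrite !seriesCE -[in LHS](subnKC nm') big_split_ord /= big1 ?add0r => [|i _].
  rewrite mulr_sumr; apply: eq_bigr => i _.
  by rewrite ltnNge leq_addr /= addnC addnK exprD; ring.
by rewrite ltn_ord mul0r.
Qed.

Lemma ana_order f : ana f -> (forall w, nm w < 1 -> f w = 0) \/
  exists n f1, [/\ ana f1, f1 0 != 0 & forall w, nm w < 1 -> f w = w ^+ n * f1 w].
Proof.
move=> [a ha]; case: (pselect (exists n, a n != 0)) => [ex|nex]; [right|left].
  have [n an min] := ex_minnP ex.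
  have [|f1 [hf1 Hf1]] := @hasps_shift a f n ha.
    by move=> k kn; apply/eqP; apply: contraTT kn => /min; rewrite -leqNgt.
  by exists n, f1; split => //; [eexists; exact: hf1|rewrite (hasps0 hf1) addn0].
have a0 n : a n = 0 by apply/eqP; apply: contrapT => /negP h; apply: nex; exists n.
move=> w w1; apply: (@cvgC_unique _ _ _ _ (proj2 ha w w1)).
apply: (@cvgC_eq _ (fun=> 0)); last exact: cvgC_cst.
by exists 0%N => n _; rewrite seriesCE big1 // => i _; rewrite a0 mul0r.
Qed.

Lemma ana_neq0_near f : ana f -> f 0 != 0 ->
  exists d : R, 0 < d < 1 /\ forall w, nm w < d -> f w != 0.
Proof.
move=> fana f0; have z1 : nm (0 : C) < 1 by rewrite nm0.
have [k [kana hk]] := ana_factor fana z1.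
have [|B HB] := ana_bnd (r := 1 / 2) kana; first by apply/andP; split; lra.
have B0 : 0 <= B by apply: le_trans (nm_ge0 _) (HB 0 _); rewrite nm0; lra.
have nf0 : 0 < nm (f 0) by rewrite nm_gt0.
have B10 : 0 < B + 1 by lra.
exists (Num.min (1 / 2) (nm (f 0) / (B + 1))); split.
  apply/andP; split; last by rewrite gt_min; apply/orP; left; lra.
  by rewrite lt_min; apply/andP; split; [lra|exact: divr_gt0].
move=> w; rewrite lt_min => /andP[w2 wf]; apply/eqP => fw0.
have := hk w; rewrite fw0 sub0r subr0 => /(_ _)/(congr1 (@nm R)); rewrite nmN nmM => h.
have {h} := h (lt_trans w2 _); have := HB w (ltW w2).
move: wf; rewrite ltr_pdivlMr // => h1 h2 h3.
have : nm (f 0) <= nm w * B by rewrite h3 ?ler_wpM2l ?nm_ge0 //; lra.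
by have := nm_ge0 w; nra.
Qed.

Lemma ana_zero f : ana f -> (forall d : R, 0 < d < 1 -> exists w, [/\ w != 0, nm w < d & f w = 0]) ->
  forall w, nm w < 1 -> f w = 0.
Proof.
move=> /ana_order[//|[n [f1 [f1ana f10 hf]]]] H.
have [d [d01 hd]] := ana_neq0_near f1ana f10; have [w [w0 wd fw]] := H d d01.
have := hf w; rewrite fw => /(_ _)/esym/eqP; rewrite mulf_eq0 expf_eq0 (negPf w0) andbF /=.
rewrite (negPf (hd w wd)) => h; have : false by apply: h; apply: lt_trans wd _; case/andP: d01.
by [].
Qed.

(** The interval (0, 1) is the image of the imaginary half-axis under a nome, so identities known on
    the upper half-plane pass to the whole disc, including the point 0. *)
Lemma ana_zero_real f : ana f -> (forall t : R, 0 < t < 1 -> f t%:C = 0) ->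
  forall w, nm w < 1 -> f w = 0.
Proof.
move=> fana H; apply: ana_zero => // d /andP[d0 d1]; exists (d / 2)%:C.
have d2 : 0 < d / 2 by lra.
split; first by rewrite -nm_gt0 nm_real gtr0_norm.
  by rewrite nm_real gtr0_norm //; lra.
by apply: H; apply/andP; split; lra.
Qed.

Lemma expr_ub_le (u v K : R) : 0 <= u -> 0 <= v ->
  (forall N, u ^+ N <= K * v ^+ N) -> u <= v.
Proof.
move=> u0 v0 H; rewrite leNgt; apply/negP => vu.
have u1 : 0 < u by exact: le_lt_trans vu.
have : (fun n => K * (v / u) ^+ n) @ \oo --> K * 0.
  apply: (cvgM (cvg_cst K)); apply: (@cvg_expr R (v / u)).
  by rewrite ger0_norm ?divr_ge0 ?ltr_pdivrMr ?mul1r // ltW.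
rewrite mulr0 => /cvgRP /(_ 1 ltr01)[N HN]; have := HN N (leqnn N); rewrite subr0.
apply/negP; rewrite -leNgt; apply: le_trans (ler_norm _).
by rewrite expr_div_n mulrA ler_pdivlMr ?exprn_gt0 // mul1r.
Qed.

(* Cauchy's estimates for the powers f ^ N bound the modulus of f ^ N up to a factor
   that does not depend on N. *)
Lemma maxmod f r (S : R) w : ana f -> 0 < r < 1 ->
  (forall t : R, nm (f (r%:C * cexp (0 +i* t))) <= S) -> nm w < r -> nm (f w) <= S.
Proof.
move=> fana r01 fS wr; have /andP[r0 r1] := r01.
have S0 : 0 <= S by exact: le_trans (nm_ge0 _) (fS 0).
have x1 : 0 <= nm w / r < 1.
  by rewrite divr_ge0 ?nm_ge0 ?(ltW r0) //= ltr_pdivrMr // mul1r.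
apply: (@expr_ub_le _ _ (1 - nm w / r)^-1) => // [|N]; first exact: nm_ge0.
have [a ha] := anaX N fana.
have ca n : nm (a n) * r ^+ n <= S ^+ N.
  apply: (cauchy_est n ha r01) => t; rewrite nmX lerXn2r ?nnegrE ?nm_ge0 //.
rewrite -nmX mulrC.
apply: (nm_series_le _ (proj2 ha w (lt_trans wr r1)) (geo_cvg (S ^+ N) x1)) => n.
rewrite nmM nmX expr_div_n mulrA ler_pdivlMr ?exprn_gt0 // mulrAC.
by rewrite ler_wpM2r ?exprn_ge0 ?nm_ge0.
Qed.

End AnalyticOrder.

(** * Elementary bounds for sine, cosine, exponential and pi *)

Section RealTrig.
Variable R : realType.
Implicit Types x y : R.

Lemma MVT0 (f : R -> R) (f' : R -> R) x : (forall t : R, is_derive t (1 : R) f (f' t)) ->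
  exists t, `|t| <= `|x| /\ f x - f 0 = f' t * x.
Proof.
move=> df.
have cf (u v : R) : {within `[u, v], continuous f}.
  by apply: derivable_within_continuous => t _; case: (df t).
have [x0|x0|->] := ltgtP x 0.
- have [|t tI E] := @MVT_segment R f f' x 0 _ (fun t _ => df t) (cf _ _); first exact: ltW.
  exists t; split; last by rewrite -[LHS]opprB E; ring.
  by move: tI; rewrite in_itv /= => /andP[h1 h2]; rewrite !ler0_norm ?(ltW x0) // lerN2.
- have [|t tI E] := @MVT_segment R f f' 0 x _ (fun t _ => df t) (cf _ _); first exact: ltW.
  exists t; split; last by rewrite E subr0.
  by move: tI; rewrite in_itv /= => /andP[h1 h2]; rewrite !ger0_norm ?(ltW x0).
- by exists 0; split => //; rewrite subrr mulr0.
Qed.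

Lemma sin_MVT x : exists t, `|t| <= `|x| /\ sin x = cos t * x.
Proof.
have [t [tx E]] := @MVT0 sin cos x (fun t => is_derive_sin t).
by exists t; split => //; rewrite -E sin0 subr0.
Qed.

Lemma cos_norm_le1 x : `|cos x| <= 1.
Proof. by rewrite ler_norml cos_geN1 cos_le1. Qed.

Lemma sin_norm_le x : `|sin x| <= `|x|.
Proof. by have [t [_ ->]] := sin_MVT x; rewrite normrM ler_piMl // cos_norm_le1. Qed.

Lemma cos_ge x : 1 - x ^+ 2 / 2 <= cos x.
Proof.
have -> : cos x = 1 - 2 * sin (x / 2) ^+ 2.
  by rewrite [in LHS](splitr x) cosD -!expr2 cos2sin2; ring.
have := sin_norm_le (x / 2); rewrite -ler_sqr ?nnegrE // !real_normK ?num_real // => h.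
have -> : x ^+ 2 / 2 = 2 * (x / 2) ^+ 2 by field.
by move: h; lra.
Qed.

Lemma sin_sub_le x : `|sin x - x| <= `|x| ^+ 3.
Proof.
have [t [tx ->]] := sin_MVT x.
rewrite -[X in _ - X]mul1r -mulrBl normrM mulrC exprS ler_wpM2l // distrC ger0_norm ?subr_ge0 ?cos_le1 //.
have := cos_ge t; have : `|t| ^+ 2 <= `|x| ^+ 2 by rewrite ler_sqr ?nnegrE.
by rewrite (real_normK (num_real t)); have := sqr_ge0 t; lra.
Qed.

Lemma expR_sub_le x : `|x| <= 1 / 2 -> `|expR x - 1 - x| <= 2 * x ^+ 2.
Proof.
rewrite ler_norml => /andP[x1 x2].
have h1 := expR_ge1Dx x; have h2 := expR_ge1Dx (- x).
have h3 : expR x * expR (- x) = 1 by rewrite -expRD subrr expR0.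
have e0 := expR_gt0 x; have e0' := expR_gt0 (- x).
rewrite ler_norml; apply/andP; split; first by have := sqr_ge0 x; lra.
have h4 : expR x * (1 - x) <= expR x * expR (- x) by rewrite ler_wpM2l // ltW.
rewrite h3 in h4; have : 0 <= (expR x - 1 - x) * (1 / 2 - x) by apply: mulr_ge0; lra.
by move: h4; clear; lra.
Qed.

(** Since sin(pi/6) = 1/2 equals 2 sin(pi/12) cos(pi/12), and sin(pi/12) is at most pi/12 while
    cos(pi/12) < 1. The strict inequality is what [level1_vanish] needs in its borderline case. *)
Lemma pi_gt3 : 3 < pi :> R.
Proof.
set s := sin (pi / 6 : R).
have e3 : (pi / 2 : R) = pi / 6 + pi / 6 + pi / 6 by field.
have p0 := @pi_gt0 R.
have s0 : 0 < s by apply: sin_gt0_pihalf; apply/andP; split; lra.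
have : sin (pi / 2 : R) = 1 by exact: sin_pihalf.
rewrite e3 !sinD !cosD -/s.
have := cos2Dsin2 (pi / 6 : R); rewrite -/s; set c := cos _ => h1 h2.
(* The triple-angle formula at pi/6 reads 3s - 4s^3 = 1, which factors in this way. *)
have h3 : (2 * s - 1) ^+ 2 * (s + 1) = 0.
  have : 3 * s * (1 - s ^+ 2) - s ^+ 3 = 1.
    have e1 : c ^+ 2 = 1 - s ^+ 2 by rewrite -h1; ring.
    by rewrite -e1 -[RHS]h2; ring.
  by move=> h; transitivity (1 - (3 * s * (1 - s ^+ 2) - s ^+ 3)); [ring|rewrite h subrr].
have s12 : s = 1 / 2.
  move: h3 => /eqP; rewrite mulf_eq0 sqrf_eq0 => /orP[/eqP h|/eqP h]; lra.
have e6 : pi / 6 = pi / 12 + pi / 12 :> R by field.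
have c12 : cos (pi / 12 : R) < 1.
  rewrite lt_neqAle cos_le1 andbT; apply/eqP => e.
  have := cos2Dsin2 (pi / 12 : R); rewrite e expr1n => h.
  have : 0 < sin (pi / 12 : R) by apply: sin_gt0_pihalf; apply/andP; split; lra.
  by move=> h0; have := exprn_gt0 2 h0; lra.
have c0 : 0 < cos (pi / 12 : R) by apply: cos_gt0_pihalf; apply/andP; split; lra.
have := sin_norm_le (pi / 12 : R).
rewrite [X in _ <= X]ger0_norm; last lra.
move=> /(le_trans (ler_norm _)) h4.
by move: s12; rewrite /s e6 sinD; nra.
Qed.

End RealTrig.

(** * Fourier expansions in the nome *)

Section Nome.
Variable R : realType.
Notation C := (cplx R).
Implicit Types (x y z w : C) (a b : nat -> C) (f g k : C -> C) (r s : R).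

Lemma ImD z w : complex.Im (z + w) = complex.Im z + complex.Im w.
Proof. by case: z w => [? ?] [? ?]. Qed.
Lemma ReD z w : complex.Re (z + w) = complex.Re z + complex.Re w.
Proof. by case: z w => [? ?] [? ?]. Qed.
Lemma ImN z : complex.Im (- z) = - complex.Im z. Proof. by case: z. Qed.
Lemma ReN z : complex.Re (- z) = - complex.Re z. Proof. by case: z. Qed.
Lemma ImZ r z : complex.Im (r%:C * z) = r * complex.Im z.
Proof. by case: z => a b /=; rewrite mul0r addr0. Qed.
Lemma ReZ r z : complex.Re (r%:C * z) = r * complex.Re z.
Proof. by case: z => a b /=; rewrite mul0r subr0. Qed.
Lemma natC n : (n%:R : C) = (n%:R : R)%:C.
Proof. by rewrite (rmorph_nat (real_complex R)). Qed.
Lemma natCV n : (n%:R : C)^-1 = ((n%:R)^-1 : R)%:C.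
Proof. by rewrite natC (fmorphV (real_complex R)). Qed.
Lemma Im_nat n : complex.Im (n%:R : C) = 0. Proof. by rewrite natC. Qed.
Lemma ImMn n z : complex.Im (n%:R * z) = n%:R * complex.Im z.
Proof. by rewrite natC ImZ. Qed.
Lemma ImVn n z : complex.Im (z / n%:R) = complex.Im z / n%:R.
Proof. by rewrite natCV mulrC ImZ mulrC. Qed.
Lemma ReVn n z : complex.Re (z / n%:R) = complex.Re z / n%:R.
Proof. by rewrite natCV mulrC ReZ mulrC. Qed.

Lemma nomeE h z : nome h z =
  cexp ((- (2 * pi * complex.Im z / h%:R)) +i* (2 * pi * complex.Re z / h%:R)) :> C.
Proof.
rewrite /nome; congr cexp; rewrite natCV mulrC; case: z => a b.
apply/eqP; rewrite eq_complex /=; apply/andP; split; apply/eqP; ring.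
Qed.

Lemma nomeD h z w : nome h (z + w) = nome h z * nome h w :> C.
Proof. by rewrite /nome -cexpD; congr cexp; ring. Qed.
Lemma nome_neq0 h z : nome h z != 0 :> C. Proof. exact: cexp_neq0. Qed.
Lemma nomeN h z : nome h (- z) = (nome h z)^-1 :> C.
Proof. by rewrite /nome -cexpN; congr cexp; ring. Qed.
Lemma nomeMn h n z : nome h (n%:R * z) = nome h z ^+ n :> C.
Proof. by rewrite /nome -cexpMn; congr cexp; ring. Qed.
Lemma nm_nome h z : nm (nome h z) = expR (- (2 * pi * complex.Im z / h%:R)).
Proof. by rewrite nomeE nm_cexp. Qed.
Lemma nm_nome_lt1 h z : (0 < h)%N -> 0 < complex.Im z -> nm (nome h z) < 1.
Proof.
move=> h0 z0; rewrite nm_nome expR_lt1 oppr_lt0 divr_gt0 ?ltr0n //.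
by rewrite !mulr_gt0 ?pi_gt0.
Qed.
Lemma nome_div h n z : nome h (z / n%:R) = nome (h * n) z :> C.
Proof. by rewrite /nome; congr cexp; rewrite natrM invfM; ring. Qed.
Lemma nomeXn h n z : (0 < n)%N -> nome (h * n) z ^+ n = nome h z :> C.
Proof.
move=> n0; rewrite -nome_div -nomeMn; congr nome.
by rewrite mulrC divfK // pnatr_eq0 -lt0n.
Qed.
Lemma nome_half h : (0 < h)%N -> nome (h * 2) h%:R = -1 :> C.
Proof.
move=> h0; have h0' : (h%:R : R) != 0 by rewrite pnatr_eq0 -lt0n.
rewrite nomeE natC /= -cexp_pi; congr cexp; rewrite natrM.
by apply/eqP; rewrite eq_complex /=; apply/andP; split; apply/eqP; field.
Qed.
Lemma nome_per h : (0 < h)%N -> nome h h%:R = 1 :> C.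
Proof. by move=> h0; rewrite -(@nomeXn h 2) // nome_half // sqrrN expr1n. Qed.
Lemma nome_img h r : nome h (0 +i* r) = (expR (- (2 * pi * r / h%:R)))%:C :> C.
Proof.
rewrite nomeE /= mulr0 mul0r /cexp /= cos0 sin0 mulr1 mulr0.
by apply/eqP; rewrite eq_complex /= !eqxx.
Qed.
Lemma nome_surj h r : (0 < h)%N -> 0 < r < 1 ->
  exists s, 0 < s /\ nome h (0 +i* s) = r%:C :> C.
Proof.
move=> h0 /andP[r0 r1]; have hR : 0 < (h%:R : R) by rewrite ltr0n.
have p0 := @pi_gt0 R.
exists (- (h%:R * ln r / (2 * pi))); split.
  by rewrite oppr_gt0 pmulr_llt0 ?invr_gt0 ?mulr_gt0 // pmulr_rlt0 // ln_lt0 // r0.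
rewrite nome_img; congr _%:C; rewrite -[RHS](lnK (x := r)) ?posrE //.
by congr expR; move: p0; move: (@pi R) => p p0; field; rewrite !gt_eqF.
Qed.

Lemma ana_cont k w : ana k -> nm w < 1 -> k @ nbhs w --> k w.
Proof.
move=> kana w1; have [k2 [k2ana hk]] := ana_factor kana w1.
have [r [r01 wr _]] := mid_lt1 w1.
have [|B HB] := ana_bnd (r := r) k2ana; first by case/andP: r01 => /ltW -> ->.
have r1 : r < 1 by case/andP: r01.
have B1 : 0 < `|B| + 1 by apply: ltr_wpDl.
apply/(cvgrPdist_lt (FF := _)) => -[e i]; rewrite ltcE /= => /andP[/eqP -> e0].
pose d := Num.min (r - nm w) (e / (`|B| + 1)).
have d0 : 0 < d by rewrite lt_min subr_gt0 wr divr_gt0.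
exists d%:C => /=; first by rewrite ltcR.
move=> x; rewrite /ball_ /= nmE ltcR => xd; rewrite nmE ltcR nmB.
have xr : nm x < r.
  rewrite -(subrK w x); apply: le_lt_trans (nmD _ _) _.
  by rewrite -ltrBrDr nmB; apply: lt_le_trans xd _; rewrite ge_min lexx.
rewrite hk ?(lt_trans xr) // nmM nmB.
apply: (@le_lt_trans _ _ (nm (w - x) * (`|B| + 1))).
  rewrite ler_wpM2l ?nm_ge0 //; apply: le_trans (HB x (ltW xr)) _.
  by rewrite ler_wpDr // ler_norm.
by rewrite -ltr_pdivlMr //; apply: lt_le_trans xd _; rewrite ge_min lexx orbT.
Qed.

(** This second-order bound serves twice: for the derivative of the exponential at 0, and for the
    limit of the terms in [csc2_lim]. *)
Lemma cexp_sub_le z : nm z <= 1 / 2 -> nm (cexp z - 1 - z) <= 8 * nm z ^+ 2.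
Proof.
move=> z1; apply: le_trans (nm_ReIm _) _.
have hx := nm_Re z; have hy := nm_Im z; have hn := nm_sqr z.
have -> : complex.Re (cexp z - 1 - z) = expR (complex.Re z) * cos (complex.Im z) - 1 - complex.Re z.
  by rewrite !ReD !ReN.
have -> : complex.Im (cexp z - 1 - z) = expR (complex.Re z) * sin (complex.Im z) - complex.Im z.
  by rewrite !ImD !ImN /= oppr0 addr0.
have n0 := nm_ge0 z.
move: z1 hx hy hn n0; move: (complex.Re z) (complex.Im z) (nm z) => x y n z1 hx hy hn n0.
have hex := expR_sub_le (le_trans hx z1).
have hs := sin_sub_le y; have hs1 := sin_norm_le y; have hc := cos_ge y; have hc1 := cos_le1 y.
have y3 : `|y| ^+ 3 <= n ^+ 2 / 2.
  have h2 : `|y| ^+ 2 <= n ^+ 2 by rewrite ler_sqr ?nnegrE.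
  have h3 : `|y| <= 1 / 2 by exact: le_trans hy z1.
  rewrite exprS mulrC; apply: ler_pM; rewrite ?exprn_ge0 //; move: h3; lra.
have x2 : x ^+ 2 <= n ^+ 2 by rewrite hn lerDl sqr_ge0.
have y2 : y ^+ 2 <= n ^+ 2 by rewrite hn lerDr sqr_ge0.
have r1 : `|expR x * cos y - 1 - x| <= 2 * x ^+ 2 + (1 + 1 / 2) * (y ^+ 2 / 2).
  have -> : expR x * cos y - 1 - x = (expR x - 1 - x) * cos y + (1 + x) * (cos y - 1) by ring.
  apply: le_trans (ler_normD _ _) _; rewrite !normrM; apply: lerD.
    by apply: le_trans hex; rewrite ler_piMr // cos_norm_le1.
  apply: ler_pM => //.
    by apply: le_trans (ler_normD _ _) _; rewrite normr1; move: (le_trans hx z1); lra.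
  by rewrite distrC ger0_norm ?subr_ge0 //; move: hc; lra.
have r2 : `|expR x * sin y - y| <= (2 * x ^+ 2 + `|x|) * `|y| + `|y| ^+ 3.
  have -> : expR x * sin y - y = ((expR x - 1 - x) + x) * sin y + (sin y - y) by ring.
  apply: le_trans (ler_normD _ _) _; apply: lerD => //; rewrite normrM.
  by apply: ler_pM => //; apply: le_trans (ler_normD _ _) _; rewrite lerD2r.
have r3 : (2 * x ^+ 2 + `|x|) * `|y| <= 2 * n ^+ 2.
  have -> : 2 * n ^+ 2 = (2 * n) * n by ring.
  apply: ler_pM => //; first by rewrite addr_ge0 // mulr_ge0 // sqr_ge0.
  have : n ^+ 2 <= n / 2 by rewrite expr2; nra.
  by move: hx x2; lra.
by have := sqr_ge0 n; move: r1 r2 r3 x2 y2 y3; clear; lra.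
Qed.

(** A difference quotient with field division instead of scaling, which suits algebraic
    manipulation; [cderivP] links it to [derivable]. *)
Definition cderiv f z (l : C) := (fun x => (f (z + x) - f z) / x) @ 0^' --> l.

Lemma cderivP f z l : cderiv f z l -> derivable f z (1 : C).
Proof.
move=> H; apply/cvg_ex; exists l; apply: cvg_trans H; apply: near_eq_cvg.
near=> x; rewrite /=; have -> : x%:A = x :> C by exact: mulr1.
by rewrite [z + x]addrC mulrC.
Unshelve. all: by end_near.
Qed.

Lemma cderiv_cexp0 : (fun x : C => (cexp x - 1) / x) @ 0^' --> (1 : C).
Proof.
apply/(cvgrPdist_lt (FF := _)) => -[e i]; rewrite ltcE /= => /andP[/eqP -> e0].
pose d := Num.min (1 / 2) (e / 8).
have d0 : 0 < d by rewrite lt_min; apply/andP; split; lra.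
exists d%:C => /=; first by rewrite ltcR.
move=> x; rewrite /ball_ /= nmE ltcR sub0r nmN lt_min => /andP[/ltW x2 xe] x0.
rewrite nmE ltcR nmB.
have -> : (cexp x - 1) / x - 1 = (cexp x - 1 - x) / x by field.
have nx0 : 0 < nm x by rewrite nm_gt0.
rewrite nmM nmV ltr_pdivrMr //; apply: le_lt_trans (cexp_sub_le x2) _.
by rewrite expr2; move: xe nx0; clear; nra.
Qed.

Lemma cderiv_nome h z : (0 < h)%N -> exists l : C, cderiv (@nome R h) z l.
Proof.
move=> h0; pose c : C := (2 * pi)%:C * 'i%C / h%:R.
have c0 : c != 0.
  rewrite !mulf_neq0 ?invr_eq0 ?pnatr_eq0 -?lt0n //; last first.
    by rewrite eq_complex /= oner_eq0 andbF.
  by rewrite eq_complex /= negb_and mulf_eq0 pnatr_eq0 (gt_eqF (pi_gt0 R)).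
exists (nome h z * c * 1); rewrite /cderiv.
have : (fun x : C => nome h z * c * ((cexp (c * x) - 1) / (c * x))) @ 0^' --> nome h z * c * 1.
  apply: cvgM; first exact: cvg_cst.
  apply: (@cvg_comp _ _ _ (fun x : C => c * x) (fun x => (cexp x - 1) / x) _ 0^'); last exact: cderiv_cexp0.
  move=> P [d /= d0 Pd]; exists (d / `|c|); first by rewrite /= divr_gt0 // normr_gt0.
  move=> x /=; rewrite sub0r normrN => xd x0; apply: Pd; last by rewrite mulf_neq0.
  by rewrite /= sub0r normrN normrM mulrC -ltr_pdivlMr ?normr_gt0.
apply: cvg_trans; apply: near_eq_cvg; near=> x.
have x0 : x != 0 by near: x; exact: nbhs_dnbhs_neq.
rewrite nomeD /= -[X in _ = (_ - X) / x]mulr1 -mulrBr.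
have -> : nome h x = cexp (c * x) by rewrite /nome; congr cexp; rewrite /c; ring.
by field; rewrite x0 c0.
Unshelve. all: by end_near.
Qed.

Lemma cderiv_cvg f z l : cderiv f z l -> (fun x => f (z + x)) @ 0^' --> f z.
Proof.
move=> H.
have : (fun x : C => (f (z + x) - f z) / x * x + f z) @ 0^' --> l * 0 + f z.
  apply: cvgD; last exact: cvg_cst.
  exact: (@cvgM C C _ _ _ _ _ _ H (@cvg_within _ (nbhs (0 : C)) _ _)).
rewrite mulr0 add0r; apply: cvg_trans; apply: near_eq_cvg; near=> x.
have x0 : x != 0 by near: x; exact: nbhs_dnbhs_neq.
by rewrite /= divfK // subrK.
Unshelve. all: by end_near.
Qed.

Lemma cderiv_ana_nome f h z : ana f -> (0 < h)%N -> 0 < complex.Im z ->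
  exists l : C, cderiv (fun x => f (nome h x)) z l.
Proof.
move=> fana h0 z0; have w1 := nm_nome_lt1 h0 z0.
have [k [kana hk]] := ana_factor fana w1.
have [l hl] := cderiv_nome z h0.
exists (l * k (nome h z)).
have : (fun x => (nome h (z + x) - nome h z) / x * k (nome h (z + x))) @ 0^' --> l * k (nome h z).
  apply: cvgM; first exact: hl.
  apply: (@cvg_comp _ _ _ (fun x : C => nome h (z + x)) k _ (nbhs (nome h z))).
    exact: cderiv_cvg hl.
  exact: ana_cont.
apply: cvg_trans; apply: near_eq_cvg; near=> x.
have E : nm (nome h (z + x)) < 1; last by rewrite (hk _ E) mulrAC.
apply: nm_nome_lt1 => //; rewrite ImD.
have : `|x| < (complex.Im z)%:C.
  near: x; exists (complex.Im z)%:C; first by rewrite /= ltcR.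
  by move=> x /=; rewrite sub0r normrN.
rewrite nmE ltcR => xz; have := nm_Im x; rewrite ler_norml => /andP[h1 _].
by move: xz h1; clear; lra.
Unshelve. all: by end_near.
Qed.

End Nome.

(** * Fourier expansions as power series *)

Section Fourier.
Variable R : realType.
Notation C := (cplx R).
Implicit Types (x y z w : C) (a b : nat -> C) (r s : R) (f g : uhp R -> C).

Lemma extendE f z (hz : 0 < complex.Im z) : extend f z = f (exist _ z hz).
Proof. by rewrite /extend insubT /=; congr f; apply: val_inj. Qed.

Lemma extend_val f (z : uhp R) : extend f (val z) = f z.
Proof. by case: z => z hz; rewrite (extendE f hz). Qed.

Lemma series_term_bnd (u : nat -> C) (l : C) : series u @ \oo --> l ->
  exists B : R, forall n, nm (u n) <= B.
Proof.
move=> /cvgCP /(_ 1 ltr01)[N HN].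
exists (2 + \sum_(k < N) nm (u k)) => n; have [nN|Nn] := ltnP n N.
  rewrite (bigD1 (Ordinal nN)) //= addrCA lerDl addr_ge0 // sumr_ge0 // => i _.
  exact: nm_ge0.
have -> : u n = (series u n.+1 - l) - (series u n - l).
  by rewrite !seriesCE big_ord_recr /=; ring.
apply: le_trans (nmD _ _) _; rewrite nmN.
apply: (@le_trans _ _ (1 + 1)).
  by apply: lerD; apply: ltW; apply: HN => //; exact: leqW.
by rewrite -[1 + 1]/2 lerDl sumr_ge0 // => i _; exact: nm_ge0.
Qed.

(** The nome takes every value in (0, 1) on the imaginary axis, and the terms of a convergent series
    are bounded; this is exactly [psb a]. *)
Lemma fourier_hasps h a f : (0 < h)%N -> fourier h a f ->
  exists A : C -> C, hasps a A /\ forall z : uhp R, f z = A (nome h (val z)).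
Proof.
move=> h0 H.
have ha : psb a.
  move=> r r01; have [s [s0 hs]] := @nome_surj R h r h0 r01.
  have /series_term_bnd[B HB] := H (exist _ (0 +i* s : C) s0).
  exists B => n; apply: le_trans (HB n); rewrite nmM nmX -[nome h _]/(nome h (0 +i* s : C)) hs nm_real.
  by rewrite ger0_norm //; case/andP: r01 => /ltW.
have [A hA] := hasps_ex ha; exists A; split => // z.
apply: (@cvgC_unique _ _ _ _ (H z)); case: hA => _; apply.
by apply: nm_nome_lt1 => //; exact: (valP z).
Qed.

Lemma hasps_fourier h a f (A : C -> C) : (0 < h)%N -> hasps a A ->
  (forall z : uhp R, f z = A (nome h (val z))) -> fourier h a f.
Proof.
move=> h0 [_ HA] hf z; rewrite hf; apply: HA.
by apply: nm_nome_lt1 => //; exact: (valP z).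
Qed.

Lemma Im_near z x : 0 < complex.Im z -> nm x < complex.Im z -> 0 < complex.Im (z + x).
Proof.
move=> z0 xz; rewrite ImD; have := nm_Im x; rewrite ler_norml => /andP[h1 _].
by move: xz h1; clear; lra.
Qed.

Lemma holomorphic_ana h f (A : C -> C) : (0 < h)%N -> ana A ->
  (forall z : uhp R, f z = A (nome h (val z))) -> holomorphic f.
Proof.
move=> h0 hA hf [z z0]; rewrite [val _]/=.
have [l hl] := cderiv_ana_nome hA h0 z0.
apply: (@cderivP _ _ _ l); apply: cvg_trans hl; apply: near_eq_cvg; near=> x.
have x0 : 0 < complex.Im (z + x).
  apply: Im_near => //; rewrite -ltcR -nmE; near: x; exists (complex.Im z)%:C; first by rewrite /= ltcR.
  by move=> x /=; rewrite sub0r normrN.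
by rewrite (extendE f x0) (extendE f z0) !hf.
Unshelve. all: by end_near.
Qed.

Lemma holomorphicM f g : holomorphic f -> holomorphic g -> holomorphic (fun z : uhp R => f z * g z).
Proof.
move=> hf hg z.
have -> : extend (fun z : uhp R => f z * g z) = extend f * extend g.
  apply/funext => x; rewrite /extend fctE /=; case: insub => [u|] //=.
  by rewrite mulr0.
by apply: derivableM; [exact: hf|exact: hg].
Qed.

Lemma holomorphicV f : (forall z : uhp R, f z != 0) -> holomorphic f -> holomorphic (fun z : uhp R => (f z)^-1).
Proof.
move=> f0 hf z.
have -> : extend (fun z : uhp R => (f z)^-1) = (fun x => (extend f x)^-1).
  apply/funext => x; rewrite /extend; case: insub => [u|] //=.
  by rewrite invr0.
by apply: derivableV; [rewrite extend_val|exact: hf].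
Qed.

End Fourier.

(** * A vanishing criterion for the full modular group *)

Section LevelOne.
Variable R : realType.
Notation C := (cplx R).
Implicit Types (x y z w : C) (r s : R).

Lemma Im_Ninv z : complex.Im (- z^-1) = complex.Im z / nm z ^+ 2.
Proof. by rewrite ImN nm_sqr; case: z => a b /=; rewrite opprK. Qed.

Lemma Im_Ninv_gt0 z : 0 < complex.Im z -> 0 < complex.Im (- z^-1).
Proof.
move=> z0; rewrite Im_Ninv divr_gt0 // exprn_gt0 // nm_gt0; apply/eqP => e.
by move: z0; rewrite e ltxx.
Qed.

Lemma uhp_neq0 z : 0 < complex.Im z -> z != 0.
Proof. by move=> z0; apply/eqP => e; move: z0; rewrite e ltxx. Qed.

Lemma trans_int (T : Type) (Q : C -> T) : (forall z, 0 < complex.Im z -> Q (z + 1) = Q z) ->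
  forall (m : int) z, 0 < complex.Im z -> Q (z + m%:~R) = Q z.
Proof.
move=> Q1.
have Im_int (m : int) : complex.Im (m%:~R : C) = 0.
  by case: m => n; rewrite ?NegzE ?mulrNz ?ImN; rewrite -pmulrn Im_nat ?oppr0.
have Qn n z : 0 < complex.Im z -> Q (z + n%:R) = Q z.
  move=> z0; elim: n => [|n IH]; first by rewrite addr0.
  by rewrite -natr1 addrA Q1 // ImD Im_nat addr0.
case=> n z z0; first exact: Qn.
rewrite -(Qn n.+1) ?ImD ?Im_int ?addr0 //; congr Q.
by rewrite NegzE mulrNz -pmulrn subrK.
Qed.

(* Translations bring the real part into [-1/2, 1/2], and there z |-> -1/z
   multiplies an imaginary part below 3/4 by at least 16/13. *)
Lemma fund_reduce (T : Type) (Q : C -> T) :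
  (forall z, 0 < complex.Im z -> Q (z + 1) = Q z) ->
  (forall z, 0 < complex.Im z -> Q (- z^-1) = Q z) ->
  forall z, 0 < complex.Im z -> exists z', 3 / 4 <= complex.Im z' /\ Q z' = Q z.
Proof.
move=> Q1 QS.
have main N : forall z, 0 < complex.Im z -> 3 / 4 <= (16 / 13) ^+ N * complex.Im z ->
    exists z', 3 / 4 <= complex.Im z' /\ Q z' = Q z.
  elim: N => [|N IH] z z0; first by rewrite expr0 mul1r => h; exists z.
  move=> h; have [z34|z34] := leP (3 / 4) (complex.Im z); first by exists z.
  pose m := Num.floor (complex.Re z + 1 / 2).
  pose z1 := z + (- m)%:~R.
  have Rint (k : int) : (k%:~R : C) = (k%:~R : R)%:C.
    by rewrite (rmorph_int (real_complex R)).
  have Iz1 : complex.Im z1 = complex.Im z by rewrite ImD Rint addr0.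
  have Rz1 : complex.Re z1 = complex.Re z - m%:~R by rewrite ReD Rint /= mulrNz.
  have z10 : 0 < complex.Im z1 by rewrite Iz1.
  have n1 : nm z1 ^+ 2 <= 13 / 16.
    rewrite nm_sqr Iz1 Rz1.
    have := Num.Theory.ge_floor (complex.Re z + 1 / 2); have := floorD1_gt (complex.Re z + 1 / 2).
    rewrite -/m intrD => h1 h2.
    have : (complex.Re z - m%:~R) ^+ 2 <= 1 / 4.
      have e : 0 <= (1 / 2 - (complex.Re z - m%:~R)) * (1 / 2 + (complex.Re z - m%:~R)).
        by apply: mulr_ge0; move: h1 h2; rewrite mulr1z; lra.
      by move: e; lra.
    have : complex.Im z ^+ 2 <= 9 / 16.
      have e : 0 <= (3 / 4 - complex.Im z) * (3 / 4 + complex.Im z) by apply: mulr_ge0; lra.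
      by move: e; lra.
    by lra.
  have n10 : 0 < nm z1 ^+ 2 by rewrite exprn_gt0 // nm_gt0 uhp_neq0.
  have [|z' [hz' E]] := IH _ (Im_Ninv_gt0 z10).
    apply: le_trans h _; rewrite exprSr -mulrA ler_wpM2l ?exprn_ge0 //.
    rewrite Im_Ninv Iz1 ler_pdivlMr //.
    have : 0 <= complex.Im z * (13 / 16 - nm z1 ^+ 2).
      by apply: mulr_ge0; [exact: ltW|rewrite subr_ge0].
    by clear; lra.
  by exists z'; split => //; rewrite E QS // trans_int.
move=> z z0.
have : (fun n => (13 / 16 : R) ^+ n) @ \oo --> (0 : R).
  by apply: cvg_expr; rewrite ger0_norm; lra.
move=> /cvgRP /(_ (4 / 3 * complex.Im z))[|N HN]; first by lra.
apply: (main N z z0); have := HN N (leqnn N); rewrite subr0 ger0_norm ?exprn_ge0 // => h.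
have p : 0 < (16 / 13 : R) ^+ N by rewrite exprn_gt0.
have e : (16 / 13 : R) ^+ N * (13 / 16) ^+ N = 1.
  by rewrite -exprMn (_ : 16 / 13 * (13 / 16) = 1) ?expr1n //; field.
have := ltr_pM2l p ((13 / 16) ^+ N) (4 / 3 * complex.Im z); rewrite h e => /esym h2.
by move: h2; rewrite mulrCA; lra.
Qed.

Lemma powX_expR_le (u : R) n : 0 <= u -> u ^+ n <= expR (n%:R * (u - 1)).
Proof.
move=> u0; rewrite mulrC expRM_natr lerXn2r ?nnegrE ?expR_ge0 //.
by have := expR_ge1Dx (u - 1); rewrite addrC subrK.
Qed.

(* A weak form of the valence formula for SL_2(Z). The function |P| y^om is bounded
   by its supremum over Im z >= 3/4, and there the maximum principle, applied with
   the circle Im z = 1/2, improves any bound by a constant factor. *)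
Lemma level1_vanish (P B1 : C -> C) h n0 om : (0 < h)%N -> (0 < n0)%N ->
  (om * h <= 3 * n0)%N -> ana B1 ->
  (forall z, 0 < complex.Im z -> P z = nome h z ^+ n0 * B1 (nome h z)) ->
  (forall z, 0 < complex.Im z -> nm (P (z + 1)) = nm (P z)) ->
  (forall z, 0 < complex.Im z -> nm (P (- z^-1)) = nm z ^+ (2 * om) * nm (P z)) ->
  forall z, 0 < complex.Im z -> P z = 0.
Proof.
move=> h0 n00 le hB PB P1 PS.
(* In modulus [P] transforms with weight [2 * om], so [phi] is invariant under both generators of
   SL_2(Z). *)
pose phi z := nm (P z) * complex.Im z ^+ om.
have phi1 z : 0 < complex.Im z -> phi (z + 1) = phi z.
  by move=> z0; rewrite /phi P1 // ImD /= addr0.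
have phiS z : 0 < complex.Im z -> phi (- z^-1) = phi z.
  move=> z0; rewrite /phi PS // Im_Ninv expr_div_n -exprM.
  have n00' : nm z ^+ (2 * om) != 0 by rewrite expf_neq0 // nm_eq0 uhp_neq0.
  by rewrite mulrC mulrA divfK // mulrC.
have red := fund_reduce phi1 phiS.
have pi0 := @pi_gt3 R; have hR : 0 < (h%:R : R) by rewrite ltr0n.
pose c : R := n0%:R / h%:R.
have c0 : 0 < c by rewrite divr_gt0 // ltr0n.
have omc : om%:R <= 3 * c.
  by rewrite /c mulrA ler_pdivlMr // -!natrM ler_nat.
(* [de] measures the gain per step. The hypothesis on the orders gives [om <= 3 * c], and pi > 3
   makes [de] positive even in the case of equality. *)
pose de := pi * c - om%:R.
have de0 : 0 < de by rewrite /de; nra.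
have rho01 r : 0 < r -> 0 < expR (- (2 * pi * r / h%:R)) < 1.
  by move=> r0; rewrite expR_gt0 expR_lt1 oppr_lt0 !divr_gt0 ?mulr_gt0 //; lra.
have nomeX r : expR (- (2 * pi * r / h%:R)) ^+ n0 = expR (- (2 * pi * r * c)).
  by rewrite -expRM_natr; congr expR; rewrite /c; ring.
have [K0 HK0] : exists K0 : R, forall z, 0 < complex.Im z -> phi z <= K0.
  have := rho01 (3 / 4); set r := expR _ => r01; have [|K HK] := ana_bnd (r := r) hB.
    by have /andP[h1 ->] := r01 ltac:(lra); rewrite ltW.
  exists K => z z0; have [z' [z34 <-]] := red z z0.
  have z0' : 0 < complex.Im z' by lra.
  rewrite /phi PB // nmM nmX nm_nome nomeX mulrAC.
  have Kb : nm (B1 (nome h z')) <= K.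
    apply: HK; rewrite nm_nome ler_expR lerN2 ler_wpM2r ?invr_ge0 ?(ltW hR) //.
    by rewrite ler_wpM2l // mulr_ge0 // ltW //; lra.
  have K0 : 0 <= K by exact: le_trans (nm_ge0 _) Kb.
  apply: le_trans (_ : 1 * K <= _); last by rewrite mul1r.
  apply: ler_pM; rewrite ?nm_ge0 // ?mulr_ge0 ?expR_ge0 ?exprn_ge0 ?(ltW z0') //.
  apply: le_trans (_ : expR (- (2 * pi * complex.Im z' * c)) * expR (om%:R * (complex.Im z' - 1)) <= _).
    by rewrite ler_wpM2l ?expR_ge0 // powX_expR_le // ltW.
  rewrite -expRD -[X in _ <= X]expR0 ler_expR; rewrite /de in de0.
  have : 0 <= complex.Im z' * (2 * pi * c - (om%:R : R)) by apply: mulr_ge0; nra.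
  have : 0 <= (om%:R : R) by [].
  generalize (pi : R) c (om%:R : R) (complex.Im z'); clear => p u v y h1 h2; lra.
(* On the circle of height 1/2 the bound [K] for [phi] bounds [B1] by [S]. At height y >= 3/4 this
   leaves the factor (2y)^om exp(- pi c (2y - 1)), at most exp(- de (2y - 1)), hence at most exp(-
   de / 2). *)
have step K : (forall z, 0 < complex.Im z -> phi z <= K) ->
    forall z, 0 < complex.Im z -> phi z <= K * expR (- (de / 2)).
  move=> HK z z0; have [z' [z34 <-]] := red z z0; set y := complex.Im z' in z34.
  have z0' : 0 < complex.Im z' by rewrite -/y; lra.
  have K1 : 0 <= K.
    by apply: le_trans (HK z z0); rewrite mulr_ge0 ?nm_ge0 // exprn_ge0 // ltW.
  have := rho01 (1 / 2); set r := expR _ => r01'; have r01 := r01' ltac:(lra).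
  have /andP[r0 r1] := r01.
  have rn0 : 0 < r ^+ n0 by exact: exprn_gt0.
  pose S := K * 2 ^+ om / r ^+ n0.
  have circ t : nm (B1 (r%:C * cexp (0 +i* t))) <= S.
    pose zt : C := (h%:R * t / (2 * pi)) +i* (1 / 2).
    have zt0 : 0 < complex.Im zt by rewrite /=; lra.
    have e : nome h zt = r%:C * cexp (0 +i* t).
      have -> : r%:C = cexp ((- (2 * pi * (1 / 2) / h%:R)) +i* 0) :> C.
        by rewrite /cexp /= cos0 sin0 mulr1 mulr0.
      rewrite nomeE -cexpD; congr cexp; apply/eqP; rewrite eq_complex /= addr0 add0r eqxx /=.
      apply/eqP; move: pi0 hR; clear; move: (pi : R) (h%:R : R) => p u p0 u0.
      by field; rewrite !gt_eqF //; lra.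
    have := HK zt zt0; rewrite /phi PB // e nmM nmX -e nm_nome -/r => h1.
    rewrite /S ler_pdivlMr // mulrC.
    have e2 (u v : R) : u * (1 / 2) ^+ om <= v -> u <= v * 2 ^+ om.
      by rewrite mul1r exprVn ler_pdivrMr ?exprn_gt0.
    exact: e2 h1.
  have wr : nm (nome h z') < r.
    rewrite nm_nome /r ltr_expR ltrN2 ltr_pM2r ?invr_gt0 // ltr_pM2l //; last by lra.
    by rewrite -/y; lra.
  have := maxmod hB r01 circ wr => hBS.
  rewrite /phi PB // nmM nmX nm_nome nomeX -/y.
  apply: le_trans (_ : expR (- (2 * pi * y * c)) * S * y ^+ om <= _).
    by rewrite ler_wpM2r ?exprn_ge0 ?ler_wpM2l ?expR_ge0 //; lra.
  rewrite /S /r nomeX -expRN opprK.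
  have -> : expR (- (2 * pi * y * c)) * (K * 2 ^+ om * expR (2 * pi * (1 / 2) * c)) * y ^+ om =
     K * ((2 * y) ^+ om * expR (- (pi * c * (2 * y - 1)))).
    have -> : - (pi * c * (2 * y - 1)) = - (2 * pi * y * c) + 2 * pi * (1 / 2) * c.
      by move: (pi : R) => p; field.
    by rewrite expRD exprMn; ring.
  rewrite ler_wpM2l //; apply: le_trans (_ : expR (om%:R * (2 * y - 1)) * expR (- (pi * c * (2 * y - 1))) <= _).
    by rewrite ler_wpM2r ?expR_ge0 // powX_expR_le //; lra.
  rewrite -expRD ler_expR.
  have -> : om%:R * (2 * y - 1) + - (pi * c * (2 * y - 1)) = - (de * (2 * y - 1)) by rewrite /de; ring.
  by rewrite lerN2 ler_wpM2l ?(ltW de0) //; lra.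
have all N : forall z, 0 < complex.Im z -> phi z <= K0 * expR (- (de / 2)) ^+ N.
  elim: N => [|N IH] z z0; first by rewrite expr0 mulr1; exact: HK0.
  by rewrite exprSr mulrA; exact: step.
move=> z z0; apply/eqP; rewrite -nm_eq0.
suff : phi z <= 0.
  move=> p; have : phi z == 0.
    by rewrite eq_le p mulr_ge0 ?nm_ge0 // exprn_ge0 // ltW.
  by rewrite /phi mulf_eq0 expf_eq0 (gt_eqF z0) andbF orbF.
have lim : (fun N => K0 * expR (- (de / 2)) ^+ N) @ \oo --> K0 * 0.
  apply: (cvgM (cvg_cst K0)); apply: cvg_expr; rewrite ger0_norm ?expR_ge0 // expR_lt1.
  by move: de0; lra.
rewrite mulr0 in lim; apply/ler_addgt0Pr => e e0; rewrite add0r.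
have [N HN] := (iffLR (cvgRP _ _)) lim e e0; have := HN N (leqnn N); rewrite subr0 => h1.
by apply: le_trans (all N z z0) _; apply: le_trans (ler_norm _) (ltW h1).
Qed.

End LevelOne.

(** * The Lipschitz formula *)

Section Lipschitz.
Variable R : realType.
Notation C := (cplx R).
Implicit Types (x y z w : C) (r s : R).

(* pi ^ 2 / sin (pi z) ^ 2, written in q. *)
Definition csc2 z : C := - (4 * (pi%:C) ^+ 2) * (nome 1 z / (1 - nome 1 z) ^+ 2).

Lemma nome1_shift z n : nome 1 (z + n%:R) = nome 1 z :> C.
Proof.
rewrite nomeD; suff -> : nome 1 n%:R = 1 :> C by rewrite mulr1.
by rewrite -[n%:R]mulr1 nomeMn nome_per // expr1n.
Qed.

Lemma csc2_shift z n : csc2 (z + n%:R) = csc2 z.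
Proof. by rewrite /csc2 nome1_shift. Qed.

(** With s = [nome 2 z] the two halves have nomes s and -s, and the identity is s/(1-s)^2 -
    s/(1+s)^2 = 4 s^2/(1-s^2)^2. Iterating it produces sums over 2^n equidistant points. *)
Lemma csc2_double z : nome 1 z != 1 :> C ->
  csc2 z = (csc2 (z / 2) + csc2 ((z + 1) / 2)) / 4.
Proof.
move=> z1; rewrite /csc2.
have e1 : nome 1 (z / 2) = nome 2 z :> C by rewrite nome_div.
have e2 : nome 1 ((z + 1) / 2) = - nome 2 z :> C.
  by rewrite nome_div nomeD (@nome_half R 1) // mulrN1.
have e3 : nome 1 z = nome 2 z ^+ 2 :> C by rewrite -(@nomeXn R 1 2).
rewrite e1 e2; rewrite e3 in z1 *; set s := nome 2 z in z1 *.
have s1 : 1 - s != 0.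
  by apply: contraNneq z1 => /eqP; rewrite subr_eq0 => /eqP <-; rewrite expr1n.
have s2 : 1 + s != 0.
  by apply: contraNneq z1 => /eqP; rewrite addrC addr_eq0 => /eqP ->; rewrite sqrrN expr1n.
have s3 : 1 - s ^+ 2 != 0 by rewrite subr_eq0 eq_sym.
by field; rewrite opprK s1 s2 s3.
Qed.

Lemma csc2_iter z n : nome 1 z != 1 :> C ->
  csc2 z = (4 ^+ n)^-1 * \sum_(k < 2 ^ n) csc2 ((z + k%:R) / (2 ^ n)%:R).
Proof.
move=> z1; elim: n => [|n IH].
  by rewrite expr0 expn0 !invr1 mul1r big_ord1 addr0 mulr1.
have n2 : (2 ^ n)%:R != 0 :> C by rewrite pnatr_eq0 expn_eq0.
rewrite IH exprSr invfM -mulrA; congr (_ * _).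
have e : (2 ^ n.+1 = 2 ^ n + 2 ^ n)%N by rewrite expnS mul2n addnn.
have eC : (2 ^ n.+1)%:R = 2 * (2 ^ n)%:R :> C by rewrite expnS natrM.
rewrite eC e big_split_ord /= -big_split mulr_sumr /=; apply: eq_bigr => k _.
rewrite csc2_double; last first.
  apply: contra z1 => /eqP h.
  by rewrite -(nome1_shift z k) -(divfK n2 (z + _)) mulrC nomeMn h expr1n.
rewrite mulrC; congr (_ * (csc2 _ + csc2 _)); first by field.
by rewrite natrD; field.
Qed.

(** The upper half of the indices is moved down by one period, so that the real parts of the
    arguments stay near [-1/2, 1/2], away from the other poles of [csc2]. *)
Lemma csc2_sym z n : nome 1 z != 1 :> C ->
  csc2 z = \sum_(k < 2 ^ n) ((4 ^+ n.+1)^-1 * csc2 ((z + k%:R) / (2 ^ n.+1)%:R) +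
     (4 ^+ n.+1)^-1 * csc2 ((z - k.+1%:R) / (2 ^ n.+1)%:R)).
Proof.
move=> z1; rewrite (csc2_iter n.+1 z1) mulr_sumr.
have n2 : (2 ^ n.+1)%:R != 0 :> C by rewrite pnatr_eq0 expn_eq0.
have e : (2 ^ n.+1 = 2 ^ n + 2 ^ n)%N by rewrite expnS mul2n addnn.
rewrite [in LHS]e big_split_ord /= big_split; congr (_ + _).
  by apply: eq_bigr => k _; rewrite -e.
rewrite (reindex_inj rev_ord_inj) /=; apply: eq_bigr => k _; congr (_ * _).
rewrite -e -[RHS](csc2_shift _ 1); congr csc2.
rewrite -[X in _ = _ + X](divff n2) -mulrDl; congr (_ / _).
have -> : (2 ^ n.+1)%:R = (2 ^ n)%:R + (2 ^ n - k.+1)%:R + k.+1%:R :> C.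
  by rewrite -addrA -natrD subnK // -natrD -e.
by rewrite natrD; ring.
Qed.

(** The constant of [nm_1Bnome]: the first entry of the minimum comes from the sine in the real
    direction, the second from the exponential in the imaginary direction. *)
Definition kap : R := Num.min ((cos (3 / 8 * pi)) ^+ 4) (1 / 4) * pi ^+ 2.

Lemma cos38_gt0 : 0 < cos (3 / 8 * pi : R).
Proof. by apply: cos_gt0_pihalf; have := @pi_gt0 R => p; apply/andP; split; lra. Qed.

Lemma kap_gt0 : 0 < kap.
Proof.
by rewrite /kap mulr_gt0 ?exprn_gt0 ?pi_gt0 // lt_min exprn_gt0 ?cos38_gt0 //=.
Qed.

(** Since pi r may exceed pi/2, the angle is halved first: sin(pi r) = 2 sin(pi r/2) cos(pi r/2),
    and then only cosines of angles at most 3 pi/8 occur. *)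
Lemma sin_ge_lin r : `|r| <= 3 / 4 ->
  (cos (3 / 8 * pi) ^+ 2 * pi * r) ^+ 2 <= sin (pi * r) ^+ 2.
Proof.
move=> hr; have p0 := @pi_gt0 R; have c0 := cos38_gt0.
have [t [ht Et]] := sin_MVT (pi * r / 2).
have h38 u : `|u| <= `|pi * r / 2| -> cos (3 / 8 * pi : R) <= cos u.
  move=> hu; have hu' : `|u| <= 3 / 8 * pi.
    apply: le_trans hu _; rewrite normrM normrM (ger0_norm (ltW p0)) [X in _ * X]ger0_norm ?invr_ge0 //.
    by move: hr p0; clear; move: `|r| (pi : R) => a p; nra.
  have -> : cos u = cos `|u|.
    by case: (ger0P u) => _; rewrite ?cosN.
  have [->//|ne] := eqVneq `|u| (3 / 8 * pi).
  apply: ltW; rewrite ltr_cos ?lt_neqAle ?ne //; rewrite in_itv /=.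
    by rewrite normr_ge0 /=; lra.
  by apply/andP; split; lra.
have e : sin (pi * r) = cos t * cos (pi * r / 2) * pi * r.
  by rewrite [in LHS](splitr (pi * r)) sinD Et; move: (pi : R) => p; field.
have hA : cos (3 / 8 * pi) ^+ 2 <= cos t * cos (pi * r / 2).
  by rewrite expr2 ler_pM ?(ltW c0) //; [exact: h38|exact: h38].
rewrite e -(mulrA (_ ^+ 2)) -(mulrA (cos t * _)) ![(_ * (pi * r)) ^+ 2]exprMn ler_wpM2r ?sqr_ge0 //.
by rewrite ler_sqr // nnegrE ?sqr_ge0 //; apply: le_trans hA; exact: sqr_ge0.
Qed.

Lemma expR_sq_ge r : r ^+ 2 / 4 <= expR r + expR (- r) - 2.
Proof.
wlog r0 : r / 0 <= r => [hw|].
  have [/hw //|/ltW r0] := leP 0 r.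
  by have := hw (- r); rewrite oppr_ge0 sqrrN opprK (addrC (expR (- r))); apply.
have e : expR r + expR (- r) - 2 = (expR (r / 2) - expR (- (r / 2))) ^+ 2.
  rewrite sqrrB -!expRM_natr -expRD subrr expR0.
  have -> : r / 2 * 2 = r by field.
  have -> : - (r / 2) * 2 = - r by field.
  by ring.
have -> : r ^+ 2 / 4 = (r / 2) ^+ 2 by field.
have h1 := expR_ge1Dx (r / 2).
have h2 : expR (- (r / 2)) <= 1 by rewrite -[X in _ <= X]expR0 ler_expR; lra.
by rewrite e ler_sqr ?nnegrE; lra.
Qed.

(** For w = a + i b, |1 - q|^2 / |q| = 4 sin(pi a)^2 + (exp(2 pi b) + exp(-2 pi b) - 2), and the two
    summands are bounded below by multiples of a^2 and b^2. *)
Lemma nm_1Bnome w : `|complex.Re w| <= 3 / 4 ->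
  4 * kap * nm w ^+ 2 * nm (nome 1 w) <= nm (1 - nome 1 w) ^+ 2.
Proof.
move=> hr; rewrite nm_nome nomeE !divr1 [X in _ <= X]nm_sqr /cexp ReD ImD ReN ImN /=.
set a := complex.Re w in hr *; set b := complex.Im w.
have -> : nm w ^+ 2 = a ^+ 2 + b ^+ 2 by rewrite nm_sqr.
have h1 := sin_ge_lin hr; have h2 := expR_sq_ge (2 * pi * b).
have e : cos (2 * pi * a) = 1 - 2 * sin (pi * a) ^+ 2.
  have -> : 2 * pi * a = pi * a + pi * a by ring.
  by rewrite cosD -!expr2 cos2sin2; ring.
set u := expR (- (2 * pi * b)) in h2 *; set v := expR (2 * pi * b) in h2.
have uv : u * v = 1 by rewrite /u /v -expRD addrC subrr expR0.
have u0 : 0 < u := expR_gt0 _.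
have -> : (1 - u * cos (2 * pi * a)) ^+ 2 + (0 - u * sin (2 * pi * a)) ^+ 2 =
   u * (v + u - 2 * cos (2 * pi * a)).
  have := cos2Dsin2 (2 * pi * a); move: (cos _) (sin _) => c s cs.
  transitivity (u * v - 2 * u * c + u ^+ 2 * (c ^+ 2 + s ^+ 2)); last by rewrite cs; ring.
  by rewrite uv; ring.
rewrite mulrC ler_wpM2l ?(ltW u0) //.
have k1 : kap <= cos (3 / 8 * pi) ^+ 4 * pi ^+ 2.
  by rewrite /kap ler_wpM2r ?exprn_ge0 ?pi_ge0 // ge_min lexx.
have k2 : kap <= 1 / 4 * pi ^+ 2.
  by rewrite /kap ler_wpM2r ?exprn_ge0 ?pi_ge0 // ge_min lexx orbT.
have h3 : 4 * kap * a ^+ 2 <= 4 * sin (pi * a) ^+ 2.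
  rewrite -mulrA ler_wpM2l //; apply: le_trans h1.
  apply: le_trans (ler_wpM2r (sqr_ge0 a) k1) _.
  by rewrite le_eqVlt; apply/orP; left; apply/eqP; ring.
have h4 : 4 * kap * b ^+ 2 <= (2 * pi * b) ^+ 2 / 4.
  rewrite -mulrA; apply: le_trans (ler_wpM2l (ler0n _ 4) (ler_wpM2r (sqr_ge0 b) k2)) _.
  by rewrite le_eqVlt; apply/orP; left; apply/eqP; move: (pi : R) => p; field.
by rewrite e mulrDr; move: h2 h3 h4; clear; lra.
Qed.

End Lipschitz.

(** * Passage to the limit in the subdivided sums *)

Section Lipschitz2.
Variable R : realType.
Notation C := (cplx R).
Implicit Types (x y z w : C) (r s : R).

(** The majorant (k+1)^(-3/2). The exponent 3/2 is chosen for the double series [dd]: its terms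
    decay like a cube of the distance, which splits as a geometric mean into a product of two such
    factors, as [fubini_prod] requires. *)
Definition p32 (k : nat) : R := (k.+1%:R * Num.sqrt k.+1%:R)^-1.

Lemma p32_ge0 k : 0 <= p32 k.
Proof. by rewrite /p32 invr_ge0 mulr_ge0 ?sqrtr_ge0. Qed.

(** Applied to the square roots of consecutive integers, it gives [p32] a telescoping majorant. *)
Lemma inv_cube_le r s : 0 < r -> 0 < s -> s ^+ 2 = r ^+ 2 + 1 ->
  (s ^+ 2 * s)^-1 <= 2 * (r^-1 - s^-1).
Proof.
move=> r0 s0 e; have rs : r <= s by rewrite -ler_sqr ?nnegrE ?(ltW r0) ?(ltW s0) // e lerDl.
have -> : r^-1 - s^-1 = (s - r) / (r * s) by field; rewrite !gt_eqF.
have d1 : (s - r) * (s + r) = 1 by rewrite -subr_sqr e addrAC subrr add0r.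
rewrite mulrA ler_pdivlMr ?mulr_gt0 // mulrC ler_pdivrMr ?mulr_gt0 ?exprn_gt0 //.
have h : s <= 2 * (s - r) * s ^+ 2.
  have : (s - r) * (s + r) <= (s - r) * (2 * s) by rewrite ler_wpM2l ?subr_ge0 //; lra.
  rewrite d1 => h1; have := ler_wpM2r (ltW s0) h1; rewrite mul1r => h2.
  by apply: le_trans h2 _; rewrite le_eqVlt; apply/orP; left; apply/eqP; ring.
rewrite mulrA ler_wpM2r ?(ltW s0) //; exact: le_trans h.
Qed.

Lemma p32_cvg : cvgn (series p32).
Proof.
apply: nondecreasing_is_cvgn.
  by apply/nondecreasing_seqP => m; rewrite !seriesRE big_ord_recr /= lerDl p32_ge0.
exists 3 => _ [n _ <-].
have sq m : Num.sqrt m%:R ^+ 2 = m%:R :> R by rewrite sqr_sqrtr.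
have sp m : 0 < Num.sqrt m.+1%:R :> R by rewrite sqrtr_gt0.
suff : series p32 n.+1 <= 3 - 2 * (Num.sqrt n.+1%:R)^-1.
  rewrite !seriesRE big_ord_recr /= => h.
  have h1 := p32_ge0 n; have h2 : 0 < (Num.sqrt n.+1%:R)^-1 :> R by rewrite invr_gt0.
  by move: h h1 h2; clear; lra.
elim: n => [|n IH].
  by rewrite seriesRE big_ord1 /p32 sqrtr1 mulr1 invr1; lra.
rewrite seriesRE big_ord_recr /= -seriesRE.
have := @inv_cube_le (Num.sqrt n.+1%:R) (Num.sqrt n.+2%:R) (sp _) (sp _).
rewrite !sq natr1 => /(_ erefl) h.
by move: IH h; rewrite -/(p32 n.+1); clear; lra.
Qed.

Lemma invsq_p32 k : (k.+1%:R ^+ 2)^-1 <= p32 k.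
Proof.
rewrite /p32 lef_pV2 ?posrE ?mulr_gt0 ?sqrtr_gt0 ?exprn_gt0 // expr2 ler_wpM2l //.
rewrite -[X in _ <= X]sqr_sqrtr // expr2 ler_peMl ?sqrtr_ge0 //.
by rewrite -[X in X <= _]sqrtr1 ler_wsqrtr // ler1n.
Qed.

(** With u = 2 pi i c / N the expression is u^2 exp(u) / (exp(u) - 1)^2 divided by c^2, and (exp(u)
    - 1)/u tends to 1. The offset [n0] is there for the domination, which has to hold from the first
    index on. *)
Lemma csc2_lim (c : C) n0 : c != 0 ->
  (fun n => (4 ^+ (n + n0).+1)^-1 * csc2 (c / (2 ^ (n + n0).+1)%:R)) @ \oo --> c ^- 2.
Proof.
move=> c0; pose d : C := (2 * pi)%:C * 'i%C * c.
pose N n : C := (2 ^ (n + n0).+1)%:R.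
have N0 n : N n != 0 by rewrite pnatr_eq0 expn_eq0.
have N4 n : N n ^+ 2 = 4 ^+ (n + n0).+1.
  by rewrite /N -natrX -expnM mulnC expnM -natrX.
have pC : (2 * pi)%:C != 0 :> C.
  by rewrite eq_complex /= eqxx andbT mulf_neq0 ?gt_eqF ?pi_gt0.
have i0 : 'i%C != 0 :> C by rewrite eq_complex /= oner_eq0 andbF.
have d0 : d != 0 by rewrite !mulf_neq0.
pose u n := d / N n.
have u0 n : u n != 0 by rewrite mulf_neq0 ?invr_eq0.
have ul : (fun n => nm (u n)) @ \oo --> (0 : R).
  have : (fun n => nm d * (1 / 2) ^+ n) @ \oo --> nm d * (0 : R).
    apply: (cvgM (cvg_cst (nm d))); apply: (@cvg_expr R (1 / 2)); rewrite ger0_norm; lra.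
  rewrite mulr0 => /cvgRP H; apply/cvgRP => e /H[M HM]; exists M => n /HM.
  rewrite !subr0 !ger0_norm ?nm_ge0 ?mulr_ge0 ?exprn_ge0 ?nm_ge0 ?divr_ge0 //.
  apply: le_lt_trans; rewrite /u nmM nmV ler_wpM2l ?nm_ge0 // /N nm_nat.
  rewrite mul1r exprVn lef_pV2 ?posrE ?exprn_gt0 ?ltr0n ?expn_gt0 // -natrX ler_nat leq_exp2l //.
  by rewrite ltnW // ltnS leq_addr.
have X1 : (fun n => (cexp (u n) - 1) / u n) @ \oo --> (1 : C).
  apply: (cvgC_squeeze (a := fun n => 8 * nm (u n))); last first.
    by have h := cvgM (cvg_cst (8 : R)) ul; rewrite mulr0 in h; exact: h.
  have [M HM] := (iffLR (cvgRP _ _)) ul (1 / 2) ltac:(lra).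
  exists M => n /HM; rewrite subr0 ger0_norm ?nm_ge0 // => /ltW h.
  have -> : (cexp (u n) - 1) / u n - 1 = (cexp (u n) - 1 - u n) / u n by field.
  by rewrite nmM nmV ler_pdivrMr ?nm_gt0 // -mulrA -expr2 cexp_sub_le.
have u1 : u @ \oo --> (0 : C).
  by apply: (cvgC_squeeze (a := fun n => nm (u n))) => //; exists 0%N => n _; rewrite subr0.
have Y1 : (fun n => (cexp (u n) - 1) / u n * u n + 1) @ \oo --> (1 : C).
  by have := cvgCD (cvgCM X1 u1) (@cvgC_cst R 1); rewrite mulr0 add0r.
have XV : (fun n => ((cexp (u n) - 1) / u n)^-1) @ \oo --> (1 : C).
  exact: (cvgC_inv1 X1).
have := @cvgCZ _ _ _ (c ^- 2) (cvgCM Y1 (cvgCM XV XV)).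
rewrite !mulr1; apply: cvgC_eq; exists 0%N => n _.
rewrite divfK // subrK /csc2.
have -> : nome 1 (c / (2 ^ (n + n0).+1)%:R) = cexp (u n) :> C.
  by rewrite /nome; congr cexp; rewrite /u /d divr1; rewrite mulrA.
rewrite -N4 -[1 - cexp _]opprB sqrrN.
have ce : cexp (u n) - 1 = (cexp (u n) - 1) / u n * u n by rewrite divfK.
rewrite [in RHS]ce.
have e4 : - (4 * pi%:C ^+ 2) = (d / c) ^+ 2 :> C.
  rewrite /d mulfK // exprMn sqr_i mulrN1 rmorphM /= exprMn; congr (- (_ * _)).
  by rewrite -rmorphXn /= -(rmorph_nat (real_complex R)); congr (_%:C); ring.
rewrite e4; move: ((_ - 1) / _) => X.
have -> : ((X * u n) ^+ 2)^-1 = (X^-1 * X^-1) * (u n ^+ 2)^-1.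
  by rewrite exprMn invfM -exprVn expr2.
have -> : u n = d / N n by [].
have := N0 n; move: (N n) (cexp _) (X^-1) => M Y Z M0.
by field; rewrite M0 c0 d0.
Qed.

Lemma csc2_bnd w (c : C) n : c = w * (2 ^ n)%:R -> c != 0 -> `|complex.Re w| <= 3 / 4 ->
  nm ((4 ^+ n)^-1 * csc2 w) <= pi ^+ 2 / kap R / nm c ^+ 2.
Proof.
move=> cw c0 hr; have w0 : w != 0 by apply: contraNneq c0 => e; rewrite cw e mul0r.
move: (kap R) (kap_gt0 R) (nm_1Bnome hr) => k k0 h.
have nw : 0 < nm w by rewrite nm_gt0.
have q0 : 0 < nm (nome 1 w : C) by rewrite nm_gt0 nome_neq0.
have p1 : 0 < nm (1 - nome 1 w : C) ^+ 2.
  by apply: (lt_le_trans _ h); rewrite !mulr_gt0 ?exprn_gt0.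
have e2 : (2 ^ n)%:R ^+ 2 = 4 ^+ n :> R by rewrite -!natrX -expnM mulnC expnM.
rewrite /csc2 !nmM nmN !nmM !nmV !nmX cw nmM !nm_nat exprMn e2 nm_real ger0_norm ?pi_ge0 //.
have p4 : 0 < (4 : R) ^+ n by rewrite exprn_gt0.
move: h p1 p4; move: (nm (1 - _) ^+ 2) (4 ^+ n : R) => D E h D0 E0.
have -> : pi ^+ 2 / k / (nm w ^+ 2 * E) = E^-1 * (4 * pi ^+ 2 * (4 * k * nm w ^+ 2)^-1).
  by move: (pi : R) => p; field; rewrite !gt_eqF.
rewrite ler_wpM2l ?invr_ge0 ?(ltW E0) // ler_wpM2l ?mulr_ge0 ?exprn_ge0 ?pi_ge0 //.
rewrite ler_pdivrMr // mulrC ler_pdivlMr; last by rewrite !mulr_gt0 ?exprn_gt0.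
by rewrite mulrC.
Qed.

(* By [csc2_sym], csc2 z is a sum over 2 ^ n.+1 points; its terms tend to those of
   the sum of (z + k)^-2 over all integers k, and [csc2_bnd] dominates them. *)
Lemma lipschitz z (de : R) : nome 1 z != 1 :> C -> 0 < de ->
  (forall k, de * k.+1%:R <= nm (z + k%:R)) ->
  (forall k, de * k.+1%:R <= nm (z - k.+1%:R)) ->
  series (fun k => (z + k%:R) ^- 2 + (z - k.+1%:R) ^- 2) @ \oo --> csc2 z.
Proof.
move=> z1 de0 hp hm.
have dk k : 0 < de * k.+1%:R by rewrite mulr_gt0.
have cp k : z + k%:R != 0 by rewrite -nm_gt0; exact: lt_le_trans (hp k).
have cm k : z - k.+1%:R != 0 by rewrite -nm_gt0; exact: lt_le_trans (hm k).
pose K : R := pi ^+ 2 / kap R / de ^+ 2.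
have K0 : 0 <= K by rewrite !mulr_ge0 ?invr_ge0 ?exprn_ge0 ?(ltW (kap_gt0 _)) ?(ltW de0) ?pi_ge0.
pose b k := (K + K) * p32 k.
have bc : cvgn (series b).
  have /cvg_ex[/= s hs] := p32_cvg; apply/cvg_ex; exists ((K + K) * s).
  have -> : series b = (fun n => (K + K) * series p32 n).
    by apply/funext => n; rewrite !seriesRE mulr_sumr.
  exact: (cvgM (cvg_cst (K + K)) hs).
have Kb c k : de * k.+1%:R <= nm c -> pi ^+ 2 / kap R / nm c ^+ 2 <= K * p32 k.
  move=> h; apply: le_trans (_ : K * (k.+1%:R ^+ 2)^-1 <= _); last by rewrite ler_wpM2l ?invsq_p32.
  rewrite /K -[X in _ <= X]mulrA -invfM -exprMn.
  rewrite ler_wpM2l ?mulr_ge0 ?invr_ge0 ?exprn_ge0 ?(ltW (kap_gt0 _)) ?pi_ge0 //.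
  have nc : 0 < nm c by exact: lt_le_trans (dk k) h.
  by rewrite lef_pV2 ?posrE ?exprn_gt0 // ler_sqr ?nnegrE // ltW.
(* This makes |z| at most a quarter of 2^(n + n0 + 1). The integer shifts contribute at most 1/2, so
   the real parts stay within the 3/4 allowed by [csc2_bnd]. *)
pose n0 := Num.bound (2 * nm z).
have zn0 : 2 * nm z <= (2 ^ n0)%:R.
  apply: le_trans (ltW (archi_boundP _)) _; first by rewrite mulr_ge0 ?nm_ge0.
  by rewrite ler_nat; apply: ltnW; exact: ltn_expl.
pose f k n : C := (4 ^+ (n + n0).+1)^-1 * csc2 ((z + k%:R) / (2 ^ (n + n0).+1)%:R) +
     (4 ^+ (n + n0).+1)^-1 * csc2 ((z - k.+1%:R) / (2 ^ (n + n0).+1)%:R).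
have g_bnd k : nm ((z + k%:R) ^- 2 + (z - k.+1%:R) ^- 2) <=
    (de ^+ 2)^-1 * 2 * p32 k.
  apply: le_trans (nmD _ _) _; rewrite !nmV !nmX.
  have aux c : de * k.+1%:R <= nm c -> (nm c ^+ 2)^-1 <= (de ^+ 2)^-1 * p32 k.
    move=> h; apply: le_trans (_ : (de ^+ 2)^-1 * (k.+1%:R ^+ 2)^-1 <= _).
      rewrite -invfM -exprMn lef_pV2 ?posrE ?exprn_gt0 ?ler_sqr ?nnegrE ?(ltW (dk k)) //.
      - exact: nm_ge0.
      - exact: lt_le_trans (dk k) h.
    by rewrite ler_wpM2l ?invsq_p32 ?invr_ge0 ?exprn_ge0 ?(ltW de0).
  by have := aux _ (hp k); have := aux _ (hm k); clear; lra.
have [|l hl] := abs_cvg g_bnd.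
  have /cvg_ex[/= s hs] := p32_cvg; apply/cvg_ex; exists ((de ^+ 2)^-1 * 2 * s).
  have -> : series (fun k => (de ^+ 2)^-1 * 2 * p32 k) = (fun n => (de ^+ 2)^-1 * 2 * series p32 n).
    by apply/funext => n; rewrite !seriesRE mulr_sumr.
  exact: (cvgM (cvg_cst ((de ^+ 2)^-1 * 2)) hs).
have T := @tannery R f _ (fun n => (2 ^ (n + n0))%N) b l _ _ _ bc hl.
have {}T : (fun n => \sum_(k < 2 ^ (n + n0)) f k n) @ \oo --> l.
  apply: T.
  - by move=> k; exact: (cvgCD (csc2_lim n0 (cp k)) (csc2_lim n0 (cm k))).
  - move=> k n kn; apply: le_trans (nmD _ _) _; rewrite /b [X in _ <= X]mulrDl.
    have nat2 : (2 ^ (n + n0).+1)%:R != 0 :> C by rewrite pnatr_eq0 expn_eq0.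
    have N0 : 0 < (2 ^ (n + n0).+1)%:R :> R by rewrite ltr0n expn_gt0.
    have reb c : nm c <= nm z + k.+1%:R -> `|complex.Re (c / (2 ^ (n + n0).+1)%:R)| <= 3 / 4.
      move=> h; rewrite ReVn normrM normfV (ger0_norm (ltW N0)) ler_pdivrMr //.
      apply: le_trans (nm_Re _) _; apply: le_trans h _.
      have h1 : k.+1%:R <= (2 ^ (n + n0))%:R :> R by rewrite ler_nat.
      have h2 : (2 ^ n0)%:R <= (2 ^ (n + n0))%:R :> R by rewrite ler_nat leq_exp2l // leq_addl.
      rewrite expnS natrM; move: h1 h2 zn0; clear; lra.
    apply: lerD; apply: le_trans (Kb _ _ _).
    + by apply: csc2_bnd; rewrite ?divfK //; apply: reb; apply: le_trans (nmD _ _) _; rewrite nm_nat lerD2l ler_nat.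
    + exact: hp.
    + by apply: csc2_bnd; rewrite ?divfK //; apply: reb; apply: le_trans (nmD _ _) _; rewrite nmN nm_nat.
    + exact: hm.
  - move=> M; exists M => n Mn; apply: leq_trans Mn _; apply: leq_trans (leq_addr n0 n) _.
    by apply: ltnW; exact: ltn_expl.
have e : csc2 z = l; last by rewrite e.
apply: (@cvgC_unique R _ _ _ _ T); apply: (@cvgC_eq R (fun=> csc2 z)); last exact: cvgC_cst.
by exists 0%N => n _; rewrite (csc2_sym (n + n0) z1).
Qed.

End Lipschitz2.

(** * Lower bounds for lattice points *)

Section LatticeBounds.
Variable R : realType.
Notation C := (cplx R).
Implicit Types (x y z w : C) (r s : R).

(** For w = n z + m or n z - m and Y = Im z, one has n Y <= |w| and m <= |w| + n |z|. Together they
    bound Y (m + 1) by |w| (Y + |z| + 1), since n >= 1. *)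
Definition lkap z : R := complex.Im z / (complex.Im z + nm z + 1).

Lemma lkap_gt0 z : 0 < complex.Im z -> 0 < lkap z.
Proof. by move=> z0; have := nm_ge0 z => h; rewrite /lkap divr_gt0 //; lra. Qed.

Lemma lattice_lb z (n m : nat) w : 0 < complex.Im z -> (0 < n)%N ->
  w = n%:R * z + m%:R \/ w = n%:R * z - m%:R ->
  lkap z * n%:R <= nm w /\ lkap z * m.+1%:R <= nm w.
Proof.
move=> z0 n0 hw; set Y := complex.Im z; have nz := nm_ge0 z.
have Iw : complex.Im w = n%:R * Y.
  by case: hw => ->; rewrite ImD ?ImN ImMn Im_nat ?oppr0 addr0.
have h1 : n%:R * Y <= nm w.
  by rewrite -Iw; apply: le_trans (ler_norm _) (nm_Im w).
have h2 : m%:R <= nm w + n%:R * nm z.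
  have -> : m%:R = nm (m%:R : C) by rewrite nm_nat.
  rewrite -(nm_nat R n) -nmM; case: hw => ->.
    rewrite [X in nm X <= _](_ : _ = (n%:R * z + m%:R) - n%:R * z); last by ring.
    by apply: le_trans (nmD _ _) _; rewrite nmN.
  rewrite [X in nm X <= _](_ : _ = - (n%:R * z - m%:R) + n%:R * z); last by ring.
  by apply: le_trans (nmD _ _) _; rewrite nmN.
have n1 : 1 <= n%:R :> R by rewrite ler1n.
have D0 : 0 < Y + nm z + 1 by rewrite /Y; lra.
rewrite /lkap -/Y ![Y / _ * _]mulrAC !ler_pdivrMr //.
rewrite -natr1; move: (n%:R : R) (m%:R : R) n1 h1 h2 => u v u1 h1 h2.
have Y0 : 0 < Y by [].
have p1 : 0 <= nm w := nm_ge0 w.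
split; first by rewrite mulrC; nra.
have : Y * v <= Y * nm w + u * Y * nm z by nra.
have : u * Y * nm z <= nm w * nm z by rewrite ler_wpM2r.
nra.
Qed.

Lemma lipschitz_Im z : complex.Im z != 0 ->
  series (fun k => (z + k%:R) ^- 2 + (z - k.+1%:R) ^- 2) @ \oo --> csc2 z.
Proof.
move=> z0.
have [y [y0 hy]] : exists y : C, 0 < complex.Im y /\ (z = y \/ z = - y).
  have [lt|gt|e] := ltgtP (complex.Im z) 0; last by rewrite e eqxx in z0.
    by exists (- z); rewrite ImN oppr_gt0 opprK; split => //; right.
  by exists z; split => //; left.
have le1 k : k.+1%:R <= k.+2%:R :> R by rewrite ler_nat.
have lk := lkap_gt0 y0.
apply: (@lipschitz _ _ (lkap y)) => //.
- apply/eqP => /(congr1 (@nm R)); rewrite nm_nome nm1 -[RHS]expR0 => /expR_inj/eqP.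
  rewrite oppr_eq0 divr1 mulf_eq0 (negPf z0) orbF mulf_eq0.
  by rewrite (gt_eqF (pi_gt0 R)) pnatr_eq0.
- move=> k; case: hy => ->.
    by case: (@lattice_lb y 1 k (y + k%:R) y0) => //; left; rewrite mul1r.
  have -> : nm (- y + k%:R) = nm (y - k%:R) by rewrite -nmN; congr nm; ring.
  by case: (@lattice_lb y 1 k (y - k%:R) y0) => //; right; rewrite mul1r.
- move=> k; apply: le_trans (ler_wpM2l (ltW lk) (le1 k)) _; case: hy => ->.
    by case: (@lattice_lb y 1 k.+1 (y - k.+1%:R) y0) => //; right; rewrite mul1r.
  have -> : nm (- y - k.+1%:R) = nm (y + k.+1%:R) by rewrite -nmN; congr nm; ring.
  by case: (@lattice_lb y 1 k.+1 (y + k.+1%:R) y0) => //; left; rewrite mul1r.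
Qed.

(** The column m = 0 of the double series leads to the real point 1/2, outside the reach of
    [lipschitz_Im]. *)
Lemma lipschitz_half :
  series (fun k => ((1 / 2 : C) + k%:R) ^- 2 + ((1 / 2 : C) - k.+1%:R) ^- 2) @ \oo --> csc2 (1 / 2 : C).
Proof.
have e k : nm ((1 / 2 : C) + k%:R) = 1 / 2 + k%:R.
  have -> : (1 / 2 : C) + k%:R = (1 / 2 + k%:R : R)%:C.
    by rewrite rmorphD /= rmorphM /= fmorphV rmorph1 /= !rmorph_nat.
  by rewrite nm_real ger0_norm // addr_ge0.
apply: (@lipschitz _ _ (1 / 2)) => // [|k|k].
- have e1 : nome (1 * 2) 1 = -1 :> C by exact: (@nome_half R 1).
  by rewrite nome_div e1 -subr_eq0 -opprD oppr_eq0 -(natrD _ 1 1) pnatr_eq0.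
- by rewrite e -[k.+1%:R]natr1; move: (ler0n R k); move: (k%:R : R) => u; lra.
- have -> : (1 / 2 : C) - k.+1%:R = - (1 / 2 + k%:R) by rewrite -[k.+1%:R]natr1; field.
  by rewrite nmN e -[k.+1%:R]natr1; move: (ler0n R k); move: (k%:R : R) => u; lra.
Qed.

(** Differencing gains one power of the distance, which is what makes the grouped double series
    absolutely convergent. *)
Lemma invsq_sub_le x y (g : R) : 0 < g -> g <= nm x -> g <= nm y -> nm (x - y) = 1 ->
  nm (x ^- 2 - y ^- 2) <= 2 * (g ^+ 3)^-1.
Proof.
move=> g0 gx gy xy.
have x0 : 0 < nm x by exact: lt_le_trans gx.
have y0 : 0 < nm y by exact: lt_le_trans gy.
have x0' : x != 0 by rewrite -nm_gt0.
have y0' : y != 0 by rewrite -nm_gt0.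
have -> : x ^- 2 - y ^- 2 = - (x - y) * (x^-1 * (y^-1 * y^-1) + (x^-1 * x^-1) * y^-1).
  by field; rewrite x0' y0'.
rewrite nmM nmN xy mul1r; apply: le_trans (nmD _ _) _; rewrite !nmM !nmV.
have ix : (nm x)^-1 <= g^-1 by rewrite lef_pV2 ?posrE.
have iy : (nm y)^-1 <= g^-1 by rewrite lef_pV2 ?posrE.
have ix0 : 0 <= (nm x)^-1 by rewrite invr_ge0 nm_ge0.
have iy0 : 0 <= (nm y)^-1 by rewrite invr_ge0 nm_ge0.
have -> : 2 * (g ^+ 3)^-1 = g^-1 * (g^-1 * g^-1) + (g^-1 * g^-1) * g^-1.
  by rewrite -exprVn; ring.
by apply: lerD; repeat (apply: ler_pM; rewrite ?mulr_ge0 //).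
Qed.

End LatticeBounds.

(** * The fourth powers of the theta constants *)

Section Lambert.
Variable R : realType.
Notation C := (cplx R).
Implicit Types (x y z w : C) (r s : R).

Definition sumf (g : nat -> C -> C) w : C := lim (series (fun m => g m w) @ \oo).

Lemma sumf_cvg g w : mbound g -> nm w < 1 -> series (fun m => g m w) @ \oo --> sumf g w.
Proof.
move=> gb w1; have [l hl] := mbound_cvg gb w1.
by rewrite /sumf (cvg_lim _ hl) //; exact: norm_hausdorff.
Qed.

Lemma ana_sumf g : (forall m, ana (g m)) -> mbound g -> ana (sumf g).
Proof. by move=> gana gb; apply: (ana_mtest gana gb) => w; exact: sumf_cvg. Qed.

(** Up to the factor 4 pi^2 this is [csc2] as a function of minus the nome; the symmetry [hk_inv] is
    the evenness of [csc2]. *)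
Definition hk w : C := w * ((1 + w)^-1) ^+ 2.

Lemma ana_inv1D : ana (fun w : C => (1 + w)^-1).
Proof.
have h : nm (-1 : C) <= 1 by rewrite nmN nm1.
apply: ana_ext (ana_comp (ltn0Sn 0) h (ana_inv1B R)) => w _.
by rewrite expr1 mulN1r opprK.
Qed.

Lemma nm_expr_lt1 w n : nm w < 1 -> (0 < n)%N -> nm (w ^+ n) < 1.
Proof. by move=> w1 n0; rewrite nmX exprn_ilt1 ?nm_ge0 // -lt0n. Qed.

Lemma nm_expr_le w r n : nm w <= r -> r < 1 -> (0 < n)%N -> nm (w ^+ n) <= r.
Proof.
move=> wr r1 n0; rewrite nmX -(prednK n0) exprS; apply: (le_trans _ wr).
by rewrite ler_piMr ?nm_ge0 // exprn_ile1 ?nm_ge0 // (le_trans wr) // ltW.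
Qed.

Lemma neq1_disc w : nm w < 1 -> 1 + w != 0.
Proof.
move=> w1; apply/eqP => /eqP; rewrite addrC addr_eq0 => /eqP e.
by move: w1; rewrite e nmN nm1 ltxx.
Qed.

(* The general terms of the sums A = sum_m w^m / (1 + w^m)^2 over m >= 1 and O = the
   same sum over odd m, both divided by w. *)
Definition gA (m : nat) w : C := w ^+ m * ((1 + w ^+ m.+1)^-1) ^+ 2.
Definition gO (m : nat) w : C := w ^+ m.*2 * ((1 + w ^+ m.*2.+1)^-1) ^+ 2.

Lemma gA_ana m : ana (gA m).
Proof.
apply: ana_monoM; apply: anaX.
have h : nm (1 : C) <= 1 by rewrite nm1.
by apply: ana_ext (ana_comp (ltn0Sn m) h ana_inv1D) => w _; rewrite mul1r.
Qed.
Lemma gO_ana m : ana (gO m).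
Proof.
apply: ana_monoM; apply: anaX.
have h : nm (1 : C) <= 1 by rewrite nm1.
by apply: ana_ext (ana_comp (ltn0Sn m.*2) h ana_inv1D) => w _; rewrite mul1r.
Qed.
Lemma gA_mbound : mbound gA.
Proof.
move=> r /andP[r0 r1]; have [|B HB] := ana_bnd (r := r) ana_inv1D; first by rewrite ltW.
exists (B ^+ 2), r; split; first by rewrite ltW.
move=> m w wr; rewrite nmM !nmX mulrC; apply: ler_pM; rewrite ?exprn_ge0 ?nm_ge0 //.
  by rewrite ler_sqr ?nnegrE ?nm_ge0 //; [exact: HB (nm_expr_le wr r1 _)|apply: le_trans (nm_ge0 _) (HB 0 _); rewrite nm0 ltW].
by rewrite lerXn2r ?nnegrE ?nm_ge0 // ltW.
Qed.
Lemma gO_mbound : mbound gO.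
Proof.
move=> r /andP[r0 r1]; have [|B HB] := ana_bnd (r := r) ana_inv1D; first by rewrite ltW.
exists (B ^+ 2), r; split; first by rewrite ltW.
move=> m w wr; rewrite nmM !nmX mulrC; apply: ler_pM; rewrite ?exprn_ge0 ?nm_ge0 //.
  by rewrite ler_sqr ?nnegrE ?nm_ge0 //; [exact: HB (nm_expr_le wr r1 _)|apply: le_trans (nm_ge0 _) (HB 0 _); rewrite nm0 ltW].
have w1 : nm w <= 1 by apply: le_trans wr (ltW r1).
apply: (@le_trans _ _ (nm w ^+ m)); last by rewrite lerXn2r ?nnegrE ?nm_ge0 // ltW.
by rewrite ler_wiXn2l ?nm_ge0 // -addnn leq_addr.
Qed.

Definition sA := sumf gA.
Definition sO := sumf gO.
(* vt s = theta_4 ^ 4 = 1 + 8 sum_(m >= 1) (-1)^m s^m / (1 + s^m)^2, where s = exp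
   (i pi z). *)
Definition vt w : C := 1 + 8 * (w ^+ 2 * sA (w ^+ 2)) - 8 * (w * sO w).

Lemma sA_ana : ana sA. Proof. exact: ana_sumf gA_ana gA_mbound. Qed.
Lemma sO_ana : ana sO. Proof. exact: ana_sumf gO_ana gO_mbound. Qed.

Lemma ana_compX f k : (0 < k)%N -> ana f -> ana (fun w : C => f (w ^+ k)).
Proof.
move=> k0 hf; have h : nm (1 : C) <= 1 by rewrite nm1.
by apply: ana_ext (ana_comp k0 h hf) => w _; rewrite mul1r.
Qed.
Lemma ana_compN f : ana f -> ana (fun w : C => f (- w)).
Proof.
move=> hf; have h : nm (-1 : C) <= 1 by rewrite nmN nm1.
by apply: ana_ext (ana_comp (ltn0Sn 0) h hf) => w _; rewrite mulN1r expr1.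
Qed.

Lemma vt_ana : ana vt.
Proof.
apply: anaB; [apply: anaD; first exact: ana_cst|]; apply: anaZ.
  by apply: ana_monoM; apply: ana_compX => //; exact: sA_ana.
by apply: anaM; [exact: ana_id|exact: sO_ana].
Qed.

Lemma vt0 : vt 0 = 1.
Proof. by rewrite /vt expr0n /= !mul0r !mulr0 subr0 addr0. Qed.

Lemma sO0 : sO 0 = 1.
Proof.
have z1 : nm (0 : C) < 1 by rewrite nm0.
apply: (@cvgC_unique _ _ _ _ (sumf_cvg gO_mbound z1)).
apply: (@cvgC_eq _ (fun=> 1)); last exact: cvgC_cst.
exists 1%N => -[//|n] _; rewrite seriesCE big_ord_recl /gO expr0 expr0n addr0 invr1 expr1n mulr1 big1 ?addr0 // => i _.
by rewrite /= expr0n mul0r.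
Qed.

Lemma seriesA w : nm w < 1 -> series (fun m => hk (w ^+ m.+1)) @ \oo --> w * sA w.
Proof.
move=> w1; have := @cvgCZ _ _ _ w (sumf_cvg gA_mbound w1); apply: cvgC_eq; exists 0%N => n _.
by rewrite !seriesCE mulr_sumr; apply: eq_bigr => i _; rewrite /gA /hk mulrA -exprS.
Qed.
Lemma seriesO w : nm w < 1 -> series (fun m => hk (w ^+ m.*2.+1)) @ \oo --> w * sO w.
Proof.
move=> w1; have := @cvgCZ _ _ _ w (sumf_cvg gO_mbound w1); apply: cvgC_eq; exists 0%N => n _.
by rewrite !seriesCE mulr_sumr; apply: eq_bigr => i _; rewrite /gO /hk mulrA -exprS.
Qed.

Lemma cvgC_sub (u : nat -> C) (l : C) (k : nat -> nat) : (forall n, (n <= k n)%N) ->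
  u @ \oo --> l -> (fun n => u (k n)) @ \oo --> l.
Proof.
move=> kn /cvgCP H; apply/cvgCP => e /H[N HN]; exists N => n Nn.
by apply: HN; exact: leq_trans (kn n).
Qed.

Lemma leq_double n : (n <= n.*2)%N. Proof. by rewrite -addnn leq_addr. Qed.

Lemma series_even_odd (f : nat -> C) n :
  series f n.*2 = series (fun m => f m.*2) n + series (fun m => f m.*2.+1) n.
Proof.
rewrite !seriesCE; elim: n => [|n IH]; first by rewrite !big_ord0 addr0.
by rewrite doubleS !big_ord_recr /= IH; ring.
Qed.

Lemma sA_split w : nm w < 1 -> w * sA w = w * sO w + w ^+ 2 * sA (w ^+ 2).
Proof.
move=> w1; have w2 := nm_expr_lt1 w1 (ltn0Sn 1).
apply: (@cvgC_unique _ _ _ _ (cvgC_sub leq_double (seriesA w1))).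
have := cvgCD (seriesO w1) (seriesA w2); apply: cvgC_eq; exists 0%N => n _.
rewrite series_even_odd; congr (_ + _); rewrite !seriesCE; apply: eq_bigr => i _.
by rewrite -exprM mul2n.
Qed.

(** Only odd exponents occur, so it holds termwise, from [hk x + hk (- x) = 4 * hk (- x ^+ 2)]. *)
Lemma sO_sum w : nm w < 1 -> w * sO w + (- w) * sO (- w) = 4 * (- w ^+ 2 * sO (- w ^+ 2)).
Proof.
move=> w1; have w1' : nm (- w) < 1 by rewrite nmN.
have w2 : nm (- w ^+ 2) < 1 by rewrite nmN nm_expr_lt1.
apply: (@cvgC_unique _ _ _ _ (cvgCD (seriesO w1) (seriesO w1'))).
have := @cvgCZ _ _ _ 4 (seriesO w2); apply: cvgC_eq; exists 0%N => n _.
rewrite [series _ n]seriesCE [in X in _ = X + _]seriesCE [in X in _ = _ + X]seriesCE -big_split mulr_sumr; apply: eq_bigr => i _ /=.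
have odd1 : odd i.*2.+1 by rewrite /= odd_double.
rewrite exprNn [X in _ = _ + hk X]exprNn -signr_odd odd1 expr1 !mulN1r -exprM mulnC exprM.
have h1 := nm_expr_lt1 w1 (ltn0Sn i.*2); move: (w ^+ i.*2.+1) h1 => x x1.
have h2 := neq1_disc x1; have h3 : 1 - x != 0 by apply: neq1_disc; rewrite nmN.
have h4 : 1 - x ^+ 2 != 0.
  by rewrite (_ : 1 - x ^+ 2 = (1 + x) * (1 - x)) ?mulf_neq0 //; ring.
by rewrite /hk; field; rewrite h2 h3 h4.
Qed.

(** The odd part of the sum over all m is governed by [sO_sum], and [sA_split] at w^2 rewrites the
    remaining even part. *)
Lemma vt_linear w : nm w < 1 -> vt w + vt (- w) = 4 * vt (- w ^+ 2) - 2 * vt (w ^+ 2).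
Proof.
move=> w1; have w2 := nm_expr_lt1 w1 (ltn0Sn 1).
have h1 := sA_split w2; have h2 := sO_sum w1.
have -> : vt w + vt (- w) = 2 + 16 * (w ^+ 2 * sA (w ^+ 2)) - 8 * (w * sO w + (- w) * sO (- w)).
  by rewrite /vt sqrrN; move: (sA _) (sO w) (sO _) => X Y Z; ring.
rewrite h2 h1 /vt sqrrN; move: (sA _) (sO (w ^+ 2)) (sO _) => X Y Z; ring.
Qed.

Lemma vt_diff w : vt w - vt (- w) = - (8 * (w * sO w - (- w) * sO (- w))).
Proof. by rewrite /vt sqrrN; move: (sA _) (sO w) (sO _) => X Y Z; ring. Qed.

End Lambert.

(** * The transformation z |-> -1/z *)

Section Inversion.
Variable R : realType.
Notation C := (cplx R).
Implicit Types (x y z w : C) (r s : R).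

Definition pc : C := pi%:C.

Lemma csc2_half y : csc2 (y / 2) = 4 * pc ^+ 2 * hk (- nome 2 y).
Proof.
rewrite /csc2 nome_div /hk /pc -exprVn; move: (nome _ y) pi%:C => s p; ring.
Qed.
Lemma csc2_half1 y : csc2 ((y + 1) / 2) = 4 * pc ^+ 2 * hk (nome 2 y).
Proof.
rewrite /csc2 nome_div nomeD (@nome_half R 1) // mulrN1 opprK /hk /pc -exprVn.
by move: (nome _ y) pi%:C => s p; ring.
Qed.
Lemma hk_inv w : hk w^-1 = hk w.
Proof.
rewrite /hk; have [->|w0] := eqVneq w 0; first by rewrite invr0.
have -> : 1 + w^-1 = (1 + w) / w by field.
by rewrite invfM invrK; move: ((1 + w)^-1) => u; field.
Qed.

Lemma series_csc2 z : complex.Im z != 0 ->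
  series (fun k => (z + k.*2%:R) ^- 2 + (z - k.*2.+2%:R) ^- 2) @ \oo --> csc2 (z / 2) / 4.
Proof.
move=> z0.
have z2 : complex.Im (z / 2) != 0 by rewrite ImVn mulf_neq0 // invr_eq0.
have h := @cvgCZ _ _ _ 4^-1 (lipschitz_Im z2); rewrite [4^-1 * csc2 _]mulrC in h.
apply: cvgC_eq h; exists 0%N => n _.
rewrite !seriesCE mulr_sumr; apply: eq_bigr => k _.
have e1 : z + k.*2%:R = 2 * (z / 2 + k%:R) by rewrite -muln2 natrM; field.
have e2 : z - k.*2.+2%:R = 2 * (z / 2 - k.+1%:R) by rewrite -doubleS -muln2 natrM; field.
have e3 u : ((2 * u) ^+ 2)^-1 = 4^-1 * (u ^+ 2)^-1 :> C.
  by rewrite exprMn invfM -natrX.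
by rewrite e1 e2 !e3 mulrDr.
Qed.

Lemma series_csc2_odd z : complex.Im z != 0 \/ z = 0 ->
  series (fun k => (z + k.*2.+1%:R) ^- 2 + (z - k.*2.+1%:R) ^- 2) @ \oo --> csc2 ((z + 1) / 2) / 4.
Proof.
move=> hz; have H : series (fun k => ((z + 1) / 2 + k%:R) ^- 2 + ((z + 1) / 2 - k.+1%:R) ^- 2) @ \oo --> csc2 ((z + 1) / 2).
  case: hz => [z0|->].
    by apply: lipschitz_Im; rewrite ImVn ImD addr0 mulf_neq0 // invr_eq0.
  by rewrite add0r; exact: lipschitz_half.
have h := @cvgCZ _ _ _ 4^-1 H; rewrite [4^-1 * csc2 _]mulrC in h.
apply: cvgC_eq h; exists 0%N => n _.
rewrite !seriesCE mulr_sumr; apply: eq_bigr => k _.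
have e1 : z + k.*2.+1%:R = 2 * ((z + 1) / 2 + k%:R).
  by rewrite -[k.*2.+1%:R]natr1 -muln2 natrM; field.
have e2 : z - k.*2.+1%:R = 2 * ((z + 1) / 2 - k.+1%:R).
  by rewrite -[k.*2.+1%:R]natr1 -[k.+1%:R]natr1 -muln2 natrM; field.
have e3 u : ((2 * u) ^+ 2)^-1 = 4^-1 * (u ^+ 2)^-1 :> C.
  by rewrite exprMn invfM -natrX.
by rewrite e1 e2 !e3 mulrDr.
Qed.

(* The double series of the squares of the inverses of (2j+1) z + m converges only
   conditionally; grouping m with m + 1, of opposite signs, makes it absolutely
   convergent. Summing first over m yields vt s - vt (- s), first over j yields vt
   at the image of s under z |-> -1/z. *)
Definition cc z (j m : nat) : C :=
  (j.*2.+1%:R * z + m%:R) ^- 2 + (j.*2.+1%:R * z - m%:R) ^- 2.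
Definition dd z (m j : nat) : C := (-1) ^+ m * (cc z j m - cc z j m.+1).

(** Every lattice point involved is bounded below in modulus both by a multiple of m + 1 and by a
    multiple of j + 1, hence by their geometric mean [g]; each of the two differences is then at
    most 2 / g^3. *)
Lemma dd_bnd z : 0 < complex.Im z -> exists K : R, 0 <= K /\
  forall m j, nm (dd z m j) <= K * p32 R m * p32 R j.
Proof.
move=> z0; have k0 := lkap_gt0 z0; exists (4 * (lkap z ^+ 3)^-1).
split; first by rewrite mulr_ge0 ?invr_ge0 ?exprn_ge0 // ltW.
move=> m j; pose sq (n : nat) : R := Num.sqrt n.+1%:R.
have sq0 n : 0 < sq n by rewrite sqrtr_gt0.
have sq2 n : sq n ^+ 2 = n.+1%:R by rewrite sqr_sqrtr.
pose g := lkap z * (sq m * sq j).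
have g0 : 0 < g := mulr_gt0 k0 (mulr_gt0 (sq0 m) (sq0 j)).
have gb w : lkap z * j.*2.+1%:R <= nm w -> lkap z * m.+1%:R <= nm w -> g <= nm w.
  move=> h1 h2; have h1' : lkap z * j.+1%:R <= nm w.
    by apply: le_trans h1; rewrite ler_wpM2l ?(ltW k0) // ler_nat ltnS leq_double.
  rewrite -ler_sqr ?nnegrE ?nm_ge0 ?(ltW g0) //.
  have -> : g ^+ 2 = (lkap z * m.+1%:R) * (lkap z * j.+1%:R).
    by rewrite -(sq2 m) -(sq2 j) /g; ring.
  by rewrite expr2 ler_pM // mulr_ge0 ?(ltW k0).
have lb m' : (m <= m')%N -> g <= nm (j.*2.+1%:R * z + m'%:R) /\ g <= nm (j.*2.+1%:R * z - m'%:R).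
  move=> mm; have le : lkap z * m.+1%:R <= lkap z * m'.+1%:R.
    by rewrite ler_wpM2l ?(ltW k0) // ler_nat.
  have [a1 a2] := @lattice_lb R z j.*2.+1 m' (j.*2.+1%:R * z + m'%:R) z0 (ltn0Sn _) (or_introl erefl).
  have [b1 b2] := @lattice_lb R z j.*2.+1 m' (j.*2.+1%:R * z - m'%:R) z0 (ltn0Sn _) (or_intror erefl).
  by split; apply: gb => //; apply: le_trans le _.
have [p1 p2] := lb m (leqnn m); have [q1 q2] := lb m.+1 (leqnSn m).
have -> : 4 * (lkap z ^+ 3)^-1 * p32 R m * p32 R j = 2 * (g ^+ 3)^-1 + 2 * (g ^+ 3)^-1.
  rewrite /p32 -/(sq m) -/(sq j) -(sq2 m) -(sq2 j) /g; have := sq0 m; have := sq0 j.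
  by move: (sq m) (sq j) (lkap z) k0 => u v k k1 v0 u0; field; rewrite !gt_eqF.
rewrite /dd nmM nmX nmN nm1 expr1n mul1r /cc.
set a := (_ + m%:R) ^- 2; set b := (_ - m%:R) ^- 2; set a' := (_ + m.+1%:R) ^- 2; set b' := (_ - m.+1%:R) ^- 2.
have -> : a + b - (a' + b') = (a - a') + (b - b') by ring.
apply: le_trans (nmD _ _) _; apply: lerD; apply: invsq_sub_le => //.
- have -> : j.*2.+1%:R * z + m%:R - (j.*2.+1%:R * z + m.+1%:R) = -1.
    by rewrite -[m.+1%:R]natr1; ring.
  by rewrite nmN nm1.
- have -> : j.*2.+1%:R * z - m%:R - (j.*2.+1%:R * z - m.+1%:R) = 1.
    by rewrite -[m.+1%:R]natr1; ring.
  exact: nm1.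
Qed.

(** In a pair of consecutive terms the even integers occur with sign + and the odd ones, twice, with
    sign -. The even part is [series_csc2] at y plus [series_csc2] at -y, which restores the
    symmetry of the pairing. *)
Lemma dd_row z j : 0 < complex.Im z -> let x := nome 2 z ^+ j.*2.+1 in
  forall l : C, series (fun m => dd z m j) @ \oo --> l -> l = 2 * pc ^+ 2 * (hk (- x) - hk x).
Proof.
move=> z0 x l hl; pose y := j.*2.+1%:R * z.
have y0 : complex.Im y != 0 by rewrite ImMn mulf_neq0 ?gt_eqF.
have yN : complex.Im (- y) != 0 by rewrite ImN oppr_eq0.
have xE : x = nome 2 y by rewrite /y nomeMn.
have h1 := series_csc2 y0; have h2 := series_csc2 yN.
have h3 := series_csc2_odd (or_introl y0).
have e : csc2 (- y / 2) = csc2 (y / 2).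
  by rewrite !csc2_half nomeN -invrN hk_inv.
rewrite e in h2.
have lim := cvgCB (cvgCD h1 h2) (@cvgCZ _ _ _ 2 h3).
apply: (@cvgC_unique _ _ _ _ (cvgC_sub leq_double hl)).
have -> : 2 * pc ^+ 2 * (hk (- x) - hk x) = csc2 (y / 2) / 4 + csc2 (y / 2) / 4 - 2 * (csc2 ((y + 1) / 2) / 4).
  by rewrite csc2_half csc2_half1 -xE; move: (hk _) (hk x) pc => u v p; field.
apply: cvgC_eq lim; exists 0%N => n _; rewrite series_even_odd !seriesCE -!big_split mulr_sumr -sumrB /=.
apply: eq_bigr => k _; rewrite /dd /cc -/y.
have e0 : (-1 : C) ^+ k.*2 = 1 by rewrite -signr_odd odd_double.
have e1 : (-1 : C) ^+ k.*2.+1 = -1 by rewrite exprS e0 mulr1.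
rewrite e0 e1.
have -> : (- y + k.*2%:R) ^- 2 = (y - k.*2%:R) ^- 2 by rewrite -sqrrN opprD opprK.
have -> : (- y - k.*2.+2%:R) ^- 2 = (y + k.*2.+2%:R) ^- 2 by rewrite -opprD sqrrN.
ring.
Qed.

(** Taking z out of (2j+1) z + m and (2j+1) z - m leaves a sum over odd integers at the point
    -m/z. *)
Lemma cc_col z m : 0 < complex.Im z ->
  series (fun j => cc z j m) @ \oo --> pc ^+ 2 * z ^- 2 * hk (nome 2 (- z^-1) ^+ m).
Proof.
move=> z0; have z0' := uhp_neq0 z0; pose x := m%:R * - z^-1.
have hx : complex.Im x != 0 \/ x = 0.
  case: m @x => [|m] x; [right|left]; first by rewrite /x mul0r.
  by rewrite /x ImMn mulf_neq0 ?gt_eqF ?Im_Ninv_gt0.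
have := @cvgCZ _ _ _ (z ^- 2) (series_csc2_odd hx).
have -> : z ^- 2 * (csc2 ((x + 1) / 2) / 4) = pc ^+ 2 * z ^- 2 * hk (nome 2 (- z^-1) ^+ m).
  by rewrite csc2_half1 /x nomeMn; field.
apply: cvgC_eq; exists 0%N => n _; rewrite !seriesCE mulr_sumr; apply: eq_bigr => j _.
rewrite /cc mulrDr -!invfM -!exprMn addrC; congr (_^-1 + _^-1).
  by rewrite -sqrrN; congr (_ ^+ 2); rewrite /x; field.
by congr (_ ^+ 2); rewrite /x; field.
Qed.

Lemma seriesZB (u v w : nat -> C) (c : C) n : (forall j, c * (u j - v j) = w j) ->
  c * (series u n - series v n) = series w n.
Proof. by move=> h; rewrite !seriesCE -sumrB mulr_sumr; apply: eq_bigr => j _; exact: h. Qed.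

(** Summation by parts: undoing the grouping counts each inner value twice, but [h 0] only once. *)
Lemma alt_sum (h : nat -> C) (p : C) n :
  series (fun m => (-1) ^+ m * (p * h m - p * h m.+1)) n.*2 =
  p * (2 * series (fun k => h k.*2.+2) n - 2 * series (fun k => h k.*2.+1) n + (h 0%N - h n.*2)).
Proof.
rewrite series_even_odd !seriesCE; elim: n => [|n IH].
  by rewrite !big_ord0; ring.
rewrite !big_ord_recr /=.
have -> (a b c d : C) : a + b + (c + d) = (a + c) + (b + d) by ring.
rewrite IH doubleS.
have e0 : (-1 : C) ^+ n.*2 = 1 by rewrite -signr_odd odd_double.
have e1 : (-1 : C) ^+ n.*2.+1 = -1 by rewrite exprS e0 mulr1.
by rewrite e0 e1; ring.
Qed.

Lemma vt_inv z : 0 < complex.Im z ->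
  vt (nome 2 (- z^-1)) = z ^+ 2 * (vt (nome 2 z) - vt (- nome 2 z)).
Proof.
move=> z0; have z0' := uhp_neq0 z0; have w0 := Im_Ninv_gt0 z0.
set S := nome 2 (- z^-1); set s := nome 2 z.
have S1 : nm S < 1 by exact: nm_nome_lt1.
have s1 : nm s < 1 by exact: nm_nome_lt1.
have s1' : nm (- s) < 1 by rewrite nmN.
pose Cm m := pc ^+ 2 * z ^- 2 * hk (S ^+ m).
have colm m : series (dd z m) @ \oo --> (-1) ^+ m * (Cm m - Cm m.+1).
  have := @cvgCZ _ _ _ ((-1) ^+ m) (cvgCB (@cc_col z m z0) (@cc_col z m.+1 z0)).
  apply: cvgC_eq; exists 0%N => n _; rewrite !seriesCE -sumrB mulr_sumr; exact: eq_bigr.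
have [K [K0 HK]] := dd_bnd z0.
have pcvg := @p32_cvg R.
have KpC : cvgn (series (fun m => K * p32 R m)).
  have /cvg_ex[/= t ht] := pcvg; apply/cvg_ex; exists (K * t).
  have -> : series (fun m => K * p32 R m) = (fun n => K * series (p32 R) n).
    by apply/funext => n; rewrite !seriesRE mulr_sumr.
  exact: (cvgM (cvg_cst K) ht).
have rowj j : series (fun m => dd z m j) @ \oo --> 2 * pc ^+ 2 * (hk (- s ^+ j.*2.+1) - hk (s ^+ j.*2.+1)).
  have [|l hl] := @abs_cvg R (fun m => dd z m j) (fun m => K * p32 R m * p32 R j) (fun m => HK m j).
    have /cvg_ex[/= t ht] := KpC; apply/cvg_ex; exists (p32 R j * t).
    have -> : series (fun m => K * p32 R m * p32 R j) = (fun n => p32 R j * series (fun m => K * p32 R m) n).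
      by apply/funext => n; rewrite !seriesRE mulr_sumr; apply: eq_bigr => i _; rewrite mulrC.
    exact: (cvgM (cvg_cst (p32 R j)) ht).
  by rewrite -(dd_row z0 hl).
have [T [h1 h2]] := @fubini_prod R (dd z) (fun m => K * p32 R m) (p32 R) _ _
  (fun m => mulr_ge0 K0 (p32_ge0 R m)) (p32_ge0 R) HK KpC pcvg colm rowj.
have TR : T = pc ^+ 2 / 4 * (vt s - vt (- s)).
  rewrite vt_diff; apply: (@cvgC_unique _ _ _ _ h2).
  have := @cvgCZ _ _ _ (2 * pc ^+ 2) (cvgCB (seriesO s1') (seriesO s1)).
  have -> : 2 * pc ^+ 2 * (- s * sO (- s) - s * sO s) = pc ^+ 2 / 4 * - (8 * (s * sO s - - s * sO (- s))).
    by move: (sO s) (sO _) pc => u v p; field.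
  apply: cvgC_eq; exists 0%N => n _; apply: seriesZB => j.
  by congr (_ * (hk _ - _)); rewrite exprNn -signr_odd /= odd_double expr1 mulN1r.
(* The constant term 1 of [vt] comes from the singly counted value [hk 1], which is 1/4. *)
have TL : T = pc ^+ 2 / 4 * z ^- 2 * vt S.
  apply: (@cvgC_unique _ _ _ _ (cvgC_sub leq_double h1)).
  have S2 : nm (S ^+ 2) < 1 by exact: nm_expr_lt1.
  have hS : (fun n => hk (S ^+ n)) @ \oo --> (0 : C).
    have e0 := expC_cvg0 S1; have e1 := cvgCD (@cvgC_cst R 1) e0; rewrite addr0 in e1.
    have e2 : (fun n => (1 + S ^+ n)^-1) @ \oo --> (1 : C).
      exact: (cvgC_inv1 e1).
    by have := cvgCM e0 (cvgCM e2 e2); rewrite mul0r.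
  have lim := cvgCD (cvgCB (@cvgCZ _ _ _ 2 (seriesA S2)) (@cvgCZ _ _ _ 2 (seriesO S1)))
    (@cvgCBr _ _ _ (hk 1) (cvgC_sub leq_double hS)).
  have := @cvgCZ _ _ _ (pc ^+ 2 * z ^- 2) lim.
  have -> : pc ^+ 2 * z ^- 2 * (2 * (S ^+ 2 * sA (S ^+ 2)) - 2 * (S * sO S) + (hk 1 - 0)) =
      pc ^+ 2 / 4 * z ^- 2 * vt S.
    rewrite /vt /hk; move: (sA _) (sO _) pc => u v p; field.
    exact: z0'.
  apply: cvgC_eq; exists 0%N => n _.
  have -> : (fun m : nat => hk ((S ^+ 2) ^+ m.+1)) = (fun k => hk (S ^+ k.*2.+2)).
    by apply/funext => k; rewrite -exprM mul2n doubleS.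
  by rewrite (@alt_sum (fun m => hk (S ^+ m))) expr0.
have p0 : pc ^+ 2 / 4 != 0.
  rewrite mulf_neq0 ?expf_neq0 ?invr_eq0 ?pnatr_eq0 //.
  by rewrite /pc eq_complex /= eqxx andbT gt_eqF ?pi_gt0.
have e : pc ^+ 2 / 4 * (vt s - vt (- s)) = pc ^+ 2 / 4 * (z ^- 2 * vt S).
  by rewrite mulrA -TL -TR.
by rewrite (mulfI p0 e) mulVKf ?expf_neq0.
Qed.

End Inversion.

(** * Uniqueness and the duplication formula *)

Section Quadratic.
Variable R : realType.
Notation C := (cplx R).
Implicit Types (x y z w : C) (f g k : C -> C).

Lemma ana_mul_zero f g : ana f -> ana g -> (forall w, nm w < 1 -> f w * g w = 0) ->
  (forall w, nm w < 1 -> f w = 0) \/ (forall w, nm w < 1 -> g w = 0).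
Proof.
move=> hf hg fg; case: (ana_order hf) => [|[n [f1 [hf1 f10 Ef]]]]; first by left.
case: (ana_order hg) => [|[m [g1 [hg1 g10 Eg]]]]; first by right.
have [d [/andP[d0 d1] hd]] := ana_neq0_near hf1 f10.
have [e [/andP[e0 e1] he]] := ana_neq0_near hg1 g10.
pose t := Num.min d e / 2; have t0 : 0 < t by rewrite divr_gt0 // lt_min d0.
have td : t < d.
  by apply: (@lt_le_trans _ _ (Num.min d e)); rewrite ?ge_min ?lexx // ltr_pdivrMr // ltr_pMr ?ltr1n // lt_min d0.
have te : t < e.
  by apply: (@lt_le_trans _ _ (Num.min d e)); rewrite ?ge_min ?lexx ?orbT // ltr_pdivrMr // ltr_pMr ?ltr1n // lt_min d0.
have nt : nm (t%:C : C) = t by rewrite nm_real gtr0_norm.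
have t1 : nm (t%:C : C) < 1 by rewrite nt; exact: lt_trans d1.
have tC : t%:C != 0 :> C by rewrite -nm_gt0 nt.
have /eqP := fg _ t1; rewrite Ef // Eg // !mulf_eq0 !expf_eq0 (negPf tC) !andbF /=.
by rewrite (negPf (hd _ _)) ?nt // (negPf (he _ _)) ?nt.
Qed.

Lemma ana_cancel f n : ana f -> (forall w, nm w < 1 -> w ^+ n * f w = 0) ->
  forall w, nm w < 1 -> f w = 0.
Proof.
move=> hf h; apply: ana_zero => // d /andP[d0 d1].
have d2 : 0 < d / 2 by rewrite divr_gt0.
have nd : nm ((d / 2)%:C : C) = d / 2 by rewrite nm_real gtr0_norm.
exists (d / 2)%:C; have dC : (d / 2)%:C != 0 :> C by rewrite -nm_gt0 nd.
have l : d / 2 < d by rewrite ltr_pdivrMr // ltr_pMr // ltr1n.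
split; rewrite ?nd //; have := h (d / 2)%:C; rewrite nd => /(_ (lt_trans l d1))/eqP.
by rewrite mulf_eq0 expf_eq0 (negPf dC) andbF /= => /eqP.
Qed.

Lemma ana_factor0 f : ana f -> f 0 = 0 -> exists k, ana k /\ forall w, nm w < 1 -> f w = w * k w.
Proof.
move=> hf f0; have z1 : nm (0 : C) < 1 by rewrite nm0.
have [k [hk H]] := ana_factor hf z1; exists k; split => // w w1.
by have := H w w1; rewrite f0 !subr0.
Qed.

Lemma nm01 : nm (0 : C) < 1. Proof. by rewrite nm0. Qed.

(* The lowest order at which two solutions differ is excluded by the quadratic
   relation, in which it appears multiplied by the first coefficient -8. *)
Lemma theta_uniq f1 f2 k1 k2 : ana f1 -> ana f2 -> ana k1 -> ana k2 ->
  (forall w, nm w < 1 -> f1 w = 1 + w * k1 w) -> (forall w, nm w < 1 -> f2 w = 1 + w * k2 w) ->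
  k1 0 = -8 -> k2 0 = -8 ->
  (forall w, nm w < 1 -> f1 w + f1 (- w) = 4 * f1 (- w ^+ 2) - 2 * f1 (w ^+ 2)) ->
  (forall w, nm w < 1 -> f2 w + f2 (- w) = 4 * f2 (- w ^+ 2) - 2 * f2 (w ^+ 2)) ->
  (forall w, nm w < 1 -> f1 (w ^+ 2) ^+ 2 = f1 w * f1 (- w)) ->
  (forall w, nm w < 1 -> f2 (w ^+ 2) ^+ 2 = f2 w * f2 (- w)) ->
  forall w, nm w < 1 -> f1 w = f2 w.
Proof.
move=> hf1 hf2 hk1 hk2 E1 E2 k10 k20 L1 L2 Q1 Q2.
case: (ana_order (anaB hf1 hf2)) => [h w w1|[n [d [hd d0 Ed]]]].
  by apply/eqP; rewrite -subr_eq0 h.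
exfalso; apply: (negP d0); apply/eqP.
(* Both series start with 1 - 8 w, so they can differ only from order 2 on. This leaves a positive
   power of w in front of [G] in [key], which therefore disappears at 0. *)
have n2 : (1 < n)%N.
  case: n Ed => [|[|//]] Ed; exfalso; apply: (negP d0); apply/eqP.
    by have := Ed 0 nm01; rewrite E1 ?E2 ?nm01 // !mul0r addr0 subrr expr0 mul1r.
  have := @ana_cancel (fun w => d w - (k1 w - k2 w)) 1 (anaB hd (anaB hk1 hk2)) _ 0 nm01.
  rewrite k10 k20 subrr subr0; apply => w w1; rewrite expr1.
  by have := Ed w w1; rewrite E1 // E2 // expr1 mulrBr => <-; ring.
pose S w := 4 * (-1) ^+ n * d (- w ^+ 2) - 2 * d (w ^+ 2).
have Dsq w : nm w < 1 -> f1 (w ^+ 2) = f2 (w ^+ 2) + w ^+ (n + n) * d (w ^+ 2).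
  move=> w1; have := Ed _ (nm_expr_lt1 w1 (ltn0Sn 1)); rewrite -exprM mul2n addnn => <-; ring.
have DsqN w : nm w < 1 -> f1 (- w ^+ 2) = f2 (- w ^+ 2) + w ^+ (n + n) * ((-1) ^+ n * d (- w ^+ 2)).
  move=> w1; have w2 : nm (- w ^+ 2) < 1 by rewrite nmN nm_expr_lt1.
  have := Ed _ w2; rewrite [(- w ^+ 2) ^+ n]exprNn -exprM mul2n addnn => e; rewrite mulrA [_ * (-1) ^+ n]mulrC -e; ring.
have DN w : nm w < 1 -> f1 (- w) = f2 (- w) + (f2 w - f1 w) + w ^+ (n + n) * S w.
  move=> w1; have := L1 w w1; have := L2 w w1; rewrite Dsq // DsqN // => h2 h1.
  have -> : f1 (- w) = (f1 w + f1 (- w)) - f1 w by ring.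
  rewrite h1 /S; have -> : f2 (- w) = (f2 w + f2 (- w)) - f2 w by ring.
  by rewrite h2; ring.
pose G w := d (w ^+ 2) * (f1 (w ^+ 2) + f2 (w ^+ 2)) - f2 w * S w.
have hS : ana S.
  exact: (anaB (anaZ (4 * (-1) ^+ n) (ana_compX (ltn0Sn 1) (ana_compN hd))) (anaZ 2 (ana_compX (ltn0Sn 1) hd))).
have hG : ana G.
  exact: (anaB (anaM (ana_compX (ltn0Sn 1) hd) (anaD (ana_compX (ltn0Sn 1) hf1) (ana_compX (ltn0Sn 1) hf2))) (anaM hf2 hS)).
have hM : ana (fun w => d w * (k1 (- w) + k2 w) + w ^+ n.-1 * G w).
  exact: (anaD (anaM hd (anaD (ana_compN hk1) hk2)) (ana_monoM n.-1 hG)).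
(* The difference of the two quadratic relations, with [f1 (- w)] eliminated by [DN]. After
   cancellation the value at 0 reads [d 0 * (-16) = 0]. *)
have key w : nm w < 1 -> w ^+ n.+1 * (d w * (k1 (- w) + k2 w) + w ^+ n.-1 * G w) = 0.
  move=> w1; have w1' : nm (- w) < 1 by rewrite nmN.
  have e : w ^+ (n + n) = w ^+ n.+1 * w ^+ n.-1 by rewrite -exprD addSnnS prednK // ltnW.
  have h1 := Q1 w w1; have h2 := Q2 w w1.
  have e2 : w ^+ (n + n) * G w = (f1 (w ^+ 2) ^+ 2 - f2 (w ^+ 2) ^+ 2) - f2 w * (f1 (- w) - f2 (- w) + f1 w - f2 w).
    by rewrite /G DN // Dsq //; ring.
  rewrite mulrDr mulrA [X in _ + X]mulrA -e e2 h1 h2 exprSr.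
  have -> : w ^+ n * w * d w * (k1 (- w) + k2 w) = (w ^+ n * d w) * (w * k1 (- w) + w * k2 w) by ring.
  rewrite -Ed //.
  have -> : w * k1 (- w) = 1 - f1 (- w) by rewrite (E1 _ w1'); ring.
  have -> : w * k2 w = f2 w - 1 by rewrite (E2 _ w1); ring.
  ring.
have := ana_cancel hM key nm01.
rewrite oppr0 k10 k20 expr0n -[n.-1 == 0%N]negbK -lt0n -ltnS prednK ?n2 /=; last exact: ltnW.
rewrite mul0r addr0 => /eqP; rewrite mulf_eq0 => /orP[/eqP //|].
by rewrite -opprD oppr_eq0 -(natrD _ 8 8) pnatr_eq0.
Qed.

(* theta_4 ^ 4, theta_3 ^ 4 and theta_2 ^ 4 as functions of z. *)
Definition u4 z := vt (nome 2 z) : C.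
Definition u3 z := vt (- nome 2 z) : C.
Definition u2 z := u3 z - u4 z.

Lemma nome2_shift z : nome 2 (z + 1) = - nome 2 z :> C.
Proof. by rewrite nomeD (@nome_half R 1) // mulrN1. Qed.
Lemma u4T z : u4 (z + 1) = u3 z. Proof. by rewrite /u4 nome2_shift. Qed.
Lemma u3T z : u3 (z + 1) = u4 z. Proof. by rewrite /u3 nome2_shift opprK. Qed.
Lemma u2T z : u2 (z + 1) = - u2 z.
Proof. by rewrite /u2 (u3T z) (u4T z); move: (u3 z) (u4 z) => a b; rewrite opprB. Qed.
Lemma u4S z : 0 < complex.Im z -> u4 (- z^-1) = - z ^+ 2 * u2 z.
Proof.
move=> z0; rewrite /u2 /u3 /u4 (vt_inv z0).
by move: (vt _) (vt (- _)) => a b; rewrite mulNr -mulrN opprB.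
Qed.
Lemma u2S z : 0 < complex.Im z -> u2 (- z^-1) = - z ^+ 2 * u4 z.
Proof.
move=> z0; have := u4S (Im_Ninv_gt0 z0); rewrite invrN invrK opprK => ->.
have z2 : z ^+ 2 != 0 by rewrite expf_neq0 // uhp_neq0.
by rewrite sqrrN exprVn mulrA mulrNN mulfV // mul1r.
Qed.
Lemma u3E z : u3 z = u2 z + u4 z.
Proof. by rewrite /u2; move: (u3 z) (u4 z) => a b; rewrite subrK. Qed.
Lemma u3S z : 0 < complex.Im z -> u3 (- z^-1) = - z ^+ 2 * u3 z.
Proof. by move=> z0; rewrite !u3E u2S // u4S // -mulrDr addrC. Qed.

(** Normalized so that theta_2^4 is [16 * (w * t1 w)], with constant term 1 (see [vt_t1]). *)
Definition t1 w : C := (sO w + sO (- w)) / 2.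
Lemma t1_ana : ana t1.
Proof.
apply: ana_ext (anaZ (2^-1) (anaD (sO_ana R) (ana_compN (sO_ana R)))) => w _.
by rewrite /t1 mulrC.
Qed.
Lemma t1_0 : t1 0 = 1.
Proof. by rewrite /t1 oppr0 sO0 -[1 + 1]/2%:R divff ?pnatr_eq0. Qed.
Lemma vt_t1 w : vt (- w) - vt w = 16 * (w * t1 w).
Proof.
by rewrite -opprB vt_diff /t1 opprK; move: (sO w) (sO (- w)) => u v; field.
Qed.
Lemma u2_t1 z : u2 z = 16 * (nome 2 z * t1 (nome 2 z)).
Proof. exact: vt_t1. Qed.

(* fX = 0 is the duplication formula for theta_4. SL_2(Z) permutes fX, fY and fZ up
   to weight factors, and their product vanishes to order 8 in [nome 4]: too much
   for a form of weight 12. *)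
Definition fX z := u4 (2 * z) ^+ 2 - u3 z * u4 z.
Definition fY z := u2 (z / 2) ^+ 2 / 16 - u2 z * u3 z.
Definition fZ z := u2 ((z + 1) / 2) ^+ 2 / 16 + u2 z * u4 z.

Lemma u4T2 z : u4 (z + 2) = u4 z.
Proof. by rewrite (_ : z + 2 = z + 1 + 1) ?u4T ?u3T //; ring. Qed.
Lemma fXT z : fX (z + 1) = fX z.
Proof.
rewrite /fX (u3T z) (u4T z) mulrDr mulr1 (u4T2 (2 * z)).
by move: (u4 _) (u3 z) (u4 z) => a b c; ring.
Qed.
Lemma fYT z : fY (z + 1) = fZ z.
Proof.
rewrite /fY /fZ (u3T z) (u2T z).
by move: (u2 _) (u2 z) (u4 z) => a b c; ring.
Qed.
Lemma fZT z : fZ (z + 1) = fY z.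
Proof.
rewrite /fY /fZ (u4T z) (u2T z) (_ : (z + 1 + 1) / 2 = z / 2 + 1); last by field.
rewrite (u2T (z / 2)); move: (u2 _) (u2 z) (u3 z) => a b c; ring.
Qed.

Lemma fXS z : 0 < complex.Im z -> fX (- z^-1) = z ^+ 4 * fY z.
Proof.
move=> z0; have zn := uhp_neq0 z0; rewrite /fX /fY (u3S z0) (u4S z0).
have z2 : 0 < complex.Im (z / 2) by rewrite ImVn divr_gt0.
have -> : 2 * - z^-1 = - (z / 2)^-1 by field.
by rewrite (u4S z2); move: (u2 _) (u2 z) (u3 z) => a b c; field.
Qed.

Lemma fYS z : 0 < complex.Im z -> fY (- z^-1) = z ^+ 4 * fX z.
Proof.
move=> z0; have zn := uhp_neq0 z0; have w0 := Im_Ninv_gt0 z0.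
have := fXS w0; rewrite invrN invrK opprK => ->.
by move: (fY _) => a; field.
Qed.

Lemma fZS z : 0 < complex.Im z -> fZ (- z^-1) = z ^+ 4 * fZ z.
Proof.
move=> z0; have zn := uhp_neq0 z0; rewrite /fZ (u2S z0) (u4S z0).
(* The image ((-1/z) + 1)/2 = (z - 1)/(2z) is reached from rho by an inversion, a translation by -2
   and another inversion, because x rho = -z. *)
pose rho := (z - 1) / 2; pose x := - rho^-1 - 2.
have rho0 : 0 < complex.Im rho by rewrite ImVn ImD ImN oppr0 addr0 divr_gt0.
have rn := uhp_neq0 rho0.
have x0 : 0 < complex.Im x.
  by rewrite /x ImD [complex.Im (- 2)]ImN (Im_nat R 2) oppr0 addr0 Im_Ninv_gt0.
have xr : x * rho = - z.
  by rewrite /x mulrBl mulNr mulVf // /rho; field.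
have xn : x != 0 by exact: uhp_neq0.
have e1 : (- z^-1 + 1) / 2 = - x^-1.
  apply: (mulIf xn); apply: (mulIf rn); rewrite -mulrA xr mulNr mulVf //.
  by rewrite mulNr mul1r /rho; field.
have e2 : u4 x = - rho ^+ 2 * u2 rho.
  by rewrite -(u4T2 x) (_ : x + 2 = - rho^-1) ?(u4S rho0) // /x subrK.
have e3 : u2 ((z + 1) / 2) = - u2 rho.
  by rewrite (_ : (z + 1) / 2 = rho + 1) ?(u2T rho) // /rho; field.
rewrite e1 (u2S x0) e2 e3.
have e4 : x ^+ 2 * rho ^+ 2 = z ^+ 2 by rewrite -exprMn xr sqrrN.
have -> : (- x ^+ 2 * (- rho ^+ 2 * u2 rho)) ^+ 2 = (z ^+ 2 * u2 rho) ^+ 2.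
  by rewrite mulrA mulrNN e4.
by move: (u2 rho) (u2 z) (u4 z) => a b c; field.
Qed.

Lemma nome2_4 z : nome 2 z = nome 4 z ^+ 2 :> C.
Proof. by rewrite -(@nomeXn R 2 2). Qed.

Lemma nome4_1 : nome 4 1 ^+ 2 = -1 :> C.
Proof. by rewrite -nome2_4; exact: (@nome_half R 1). Qed.

(** Comparing constant terms gives one more power beyond the visible factors, so the orders of [fX],
    [fY], [fZ] in [nome 4] are at least 2, 3, 3. Their sum 8 just meets the condition
    [6 * 4 <= 3 * 8] of [level1_vanish]. *)
Lemma fX_ana : exists f, ana f /\ forall z, 0 < complex.Im z -> fX z = nome 4 z ^+ 2 * f (nome 4 z).
Proof.
have v := vt_ana R.
have [f [hf Ef]] : exists f, ana f /\ forall w, nm w < 1 -> vt (w ^+ 2) ^+ 2 - vt (- w) * vt w = w * f w.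
  apply: (@ana_factor0 (fun w => vt (w ^+ 2) ^+ 2 - vt (- w) * vt w)).
    exact: (anaB (anaX 2 (ana_compX (ltn0Sn 1) v)) (anaM (ana_compN v) v)).
  by rewrite expr0n oppr0 vt0 expr1n mulr1 subrr.
exists (fun w => f (w ^+ 2)); split; first exact: (ana_compX (ltn0Sn 1) hf).
move=> z z0; have w1 := nm_nome_lt1 (ltn0Sn 1) z0.
by rewrite -nome2_4 -(Ef _ w1) /fX /u4 /u3 nomeMn.
Qed.

Lemma fY_ana : exists f, ana f /\ forall z, 0 < complex.Im z -> fY z = nome 4 z ^+ 3 * f (nome 4 z).
Proof.
have v := vt_ana R; have t := t1_ana.
have [f [hf Ef]] : exists f, ana f /\ forall w, nm w < 1 ->
    16 * (t1 w ^+ 2 - t1 (w ^+ 2) * vt (- w ^+ 2)) = w * f w.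
  apply: (@ana_factor0 (fun w => 16 * (t1 w ^+ 2 - t1 (w ^+ 2) * vt (- w ^+ 2)))).
    exact: (anaZ 16 (anaB (anaX 2 t) (anaM (ana_compX (ltn0Sn 1) t) (ana_compX (ltn0Sn 1) (ana_compN v))))).
  by rewrite expr0n oppr0 vt0 t1_0 expr1n mulr1 subrr mulr0.
exists f; split => // z z0; have w1 := nm_nome_lt1 (ltn0Sn 3) z0.
rewrite exprSr -mulrA -(Ef _ w1) /fY /u3 !u2_t1 nome_div nome2_4.
rewrite -[(2 * 2)%N]/4%N; move: (nome 4 z) => p.
by move: (t1 p) (t1 (p ^+ 2)) (vt (- p ^+ 2)) => a b c; field.
Qed.

Lemma fZ_ana : exists f, ana f /\ forall z, 0 < complex.Im z -> fZ z = nome 4 z ^+ 3 * f (nome 4 z).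
Proof.
have v := vt_ana R; have t := t1_ana.
pose io : C := nome 4 1.
have io1 : nm io <= 1 by rewrite nm_nome /= mulr0 mul0r oppr0 expR0.
have [f [hf Ef]] : exists f, ana f /\ forall w, nm w < 1 ->
    16 * (t1 (w ^+ 2) * vt (w ^+ 2) - t1 (io * w ^+ 1) ^+ 2) = w * f w.
  apply: (@ana_factor0 (fun w => 16 * (t1 (w ^+ 2) * vt (w ^+ 2) - t1 (io * w ^+ 1) ^+ 2))).
    exact: (anaZ 16 (anaB (anaM (ana_compX (ltn0Sn 1) t) (ana_compX (ltn0Sn 1) v)) (anaX 2 (ana_comp (ltn0Sn 0) io1 t)))).
  by rewrite !expr0n mulr0 vt0 t1_0 expr1n mulr1 subrr mulr0.
exists f; split => // z z0; have w1 := nm_nome_lt1 (ltn0Sn 3) z0.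
rewrite exprSr -mulrA -(Ef _ w1) /fZ /u4 !u2_t1 nome_div nome2_4 nomeD -/io expr1 (mulrC (nome 4 z) io).
have := nome4_1; rewrite -/io; move: (nome 4 z) io {io1 Ef w1} => p i ii.
move: (t1 (i * p)) (t1 (p ^+ 2)) (vt (p ^+ 2)) => b a c.
have -> : (16 * (i * p * b)) ^+ 2 = 16 ^+ 2 * (i ^+ 2) * p ^+ 2 * b ^+ 2 by ring.
by rewrite ii; field.
Qed.

(** The product of the three functions vanishes, so one factor does, analytic functions having no
    zero divisors; [fZT] and [fYS] then carry the vanishing over to [fX]. *)
Lemma vt_quad w : nm w < 1 -> vt (w ^+ 2) ^+ 2 = vt w * vt (- w).
Proof.
have [f [hf Ef]] := fX_ana; have [g [hg Eg]] := fY_ana; have [h [hh Eh]] := fZ_ana.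
have X0 z : 0 < complex.Im z -> fX z = 0.
  have P0 z' : 0 < complex.Im z' -> fX z' * fY z' * fZ z' = 0.
    apply: (@level1_vanish R (fun z => fX z * fY z * fZ z) (fun w => f w * g w * h w) 4 8 6 isT isT isT).
    - exact: (anaM (anaM hf hg) hh).
    - move=> y y0; rewrite (Ef y y0) (Eg y y0) (Eh y y0).
      by move: (nome 4 y) => p; move: (f p) (g p) (h p) => a b c; ring.
    - move=> y y0; rewrite (fXT y) (fYT y) (fZT y).
      by move: (fX y) (fY y) (fZ y) => a b c; congr nm; ring.
    - move=> y y0; rewrite (fXS y0) (fYS y0) (fZS y0) -nmX -nmM.
      by move: (fX y) (fY y) (fZ y) => a b c; congr nm; ring.
  have fgh y : nm y < 1 -> f y * g y * h y = 0.
    apply: (@ana_zero_real _ (fun w => f w * g w * h w) (anaM (anaM hf hg) hh)) => t t01.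
     have [s [s0 Es]] := @nome_surj R 4 t isT t01.
    have t0 : t%:C != 0 :> C.
      by rewrite -nm_gt0 nm_real normr_gt0 gt_eqF //; case/andP: t01.
    have := P0 (0 +i* s) s0; rewrite Ef // Eg // Eh // Es.
    have -> : t%:C ^+ 2 * f t%:C * (t%:C ^+ 3 * g t%:C) * (t%:C ^+ 3 * h t%:C) = t%:C ^+ 8 * (f t%:C * g t%:C * h t%:C).
      by move: (t%:C) => p; move: (f p) (g p) (h p) => a b c; ring.
    by move=> /eqP; rewrite mulf_eq0 expf_eq0 (negPf t0) andbF /= => /eqP.
  move=> z0; have z4 : z ^+ 4 != 0 by rewrite expf_neq0 // uhp_neq0.
  have YX : (forall y, 0 < complex.Im y -> fY y = 0) -> fX z = 0.
    by move=> H; have := fYS z0; rewrite H ?Im_Ninv_gt0 // => /esym/eqP; rewrite mulf_eq0 (negPf z4) /= => /eqP.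
  case: (ana_mul_zero (anaM hf hg) hh fgh) => [fg|h0].
    case: (ana_mul_zero hf hg fg) => [f0|g0].
      by rewrite Ef // f0 ?mulr0 // nm_nome_lt1.
    by apply: YX => y y0; rewrite Eg // g0 ?mulr0 // nm_nome_lt1.
  apply: YX => y y0; rewrite -(fZT y) Eh ?ImD ?addr0 // h0 ?mulr0 // nm_nome_lt1 //.
  by rewrite ImD addr0.
move=> w1; apply/eqP; rewrite -subr_eq0; apply/eqP.
have v := vt_ana R.
have hA := anaB (anaX 2 (ana_compX (ltn0Sn 1) v)) (anaM v (ana_compN v)).
apply: (@ana_zero_real _ _ hA) w1 => t t01.
 have [s [s0 Es]] := @nome_surj R 2 t isT t01.
have := X0 (0 +i* s) s0; rewrite /fX /u4 /u3 nomeMn Es => <-.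
by move: (vt _) (vt (- _)) (vt t%:C) => a b c; rewrite (mulrC b).
Qed.

End Quadratic.

(** * Infinite products and eta quotients *)

Section Products.
Variable R : realType.
Notation C := (cplx R).
Implicit Types (x y z w : C) (f : C -> C).

Definition pprod (g : nat -> C -> C) n w := \prod_(i < n) (1 + g i w).
(** The telescoped form of the infinite product: the difference of consecutive partial products is
    [g m * pprod g m], so the Weierstrass test for series applies. *)
Definition mprod g w := 1 + sumf (fun m w => g m w * pprod g m w) w.

Lemma pprod_ana g n : (forall m, ana (g m)) -> ana (pprod g n).
Proof. by move=> hg; apply: ana_prod => i; exact: (anaD (ana_cst 1) (hg i)). Qed.

Lemma pprod_bnd g r : mbound g -> 0 < r < 1 ->
  exists K : R, forall n w, nm w <= r -> nm (pprod g n w) <= K.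
Proof.
move=> hg r01; have [K [rho [rho01 H]]] := hg r r01.
have K0 : 0 <= K.
  by have := H 0%N 0; rewrite nm0 expr0 mulr1 => /(_ (ltW (andP r01).1)); apply: le_trans; exact: nm_ge0.
exists (expR (K * (1 - rho)^-1)) => n w wr.
rewrite nm_prod; apply: (@le_trans _ _ (\prod_(i < n) expR (K * rho ^+ i))).
  apply: ler_prod => i _; rewrite nm_ge0 /=.
  apply: (le_trans (nmD _ _)); rewrite nm1; apply: le_trans (expR_ge1Dx _).
  by rewrite lerD2l H.
rewrite -expR_sum ler_expR.
have := @series_le_lim R _ _ n _ (geo_cvg K rho01); rewrite seriesRE; apply => m.
by rewrite mulr_ge0 // exprn_ge0 //; case/andP: rho01.
Qed.

Lemma pprod_mbound g : mbound g -> mbound (fun m w => g m w * pprod g m w).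
Proof.
move=> hg r r01; have [K [rho [rho01 H]]] := hg r r01; have [B HB] := pprod_bnd hg r01.
have B0 : 0 <= B.
  by have := HB 0%N 0; rewrite nm0 => /(_ (ltW (andP r01).1)); apply: le_trans; exact: nm_ge0.
exists (K * B), rho; split => // m w wr; rewrite nmM mulrAC.
by apply: ler_pM => //; rewrite ?nm_ge0 ?H ?HB.
Qed.

Lemma mprod_ana g : (forall m, ana (g m)) -> mbound g -> ana (mprod g).
Proof.
move=> hg bg; apply: (anaD (ana_cst 1)); apply: ana_sumf (pprod_mbound bg) => m.
exact: (anaM (hg m) (pprod_ana m hg)).
Qed.

Lemma pprodE g n w : pprod g n w = 1 + series (fun m => g m w * pprod g m w) n.
Proof.
rewrite seriesCE; elim: n => [|n IH]; first by rewrite /pprod !big_ord0 addr0.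
rewrite {1}/pprod big_ord_recr big_ord_recr /= -/(pprod g n w) addrA -IH.
by rewrite mulrDr mulr1 (mulrC (g n w)).
Qed.

Lemma mprod_cvg g w : mbound g -> nm w < 1 -> (fun n => pprod g n w) @ \oo --> mprod g w.
Proof.
move=> hg w1; have h := sumf_cvg (pprod_mbound hg) w1.
apply: (cvgC_eq (u := fun n => 1 + series (fun m => g m w * pprod g m w) n)).
  by exists 0%N => n _; rewrite pprodE.
exact: (cvgCD (@cvgC_cst R 1) h).
Qed.

Lemma nm_neq1_disc w m : nm w < 1 -> 1 - w ^+ m.+1 != 0.
Proof.
by move=> w1; have := @neq1_disc R (- w ^+ m.+1); rewrite nmN nm_expr_lt1 //; apply.
Qed.

(* Euler's product prod_(m >= 1) (1 - w^m) and its inverse. *)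
Definition gP m w : C := - w ^+ m.+1.
Definition gI m w : C := w ^+ m.+1 * (1 - w ^+ m.+1)^-1.
Definition Pr := mprod gP.
Definition PrI := mprod gI.

Lemma gP_ana m : ana (gP m).
Proof. by apply: ana_ext (ana_mono (-1) m.+1) => w _; rewrite mulN1r. Qed.
Lemma gI_ana m : ana (gI m).
Proof. exact: (anaM (ana_compX (ltn0Sn m) (ana_id R)) (ana_compX (ltn0Sn m) (ana_inv1B R))). Qed.
Lemma gP_mbound : mbound gP.
Proof.
move=> r /andP[r0 r1]; exists r, r; rewrite r1 (ltW r0); split => // m w wr.
by rewrite nmN nmX -exprS lerXn2r ?nnegrE ?nm_ge0 // ltW.
Qed.
Lemma gI_mbound : mbound gI.
Proof.
move=> r r01; have [r0 r1] := andP r01.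
have [B HB] := ana_bnd (ana_inv1B R) (r := r) (introT andP (conj (ltW r0) r1)).
exists (r * B), r; rewrite r1 (ltW r0); split => // m w wr.
rewrite nmM mulrAC -exprS nmX; apply: ler_pM; rewrite ?exprn_ge0 ?nm_ge0 //.
  by rewrite lerXn2r ?nnegrE ?nm_ge0 // ltW.
by apply: HB; exact: (nm_expr_le wr r1 (ltn0Sn m)).
Qed.
Lemma Pr_ana : ana Pr. Proof. exact: mprod_ana gP_ana gP_mbound. Qed.
Lemma PrI_ana : ana PrI. Proof. exact: mprod_ana gI_ana gI_mbound. Qed.
Lemma Pr_cvg w : nm w < 1 -> (fun n => \prod_(i < n) (1 - w ^+ i.+1)) @ \oo --> Pr w.
Proof. by move=> w1; exact: (mprod_cvg gP_mbound w1). Qed.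

Lemma PrK w : nm w < 1 -> Pr w * PrI w = 1.
Proof.
move=> w1; have h := cvgCM (mprod_cvg gP_mbound w1) (mprod_cvg gI_mbound w1).
apply: (cvgC_unique h); apply: (cvgC_eq (u := fun=> 1)); last exact: (@cvgC_cst R 1).
exists 0%N => n _; rewrite /pprod -big_split /= big1 // => i _.
rewrite /gP /gI; have := nm_neq1_disc i w1; move: (w ^+ _) => u u1; by field; rewrite u1.
Qed.

Lemma Pr_neq0 w : nm w < 1 -> Pr w != 0.
Proof. by move=> w1; apply/eqP => e; have := PrK w1; rewrite e mul0r => /esym/eqP; rewrite oner_eq0. Qed.

Lemma PrIE w : nm w < 1 -> PrI w = (Pr w)^-1.
Proof. by move=> w1; apply: (mulfI (Pr_neq0 w1)); rewrite PrK // mulfV // Pr_neq0. Qed.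

Lemma Pr0 : Pr 0 = 1.
Proof.
apply: (cvgC_unique (Pr_cvg (nm01 R))); apply: (cvgC_eq (u := fun=> 1)); last exact: (@cvgC_cst R 1).
by exists 0%N => n _; rewrite big1 // => i _; rewrite expr0n subr0.
Qed.

Lemma eta_Pr z : 0 < complex.Im z -> eta z = nome 24 z * Pr (nome 1 z).
Proof.
move=> z0; rewrite /eta; congr (_ * _).
apply: (@cvg_lim _ _ _ _ eventually_filter) => //.
apply: (cvgC_eq (u := fun n => \prod_(i < n) (1 - nome 1 z ^+ i.+1))).
  by exists 0%N => n _; rewrite big_add1 big_mkord.
exact: (Pr_cvg (nm_nome_lt1 (ltn0Sn 0) z0)).
Qed.

Definition eprod n w := \prod_(i < n) (1 - w ^+ i.+1).
Lemma eprodS n w : eprod n.+1 w = eprod n w * (1 - w ^+ n.+1).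
Proof. exact: big_ord_recr. Qed.
Lemma eprod0 w : eprod 0 w = 1. Proof. exact: big_ord0. Qed.

(** Even exponents up to 2n give factors in w^2, once from w and once from -w. The factors at an odd
    exponent multiply to 1 - w^(2m), and the product over w^4 supplies the even m missing from
    [eprod n.*2 (w ^+ 2)]. *)
Lemma eprod_parity n w :
  eprod n (w ^+ 2) * eprod n (w ^+ 2) * eprod n.*2 (w ^+ 2) =
  eprod n.*2 w * eprod n.*2 (- w) * eprod n (w ^+ 4).
Proof.
elim: n => [|n]; first by rewrite !eprod0 !mulr1.
rewrite doubleS !eprodS.
have e1 : 1 - (w ^+ 2) ^+ n.*2.+1 = (1 - w ^+ n.*2.+1) * (1 - (- w) ^+ n.*2.+1).
  rewrite exprNn -signr_odd /= odd_double /= expr1 mulN1r opprK exprAC expr2.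
  by move: (w ^+ _) => a; ring.
have e2 : (- w) ^+ n.*2.+2 = (w ^+ 2) ^+ n.+1.
  rewrite exprNn -signr_odd /= odd_double /= mul1r -!exprM; congr (_ ^+ _); lia.
have e3 : (w ^+ 2) ^+ n.*2.+2 = (w ^+ 4) ^+ n.+1 by rewrite -!exprM; congr (_ ^+ _); lia.
have e4 : w ^+ n.*2.+2 = (w ^+ 2) ^+ n.+1 by rewrite -!exprM; congr (_ ^+ _); lia.
rewrite e3 e2 e4 e1.
move: (eprod n (w ^+ 2)) (eprod n.*2 (w ^+ 2)) (eprod n.*2 w) (eprod n.*2 (- w)) (eprod n (w ^+ 4)).
move: ((w ^+ 2) ^+ n.+1) (w ^+ n.*2.+1) ((- w) ^+ n.*2.+1) ((w ^+ 4) ^+ n.+1).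
move=> u a b v A B D E F H.
transitivity (A * A * B * ((1 - u) * (1 - u) * (1 - a) * (1 - b) * (1 - v))); first by ring.
by rewrite H; ring.
Qed.

Lemma Pr_PrN w : nm w < 1 -> Pr w * Pr (- w) * Pr (w ^+ 4) = Pr (w ^+ 2) ^+ 3.
Proof.
move=> w1; have wN : nm (- w) < 1 by rewrite nmN.
have w2 := nm_expr_lt1 w1 (ltn0Sn 1); have w4 := nm_expr_lt1 w1 (ltn0Sn 3).
have dbl x (x1 : nm x < 1) : (fun n => eprod n.*2 x) @ \oo --> Pr x.
  exact: (cvgC_sub leq_double (Pr_cvg x1)).
have c1 := cvgCM (cvgCM (dbl _ w1) (dbl _ wN)) (Pr_cvg w4).
have c2 := cvgCM (cvgCM (Pr_cvg w2) (Pr_cvg w2)) (dbl _ w2).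
have -> : Pr (w ^+ 2) ^+ 3 = Pr (w ^+ 2) * Pr (w ^+ 2) * Pr (w ^+ 2).
  by move: (Pr (w ^+ 2)) => a; rewrite exprSr expr2.
apply: (cvgC_unique c1); apply: (cvgC_eq _ c2); exists 0%N => n _.
exact: eprod_parity.
Qed.
End Products.

Opaque sA sO t1 Pr PrI.

(** * Gauss' identity and the comparison of products with Lambert series *)

Section Gauss.
Variable R : realType.
Notation C := (cplx R).
Implicit Types (x y z w : C) (f : C -> C).

Definition rprod n w : C := \prod_(k < n) ((1 - w ^+ k.+1) / (1 + w ^+ k.+1)).
Definition thsum n w : C := 1 + 2 * \sum_(j < n) (-1) ^+ j.+1 * w ^+ (j.+1 ^ 2).
Definition shanks n s w : C :=
  (-1) ^+ s * (2 / (1 + w ^+ s)) * (rprod n w / rprod s w) * w ^+ (s * n.+1).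

Lemma neq1_discX w k : nm w < 1 -> 1 + w ^+ k != 0.
Proof.
case: k => [|k] w1; last by rewrite neq1_disc ?nm_expr_lt1.
by rewrite expr0 -(natrD _ 1 1) pnatr_eq0.
Qed.

Lemma rprodS n w : rprod n.+1 w = rprod n w * ((1 - w ^+ n.+1) / (1 + w ^+ n.+1)).
Proof. exact: big_ord_recr. Qed.

Lemma rprod_neq0 n w : nm w < 1 -> rprod n w != 0.
Proof.
move=> w1; apply/prodf_neq0 => i _.
by rewrite mulf_neq0 ?invr_eq0 ?neq1_discX ?nm_neq1_disc.
Qed.

(* Shanks' finite form of Gauss' identity: the difference in [n] of the right-hand
   side telescopes in [s]. *)
Lemma thsum_shanks n w : nm w < 1 -> thsum n w = \sum_(s < n.+1) shanks n s w.
Proof.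
move=> w1; elim: n => [|n IH].
  rewrite /thsum big_ord0 big_ord1 mulr0 addr0 /shanks !expr0 /rprod big_ord0 divr1.
  by rewrite !mulr1 mul1r -(natrD _ 1 1) divff ?pnatr_eq0.
have n1 := neq1_discX n.+1 w1.
(* The telescoping certificate: it vanishes at s = 0, and at s = n+1 it combines with the last
   summand of [shanks n.+1] to give the new term of [thsum]. *)
pose A s : C := 2 * (-1) ^+ s * rprod n w * ((1 - w ^+ s) / (1 + w ^+ s)) / rprod s w
  * w ^+ (s * n.+1) / (1 + w ^+ n.+1).
have step s : shanks n.+1 s w - shanks n s w = A s.+1 - A s.
  rewrite /shanks /A !rprodS.
  have s1 := neq1_discX s w1; have s2 := neq1_discX s.+1 w1; have s3 := nm_neq1_disc s w1.
  have r0 := rprod_neq0 s w1.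
  have -> : w ^+ (s * n.+2) = w ^+ (s * n.+1) * w ^+ s by rewrite -exprD; congr (_ ^+ _); lia.
  have -> : w ^+ (s.+1 * n.+1) = w ^+ (s * n.+1) * w ^+ n.+1 by rewrite -exprD; congr (_ ^+ _); lia.
  rewrite [(-1) ^+ s.+1]exprS.
  move: (rprod n w) (rprod s w) (w ^+ s.+1) (w ^+ n.+1) (w ^+ (s * n.+1)) (w ^+ s) ((-1) ^+ s) n1 s1 s2 s3 r0 => a b c d e f g h1 h2 h3 h4 h5.
  by field; rewrite h1 h2 h3 h4 h5.
rewrite big_ord_recr /=.
have -> : \sum_(s < n.+1) shanks n.+1 s w = \sum_(s < n.+1) shanks n s w + (A n.+1 - A 0%N).
  rewrite -(telescope_sumr _ (leq0n n.+1)) big_mkord -big_split /=.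
  by apply: eq_bigr => i _; rewrite -step addrC subrK.
rewrite -IH /thsum big_ord_recr /= mulrDr -!addrA; congr (_ + (_ + _)).
have -> : A 0%N = 0 by rewrite /A [w ^+ 0]expr0 subrr mul0r mulr0 !mul0r.
rewrite oppr0 add0r /A /shanks rprodS.
have r0 := rprod_neq0 n w1; have n3 := nm_neq1_disc n w1.
have -> : w ^+ (n.+1 * n.+2) = w ^+ (n.+1 * n.+1) * w ^+ n.+1 by rewrite -exprD; congr (_ ^+ _); lia.
rewrite mulnn; move: (rprod n w) (w ^+ n.+1) (w ^+ (n.+1 ^ 2)) ((-1) ^+ n.+1) n1 r0 n3 => a b c d h1 h2 h3.
by field; rewrite h1 h2 h3.
Qed.

(* aq = theta_4; vq and tq below are E2_8_0 and E2_8_1 / q as functions of q. *)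
Definition aq w : C := Pr w ^+ 2 * PrI (w ^+ 2).

Lemma aq_ana : ana aq.
Proof. exact: (anaM (anaX 2 (Pr_ana R)) (ana_compX (ltn0Sn 1) (PrI_ana R))). Qed.

Lemma rprodE n w : nm w < 1 ->
  rprod n w = pprod (@gP R) n w * pprod (@gP R) n w * pprod (@gI R) n (w ^+ 2).
Proof.
move=> w1; have w2 := nm_expr_lt1 w1 (ltn0Sn 1).
rewrite /rprod /pprod -!big_split /=; apply: eq_bigr => i _.
rewrite /gP /gI exprAC; have := neq1_discX i.+1 w1; have := nm_neq1_disc i w1.
move: (w ^+ i.+1) => u u1 u2; have u3 : 1 - u ^+ 2 != 0.
  by rewrite -[1](expr1n _ 2) subr_sqr mulf_neq0.
by field; rewrite u3 u2.
Qed.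

Lemma rprodVE n w : nm w < 1 ->
  (rprod n w)^-1 = pprod (@gI R) n w * pprod (@gI R) n w * pprod (@gP R) n (w ^+ 2).
Proof.
move=> w1; have w2 := nm_expr_lt1 w1 (ltn0Sn 1).
rewrite /rprod -prodfV /pprod -!big_split /=; apply: eq_bigr => i _.
rewrite /gP /gI exprAC; have := neq1_discX i.+1 w1; have := nm_neq1_disc i w1.
move: (w ^+ i.+1) => u u1 u2.
by field; rewrite u1 u2.
Qed.

Lemma rprod_cvg w : nm w < 1 -> (fun n => rprod n w) @ \oo --> aq w.
Proof.
move=> w1; have w2 := nm_expr_lt1 w1 (ltn0Sn 1).
have p1 := mprod_cvg (@gP_mbound R) w1; have p2 := mprod_cvg (@gI_mbound R) w2.
apply: (cvgC_eq _ (cvgCM (cvgCM p1 p1) p2)).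
by exists 0%N => n _; rewrite rprodE.
Qed.

(** The inverse of [rprod] is again a product of the form treated by [pprod_bnd], so upper bounds
    suffice. *)
Lemma rprod_bnd w : nm w < 1 -> exists K : R, 0 <= K /\
  forall n s, nm (rprod n w / rprod s w) <= K.
Proof.
move=> w1; have [r [r01 _ wr]] := mid_lt1 w1; have [_ r1] := andP r01.
have w2r := nm_expr_le wr r1 (ltn0Sn 1).
have [A HA] := pprod_bnd (@gP_mbound R) r01; have [B HB] := pprod_bnd (@gI_mbound R) r01.
have H n s : nm (rprod n w / rprod s w) <= A * A * B * (B * B * A).
  rewrite rprodE // rprodVE // !nmM.
  by rewrite !ler_pM ?mulr_ge0 ?nm_ge0 ?HA ?HB.
exists (A * A * B * (B * B * A)); split => //.
by apply: le_trans (H 0%N 0%N); exact: nm_ge0.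
Qed.

(** In Shanks' sum the term s = 0 is [rprod n w]; the terms with s > 0 carry w^(s (n+1)) and
    together are of the order of |w|^n. *)
Lemma thsum_cvg w : nm w < 1 -> (fun n => thsum n w) @ \oo --> aq w.
Proof.
move=> w1; have [K [K0 HK]] := rprod_bnd w1; pose r := nm w.
have r0 : 0 <= r := nm_ge0 w; have r01 : 0 <= r < 1 by rewrite r0.
pose B := 2 * (1 - r)^-1 * K.
have r1' : 0 < 1 - r by rewrite subr_gt0.
have tb n (s : nat) : nm (shanks n s.+1 w) <= B * (r ^+ n * r ^+ s * 1).
  rewrite /shanks !nmM !nmX nmN nm1 expr1n mul1r nmV nm_nat.
  have -> : nm w ^+ (s.+1 * n.+1) = r ^+ n * r ^+ s * r ^+ (s * n).+1.
    by rewrite -!exprD; congr (_ ^+ _); lia.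
  have e1 : nm (rprod n w) * nm (rprod s.+1 w)^-1 <= K by rewrite -nmM HK.
  have e2 : (nm (1 + w ^+ s.+1))^-1 <= (1 - r)^-1.
    rewrite lef_pV2 ?posrE ?nm_gt0 ?neq1_discX //.
    have := nm_subr 1 (w ^+ s.+1); rewrite nm1; apply: le_trans.
    by rewrite lerD2l lerN2 (nm_expr_le (lexx _)).
  have e3 : r ^+ (s * n).+1 <= 1 by rewrite exprn_ile1 // ltW.
  have p0 : 0 <= r ^+ n * r ^+ s by rewrite mulr_ge0 ?exprn_ge0.
  have q0 : 0 <= r ^+ (s * n).+1 by rewrite exprn_ge0.
  have m0 : 0 <= (nm (1 + w ^+ s.+1))^-1 by rewrite invr_ge0 nm_ge0.
  have k0 : 0 <= nm (rprod n w) * nm (rprod s.+1 w)^-1 by rewrite mulr_ge0 ?nm_ge0.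
  rewrite /B; move: (nm (rprod n w) * _) (nm _)^-1 (1 - r)^-1 (r ^+ n * r ^+ s) (r ^+ (s * n).+1) e1 e2 e3 p0 q0 m0 k0.
  move=> a b c d e e1 e2 e3 p0 q0 m0 k0.
  by do ?apply: ler_pM; rewrite ?mulr_ge0.
have d0 : (fun n => thsum n w - rprod n w) @ \oo --> (0 : C).
  apply: (cvgC_squeeze (a := geometric (B * (1 - r)^-1) r)); last first.
    by apply: cvg_geometric; rewrite ger0_norm.
  exists 0%N => n _; rewrite subr0 thsum_shanks // big_ord_recl.
  have -> : shanks n (@ord0 n) w = rprod n w.
    by rewrite /shanks /= !expr0 /rprod big_ord0 divr1 !mulr1 mul1r -(natrD _ 1 1) divff ?mul1r ?pnatr_eq0.
  rewrite addrC addKr; apply: (le_trans (nm_sum _ _ _)).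
  apply: (@le_trans _ _ (\sum_(i < n) B * r ^+ n * r ^+ i)).
    by apply: ler_sum => i _; rewrite -mulrA -[r ^+ n * _]mulr1; exact: tb.
  have B0 : 0 <= B by rewrite !mulr_ge0 // invr_ge0 ltW.
  have := @series_le_lim R _ _ n _ (geo_cvg (B * r ^+ n) r01); rewrite seriesRE /geometric /= [B * _ * r ^+ n]mulrAC.
  by apply => m; apply: mulr_ge0; [apply: mulr_ge0 => //|]; rewrite exprn_ge0.
apply: (cvgC_eq (u := fun n => rprod n w + (thsum n w - rprod n w))).
  by exists 0%N => n _; rewrite addrC subrK.
by rewrite -[aq w]addr0; exact: (cvgCD (rprod_cvg w1) d0).
Qed.

(** Odd squares cancel. For j = 2k the exponent is 4 k^2, and the sign (-1)^k (-1)^(k^2) = 1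
    accounts for the argument - w^4. *)
Lemma thsum_even n w : thsum n.*2 w + thsum n.*2 (- w) = 2 * thsum n (- w ^+ 4).
Proof.
rewrite /thsum; elim: n => [|n IH]; first by rewrite !big_ord0 !mulr0 !addr0 mulr1.
rewrite doubleS !big_ord_recr /= [(-1) ^+ n.*2.+2]exprS.
have so : (-1) ^+ n.*2.+1 = -1 :> C by rewrite -signr_odd /= odd_double expr1.
have -> : (- w) ^+ (n.*2.+1 ^ 2) = - w ^+ (n.*2.+1 ^ 2).
  by rewrite exprNn -signr_odd oddX /= odd_double expr1 mulN1r.
have -> : (- w) ^+ (n.*2.+2 ^ 2) = w ^+ (n.*2.+2 ^ 2).
  by rewrite exprNn -signr_odd oddX /= odd_double mul1r.
have e1 : (-1) ^+ n.+1 * (- w ^+ 4) ^+ (n.+1 ^ 2) = w ^+ (n.*2.+2 ^ 2).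
  rewrite [(- w ^+ 4) ^+ _]exprNn mulrA -exprD -signr_odd oddD oddX /= addbb mul1r -exprM.
  by congr (_ ^+ _); rewrite -mul2n; lia.
rewrite e1 so.
move: (\sum_(i < n.*2) (-1) ^+ i.+1 * w ^+ (i.+1 ^ 2)) (\sum_(i < n.*2) (-1) ^+ i.+1 * (- w) ^+ (i.+1 ^ 2)) IH.
move: (\sum_(i < n) _) (w ^+ (n.*2.+1 ^ 2)) (w ^+ (n.*2.+2 ^ 2)) => D a b A B IH.
transitivity ((1 + 2 * A + (1 + 2 * B)) + 4 * b); first by ring.
by rewrite IH; ring.
Qed.

Lemma aq_even w : nm w < 1 -> aq w + aq (- w) = 2 * aq (- w ^+ 4).
Proof.
move=> w1; have wN : nm (- w) < 1 by rewrite nmN.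
have w4 : nm (- w ^+ 4) < 1 by rewrite nmN nm_expr_lt1.
have dbl x (x1 : nm x < 1) : (fun n => thsum n.*2 x) @ \oo --> aq x.
  exact: (cvgC_sub leq_double (thsum_cvg x1)).
apply: (cvgC_unique (cvgCD (dbl _ w1) (dbl _ wN))).
have h := @cvgCZ R _ _ 2 (thsum_cvg w4).
apply: (cvgC_eq (u := fun n => 2 * thsum n (- w ^+ 4)) _ h).
by exists 0%N => n _; rewrite thsum_even.
Qed.

Lemma aq_mul w : nm w < 1 -> aq w * aq (- w) = aq (w ^+ 2) ^+ 2.
Proof.
move=> w1; have w2 := nm_expr_lt1 w1 (ltn0Sn 1); have w4 := nm_expr_lt1 w1 (ltn0Sn 3).
have e4 : (w ^+ 2) ^+ 2 = w ^+ 4 by rewrite -exprM.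
have eN : (- w) ^+ 2 = w ^+ 2 by rewrite sqrrN.
have aE : aq w = Pr w ^+ 2 / Pr (w ^+ 2) by rewrite -(PrIE w2).
have bE : aq (- w) = Pr (- w) ^+ 2 / Pr (w ^+ 2) by rewrite -(PrIE w2) /aq eN.
have cE : aq (w ^+ 2) = Pr (w ^+ 2) ^+ 2 / Pr (w ^+ 4) by rewrite -(PrIE w4) /aq e4.
rewrite aE bE cE; move: (Pr_PrN w1) (Pr_neq0 w2) (Pr_neq0 w4).
move: (Pr w) (Pr (- w)) (Pr (w ^+ 2)) (Pr (w ^+ 4)) => a b c d e c0 d0.
transitivity ((a * b * d) ^+ 2 / (c ^+ 2 * d ^+ 2)); first by field; rewrite d0.
by rewrite e; field; rewrite d0.
Qed.

Lemma i_expr_odd_sqr n : 'i%C ^+ (n.*2.+1 ^ 2) = 'i%C :> C.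
Proof.
have -> : (n.*2.+1 ^ 2 = 4 * (n * n.+1) + 1)%N by rewrite -mul2n; lia.
have i4 : 'i%C ^+ 4 = 1 :> C by rewrite (exprM _ 2 2) sqr_i sqrrN expr1n.
by rewrite exprD exprM i4 expr1n mul1r expr1.
Qed.

(* The exponents of the difference are the odd squares, which are 1 modulo 4. *)
Lemma thsum_odd n w :
  'i%C * (thsum n (- w) - thsum n w) = thsum n (- ('i%C * w)) - thsum n ('i%C * w).
Proof.
have D x : thsum n (- x) - thsum n x =
    2 * \sum_(j < n) (-1) ^+ j.+1 * ((- x) ^+ (j.+1 ^ 2) - x ^+ (j.+1 ^ 2)).
  have -> : \sum_(j < n) (-1) ^+ j.+1 * ((- x) ^+ (j.+1 ^ 2) - x ^+ (j.+1 ^ 2)) =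
     \sum_(j < n) (-1) ^+ j.+1 * (- x) ^+ (j.+1 ^ 2) - \sum_(j < n) (-1) ^+ j.+1 * x ^+ (j.+1 ^ 2).
    by rewrite -sumrB; apply: eq_bigr => j _; rewrite mulrBr.
  by rewrite /thsum; move: (\sum_(_ < _) _) (\sum_(_ < _) _) => a b; ring.
have key j : 'i%C * ((- w) ^+ (j.+1 ^ 2) - w ^+ (j.+1 ^ 2)) =
    (- ('i%C * w)) ^+ (j.+1 ^ 2) - ('i%C * w) ^+ (j.+1 ^ 2).
  rewrite [(- w) ^+ _]exprNn [(- ('i%C * w)) ^+ _]exprNn -signr_odd oddX orFb.
  have [oj|e] := boolP (odd j.+1); last by rewrite !mul1r !subrr mulr0.
  have E : j.+1 = (j.+1)./2.*2.+1 by rewrite -{1}(odd_double_half j.+1) oj.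
  rewrite E [('i%C * w) ^+ _]exprMn i_expr_odd_sqr; move: (w ^+ _) => a; ring.
rewrite !D mulrCA mulr_sumr; congr (2 * _); apply: eq_bigr => j _.
by rewrite mulrCA key.
Qed.

Lemma aq_odd w : nm w < 1 -> aq (- ('i%C * w)) - aq ('i%C * w) = 'i%C * (aq (- w) - aq w).
Proof.
move=> w1; have wN : nm (- w) < 1 by rewrite nmN.
have ni : nm ('i%C : C) = 1 by rewrite /nm /= expr0n expr1n add0r sqrtr1.
have iw : nm ('i%C * w) < 1 by rewrite nmM ni mul1r.
have iwN : nm (- ('i%C * w)) < 1 by rewrite nmN.
apply: (cvgC_unique (cvgCB (thsum_cvg iwN) (thsum_cvg iw))).
have h := @cvgCZ R _ _ 'i%C (cvgCB (thsum_cvg wN) (thsum_cvg w1)).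
apply: (cvgC_eq (u := fun n => 'i%C * (thsum n (- w) - thsum n w)) _ h); exists 0%N => n _.
exact: thsum_odd.
Qed.

(* aq (- x) - aq x is a square root of 4 (aq (- x^4)^2 - aq (x^2)^2), by [aq_even]
   and [aq_mul], and [aq_odd] determines its behaviour under x |-> i x. *)
Lemma aq_sqr p : nm p < 1 -> aq (- p) ^+ 2 + aq p ^+ 2 = 2 * aq (- p ^+ 2) ^+ 2.
Proof.
move=> p1; have [w w2] : exists w : C, w ^+ 2 = p by exists (sqrtC (p : R[i])); exact: sqrtCK.
have w1 : nm w < 1.
  rewrite ltNge; apply/negP => h; move: p1; rewrite -w2 nmX ltNge => /negP; apply.
  by rewrite exprn_ege1.
have D x : nm x < 1 -> (aq (- x) - aq x) ^+ 2 = 4 * (aq (- x ^+ 4) ^+ 2 - aq (x ^+ 2) ^+ 2).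
  move=> x1; move: (aq_mul x1) (aq_even x1).
  move: (aq x) (aq (- x)) (aq (x ^+ 2)) (aq (- x ^+ 4)) => a b d c e1 e2.
  transitivity ((a + b) ^+ 2 - 4 * (a * b)); first by ring.
  by rewrite e1 e2; ring.
have ni : nm ('i%C : C) = 1 by rewrite /nm /= expr0n expr1n add0r sqrtr1.
have iw : nm ('i%C * w) < 1 by rewrite nmM ni mul1r.
have := D _ iw; rewrite aq_odd //.
have -> : ('i%C * (aq (- w) - aq w)) ^+ 2 = - (aq (- w) - aq w) ^+ 2 by rewrite exprMn sqr_i mulN1r.
rewrite (D _ w1).
have -> : ('i%C * w) ^+ 4 = w ^+ 4 by rewrite exprMn (exprM _ 2 2) sqr_i sqrrN expr1n mul1r.
have -> : ('i%C * w) ^+ 2 = - w ^+ 2 by rewrite exprMn sqr_i mulN1r.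
have -> : w ^+ 4 = p ^+ 2 by rewrite -w2 -exprM.
rewrite w2; move: (aq p) (aq (- p)) (aq _) => a b c e.
have e4 : (4 : C) != 0 by rewrite pnatr_eq0.
apply: (mulfI e4).
transitivity (4 * (a ^+ 2 - c ^+ 2) - 4 * (c ^+ 2 - b ^+ 2) + 8 * c ^+ 2); first by ring.
by rewrite -e; ring.
Qed.

Definition vq w : C := aq w ^+ 4.

Lemma vq_ana : ana vq. Proof. exact: (anaX 4 aq_ana). Qed.

Lemma vq_quad w : nm w < 1 -> vq (w ^+ 2) ^+ 2 = vq w * vq (- w).
Proof.
move=> w1; rewrite /vq; have := aq_mul w1.
by move: (aq w) (aq (- w)) (aq _) => a b c e; rewrite -exprMn e; ring.
Qed.

(** With a, b the values of [aq] at w and -w, this is (a^2 + b^2)^2 - 2 (a b)^2 = a^4 + b^4, read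
    through [aq_sqr] and [aq_mul]. *)
Lemma vq_linear w : nm w < 1 -> vq w + vq (- w) = 4 * vq (- w ^+ 2) - 2 * vq (w ^+ 2).
Proof.
move=> w1; rewrite /vq; have := aq_mul w1; have := aq_sqr w1.
move: (aq w) (aq (- w)) (aq (w ^+ 2)) (aq (- w ^+ 2)) => a b c d e1 e2.
have -> : c ^+ 4 = (a * b) ^+ 2 by rewrite e2; ring.
have -> : 4 * d ^+ 4 = (b ^+ 2 + a ^+ 2) ^+ 2 by rewrite e1; ring.
ring.
Qed.

Lemma Pr_fact : exists k, [/\ ana k, k 0 = -1 & forall w, nm w < 1 -> Pr w = 1 + w * k w].
Proof.
pose h m w : C := - w ^+ m * pprod (@gP R) m w.
have hm : mbound h.
  move=> r r01; have [B HB] := pprod_bnd (@gP_mbound R) r01; have [r0 r1] := andP r01.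
  exists B, r; rewrite r1 (ltW r0); split => // m w wr.
  rewrite nmM nmN nmX mulrC ler_pM ?exprn_ge0 ?nm_ge0 ?HB //.
  by rewrite lerXn2r ?nnegrE ?nm_ge0 // ltW.
have hh m : ana (h m).
  apply: (anaM _ (pprod_ana m (@gP_ana R))).
  by apply: ana_ext (ana_mono (-1) m) => w _; rewrite mulN1r.
exists (sumf h); split; first exact: ana_sumf.
  apply: (cvgC_unique (sumf_cvg hm (nm01 R))).
  apply: (cvgC_eq (u := fun=> -1)); last exact: (@cvgC_cst R (-1)).
  exists 1%N => [[|n]] // _; rewrite seriesCE big_ord_recl big1 => [|i _].
    by rewrite /h /pprod big_ord0 expr0 mulr1 addr0.
  by rewrite /h expr0n /= oppr0 mul0r.
move=> w w1; apply: (cvgC_unique (Pr_cvg w1)).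
have c1 := cvgCD (@cvgC_cst R 1) (@cvgCZ R _ _ w (sumf_cvg hm w1)).
apply: (cvgC_eq (u := fun n => 1 + w * series (fun m => h m w) n) _ c1).
exists 0%N => n _; have := pprodE (@gP R) n w; rewrite {1}/pprod => ->.
rewrite !seriesCE mulr_sumr; congr (1 + _); apply: eq_bigr => i _.
by rewrite /h /gP mulrA mulrN -exprS.
Qed.

(** The coefficient -8 is 4 * 2 * (-1): [vq] is the fourth power of [aq], which has the square of
    Euler's product as numerator and a denominator in w^2. *)
Lemma vq_fact : exists k, [/\ ana k, k 0 = -8 & forall w, nm w < 1 -> vq w = 1 + w * k w].
Proof.
have [k [hk k0 Ek]] := Pr_fact.
have [l [hl El]] : exists l, ana l /\ forall w, nm w < 1 -> PrI w - 1 = w * l w.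
  apply: (@ana_factor0 R (fun w => PrI w - 1) (anaB (PrI_ana R) (ana_cst 1))).
  by rewrite PrIE ?nm01 // Pr0 invr1 subrr.
pose m w := 2 * k w + w ^+ 1 * (k w ^+ 2 + (l (w ^+ 2) * (1 + w ^+ 1 * k w) ^+ 2)).
have hm : ana m.
  have h1 := anaX 2 (anaD (ana_cst 1) (ana_monoM 1 hk)).
  exact: (anaD (anaZ 2 hk) (ana_monoM 1 (anaD (anaX 2 hk) (anaM (ana_compX (ltn0Sn 1) hl) h1)))).
have Em w : nm w < 1 -> aq w = 1 + w * m w.
  move=> w1; rewrite /aq Ek //; have := El _ (nm_expr_lt1 w1 (ltn0Sn 1)).
  move/eqP; rewrite subr_eq => /eqP ->; rewrite /m expr1; move: (k w) (l _) => a b; ring.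
exists (fun w => 4 * m w + w ^+ 1 * (6 * m w ^+ 2 + w ^+ 1 * (4 * m w ^+ 3 + w ^+ 1 * m w ^+ 4))); split.
- apply: (anaD (anaZ 4 hm) (ana_monoM 1 (anaD (anaZ 6 (anaX 2 hm)) (ana_monoM 1 _)))).
  exact: (anaD (anaZ 4 (anaX 3 hm)) (ana_monoM 1 (anaX 4 hm))).
- by rewrite /m k0 !expr1 !mul0r !addr0; ring.
- by move=> w w1; rewrite /vq Em // !expr1; move: (m w) => a; ring.
Qed.

Lemma vt_fact : exists k, [/\ ana k, k 0 = -8 & forall w, nm w < 1 -> vt w = 1 + w * k w].
Proof.
exists (fun w => 8 * (w ^+ 1 * sA (w ^+ 2)) + (-8) * sO w); split.
- exact: (anaD (anaZ 8 (ana_monoM 1 (ana_compX (ltn0Sn 1) (sA_ana R)))) (anaZ (-8) (sO_ana R))).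
- by rewrite expr1 mul0r mulr0 add0r sO0 mulr1.
- by move=> w _; rewrite /vt expr1; move: (sA _) (sO _) => a b; ring.
Qed.

Opaque vt.

Lemma vq_vt w : nm w < 1 -> vq w = vt w.
Proof.
have [k [hk k0 Ek]] := vq_fact; have [l [hl l0 El]] := vt_fact.
apply: (theta_uniq vq_ana (vt_ana R) hk hl Ek El k0 l0 vq_linear (@vt_linear R) vq_quad).
exact: vt_quad.
Qed.

(** With a, b, c, d the values of [vt] at w, -w, w^2, -w^2, the square of 16 w t1(w) is (a + b)^2 -
    4 a b = (4 d - 2 c)^2 - 4 c^2 = 16 d (d - c), and d - c is 16 w^2 t1(w^2). *)
Lemma t1_sqr w : nm w < 1 -> t1 w ^+ 2 = vt (- w ^+ 2) * t1 (w ^+ 2).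
Proof.
move=> w1; apply/eqP; rewrite -subr_eq0; apply/eqP.
have hA := anaB (anaX 2 (t1_ana R))
  (anaM (ana_compX (ltn0Sn 1) (ana_compN (vt_ana R))) (ana_compX (ltn0Sn 1) (t1_ana R))).
apply: (@ana_cancel R _ 2 hA) w1 => {}w w1.
move: (vt_t1 w) (vt_t1 (w ^+ 2)) (vt_linear w1) (vt_quad w1).
move: (vt w) (vt (- w)) (vt (w ^+ 2)) (vt (- w ^+ 2)) (t1 w) (t1 (w ^+ 2)) => a b d c t s e1 e2 e3 e4.
have n : (256 : C) != 0 by rewrite pnatr_eq0.
apply: (mulfI n); rewrite mulr0.
transitivity ((16 * (w * t)) ^+ 2 - 16 * c * (16 * (w ^+ 2 * s))); first by ring.
rewrite -e1 -e2.
transitivity ((a + b) ^+ 2 - 4 * (a * b) - 16 * c * (c - d)); first by ring.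
by rewrite e3 -e4; ring.
Qed.

Definition tq w : C := Pr (w ^+ 4) ^+ 8 * PrI (w ^+ 2) ^+ 4.

Lemma tq_ana : ana tq.
Proof. exact: (anaM (anaX 8 (ana_compX (ltn0Sn 3) (Pr_ana R))) (anaX 4 (ana_compX (ltn0Sn 1) (PrI_ana R)))). Qed.

Lemma vqE w : nm w < 1 -> vq w = Pr w ^+ 8 / Pr (w ^+ 2) ^+ 4.
Proof.
move=> w1; rewrite /vq /aq PrIE ?nm_expr_lt1 //.
by move: (Pr w) (Pr _) => a b; rewrite exprMn -exprM exprVn.
Qed.

Lemma tqE w : nm w < 1 -> tq w = Pr (w ^+ 4) ^+ 8 / Pr (w ^+ 2) ^+ 4.
Proof.
move=> w1; rewrite /tq PrIE ?nm_expr_lt1 //.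
by move: (Pr _) (Pr _) => a b; rewrite exprVn.
Qed.

Lemma tq_sqr w : nm w < 1 -> tq w ^+ 2 = vq (- w ^+ 2) * tq (w ^+ 2).
Proof.
move=> w1; have w2 := nm_expr_lt1 w1 (ltn0Sn 1); have w4 := nm_expr_lt1 w1 (ltn0Sn 3).
have w2N : nm (- w ^+ 2) < 1 by rewrite nmN.
have w8 : nm ((w ^+ 2) ^+ 4) < 1 by rewrite nm_expr_lt1.
rewrite (tqE w1) (tqE w2) (vqE w2N).
have -> : (- w ^+ 2) ^+ 2 = w ^+ 4 by rewrite sqrrN -exprM.
have e4 : (w ^+ 2) ^+ 2 = w ^+ 4 by rewrite -exprM.
move: (Pr_PrN w2) (Pr_neq0 w2) (Pr_neq0 w4) (Pr_neq0 w8); rewrite e4.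
move: (Pr (w ^+ 2)) (Pr (- w ^+ 2)) (Pr (w ^+ 4)) (Pr ((w ^+ 2) ^+ 4)) => a b c d e a0 c0 d0.
transitivity ((c ^+ 3) ^+ 8 / (a ^+ 8 * c ^+ 8)); first by field; rewrite ?a0 ?c0 ?d0.
by rewrite -e; field; rewrite ?a0 ?c0 ?d0.
Qed.

(** If the solutions first differ at order n > 0, the right-hand sides first differ at order 2n or
    later, whereas the left-hand sides differ at order n with coefficient [2 * d 0]. *)
Lemma tq_uniq f1 f2 g : ana f1 -> ana f2 -> ana g -> f1 0 = 1 -> f2 0 = 1 ->
  (forall w, nm w < 1 -> f1 w ^+ 2 = g w * f1 (w ^+ 2)) ->
  (forall w, nm w < 1 -> f2 w ^+ 2 = g w * f2 (w ^+ 2)) ->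
  forall w, nm w < 1 -> f1 w = f2 w.
Proof.
move=> h1 h2 hg f10 f20 E1 E2.
case: (ana_order (anaB h1 h2)) => [h w w1|[n [d [hd d0 Ed]]]].
  by apply/eqP; rewrite -subr_eq0 h.
exfalso; apply: (negP d0); apply/eqP.
have n0 : (0 < n)%N.
  case: n Ed => // Ed; exfalso; apply: (negP d0); apply/eqP.
  by have := Ed 0 (nm01 R); rewrite f10 f20 subrr expr0 mul1r.
have hA := anaB (anaM hd (anaD h1 h2)) (ana_monoM n (anaM hg (ana_compX (ltn0Sn 1) hd))).
have := @ana_cancel R _ n hA _ 0 (nm01 R).
rewrite expr0n gtn_eqF // mul0r subr0 f10 f20 => H.
have /eqP : d 0 * (1 + 1) = 0.
  apply: H => w w1; have := Ed _ (nm_expr_lt1 w1 (ltn0Sn 1)).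
  rewrite -exprM mul2n -addnn exprD => e.
  transitivity (f1 w ^+ 2 - f2 w ^+ 2 - g w * (f1 (w ^+ 2) - f2 (w ^+ 2))); last by rewrite E1 // E2 //; ring.
  rewrite e; have := Ed w w1; move: (f1 w) (f2 w) (d w) (d (w ^+ 2)) (w ^+ n) (g w) => a b x y p q e1.
  transitivity ((a - b) * (a + b) - q * (p * p * y)); last by ring.
  by rewrite e1; ring.
by rewrite mulf_eq0 -(natrD _ 1 1) pnatr_eq0 orbF => /eqP.
Qed.

Lemma tq_t1 w : nm w < 1 -> tq w = t1 w.
Proof.
have hv : ana (fun w => vt (- w ^+ 2)) := ana_compX (ltn0Sn 1) (ana_compN (vt_ana R)).
apply: (tq_uniq tq_ana (t1_ana R) hv _ (t1_0 R) _ t1_sqr).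
  by rewrite tqE ?nm01 // !expr0n /= Pr0 !expr1n divr1.
by move=> {}w w1; rewrite tq_sqr // vq_vt // nmN nm_expr_lt1.
Qed.

Lemma vt_neq0 w : nm w < 1 -> vt w != 0.
Proof. by move=> w1; rewrite -vq_vt // vqE // mulf_neq0 ?invr_eq0 ?expf_neq0 ?Pr_neq0 ?nm_expr_lt1. Qed.

Lemma t1_neq0 w : nm w < 1 -> t1 w != 0.
Proof. by move=> w1; rewrite -tq_t1 // tqE // mulf_neq0 ?invr_eq0 ?expf_neq0 ?Pr_neq0 ?nm_expr_lt1. Qed.

Lemma vtV_ana : ana (fun w : C => (vt w)^-1).
Proof.
apply: (ana_ext _ (anaM (anaX 8 (PrI_ana R)) (anaX 4 (ana_compX (ltn0Sn 1) (Pr_ana R))))) => w w1.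
rewrite -vq_vt // vqE // PrIE //; move: (Pr w) (Pr _) => a b.
by rewrite invfM invrK exprVn.
Qed.

Lemma t1V_ana : ana (fun w : C => (t1 w)^-1).
Proof.
apply: (ana_ext _ (anaM (anaX 8 (ana_compX (ltn0Sn 3) (PrI_ana R))) (anaX 4 (ana_compX (ltn0Sn 1) (Pr_ana R))))) => w w1.
rewrite -tq_t1 // tqE // PrIE ?nm_expr_lt1 //; move: (Pr _) (Pr _) => a b.
by rewrite invfM invrK exprVn.
Qed.

Lemma eta_mul n z : (0 < n)%N -> 0 < complex.Im z ->
  eta (n%:R * z) = nome 24 z ^+ n * Pr (nome 1 z ^+ n).
Proof.
move=> n0 z0; rewrite eta_Pr ?nomeMn //.
by rewrite ImMn mulr_gt0 ?ltr0n.
Qed.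

(** In terms of u = [w * t1 w], v = [w ^+ 2 * t1 (w ^+ 2)] and d = [vt (w ^+ 2)] one has E0 = d + 32
    v - 8 u and u^2 = (d + 16 v) v. The coefficients 8, 32, -128 cancel everything except d u. *)
Lemma F_eta_quotients (w : C) : nm w < 1 ->
  let E0 := vt w in let E1 := w * t1 w in let E2 := w ^+ 2 * t1 (w ^+ 2) in
  E0 * E1 + 8 * (E0 * E2) + 32 * (E1 * E2) - 128 * E2 ^+ 2 = w * t1 w * vt (w ^+ 2).
Proof.
move=> w1 /=; move: (vt_t1 w) (vt_t1 (w ^+ 2)) (vt_linear w1) (t1_sqr w1).
move: (vt w) (vt (- w)) (vt (w ^+ 2)) (vt (- w ^+ 2)) (t1 w) (t1 (w ^+ 2)) => a b d c t s e1 e2 e3 e4.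
have eb : b = a + 16 * (w * t) by rewrite -e1; ring.
have ec : c = d + 16 * (w ^+ 2 * s) by rewrite -e2; ring.
have ea : a = d + 32 * (w ^+ 2 * s) - 8 * (w * t).
  have n2 : (2 : C) != 0 by rewrite pnatr_eq0.
  apply: (mulfI n2); transitivity (a + b - 16 * (w * t)); first by rewrite eb; ring.
  by rewrite e3 ec; ring.
have et : (w * t) ^+ 2 = (d + 16 * (w ^+ 2 * s)) * (w ^+ 2 * s) by rewrite exprMn e4 ec; ring.
rewrite ea; move: (w * t) (w ^+ 2 * s) et => u v et.
transitivity (d * u + 8 * (d * v) + 128 * v ^+ 2 + 64 * (- u * v + u * v) - 8 * u ^+ 2); first by ring.
by rewrite et; ring.
Qed.

Lemma F_theta (z : uhp R) : F4_8_1 z = nome 1 (val z) * t1 (nome 1 (val z)) * vt (nome 1 (val z) ^+ 2).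
Proof.
have z0 := valP z; have q1 := nm_nome_lt1 (ltn0Sn 0) z0; have q2 := nm_expr_lt1 q1 (ltn0Sn 1).
rewrite -(F_eta_quotients q1) /F4_8_1 /E4_8_1 /E4_8_2 /E4_8_3 /E4_8_4.
have nq : nome 24 (val z) ^+ 24 = nome 1 (val z) :> C by rewrite (@nomeXn R 1 24).
have e0 : nome 24 (val z) != 0 :> C by exact: nome_neq0.
have p1 := Pr_neq0 q1; have p2 := Pr_neq0 q2; have p4 := Pr_neq0 (nm_expr_lt1 q1 (ltn0Sn 3)).
have -> : E2_8_0 z = vt (nome 1 (val z)).
  rewrite -vq_vt // vqE // /E2_8_0 eta_Pr // (@eta_mul 2) //.
  move: (Pr _) (Pr _) (nome 24 _) p1 p2 e0 => a b c a0 b0 c0; rewrite !exprMn.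
  by field; rewrite ?a0 ?b0 ?c0.
have -> : E2_8_1 z = nome 1 (val z) * t1 (nome 1 (val z)).
  rewrite -tq_t1 // tqE // /E2_8_1 (@eta_mul 2) // (@eta_mul 4) // -{3}nq.
  move: (Pr _) (Pr _) (nome 24 _) p2 p4 e0 => a b c a0 b0 c0; rewrite !exprMn.
  by field; rewrite ?a0 ?b0 ?c0.
suff -> : E2_8_2 z = nome 1 (val z) ^+ 2 * t1 (nome 1 (val z) ^+ 2) by [].
rewrite -tq_t1 // tqE // /E2_8_2 (@eta_mul 4) // (@eta_mul 8) //.
have -> : (nome 1 (val z) ^+ 2) ^+ 2 = nome 1 (val z) ^+ 4 :> C by rewrite -exprM.
have -> : (nome 1 (val z) ^+ 2) ^+ 4 = nome 1 (val z) ^+ 8 :> C by rewrite -exprM.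
have -> : nome 1 (val z) ^+ 2 = nome 24 (val z) ^+ 48 :> C by rewrite -{1}nq -exprM.
move: (Pr _) (Pr _) (nome 24 _) p4 e0 => a b c a0 c0; rewrite !exprMn.
by field; rewrite ?a0 ?b0 ?c0.
Qed.

End Gauss.

(** * The action of SL_2(Z) *)

Section SL2.
Variable R : realType.
Notation C := (cplx R).
Implicit Types (g h : SL2Z) (z : uhp R) (f : uhp R -> C).

Lemma ord2_1 : lift 0 0 = 1 :> 'I_2. Proof. exact: val_inj. Qed.

Lemma mulmx2E (g h : 'M[int]_2) i j : (g *m h) i j = g i 0 * h 0 j + g i 1 * h 1 j.
Proof. by rewrite mxE !big_ord_recl big_ord0 addr0 ord2_1. Qed.

Lemma det2E (g : 'M[int]_2) : \det g = g 0 0 * g 1 1 - g 0 1 * g 1 0.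
Proof.
rewrite (expand_det_row _ 0) !big_ord_recl big_ord0 /cofactor !det_mx11 !mxE /=.
have e10 : lift 1 0 = 0 :> 'I_2 by apply: val_inj.
by rewrite !ord2_1 !e10 addn0 expr0 expr1 mul1r mulN1r mulrN addr0.
Qed.

Lemma sl2_det g : g 0 0 * g 1 1 - g 0 1 * g 1 0 = 1.
Proof. by rewrite -det2E; exact/eqP/(valP g). Qed.

Definition mx2 (a b c d : int) : 'M[int]_2 :=
  \matrix_(i, j) (if i == 0 then if j == 0 then a else b else if j == 0 then c else d).

Lemma mx2_det a b c d : a * d - b * c = 1 -> \det (mx2 a b c d) == 1.
Proof. by move=> h; rewrite det2E !mxE /= h. Qed.

Definition sl2 a b c d (h : a * d - b * c = 1) : SL2Z :=
  exist (fun g : 'M[int]_2 => is_true (\det g == 1)) _ (mx2_det h).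

Lemma sl2E a b c d (h : a * d - b * c = 1) :
  [/\ sl2 h 0 0 = a, sl2 h 0 1 = b, sl2 h 1 0 = c & sl2 h 1 1 = d].
Proof. by split; rewrite /SL2Z_mx /= mxE. Qed.

Lemma sl2M_det g h : \det (SL2Z_mx g *m SL2Z_mx h) == 1.
Proof. by rewrite det_mulmx (eqP (valP g)) (eqP (valP h)) mulr1. Qed.
Definition sl2M g h : SL2Z :=
  exist (fun g : 'M[int]_2 => is_true (\det g == 1)) _ (sl2M_det g h).

Lemma sl2ME g h i j : sl2M g h i j = g i 0 * h 0 j + g i 1 * h 1 j.
Proof. exact: mulmx2E. Qed.

Lemma sl2V_det g : g 1 1 * g 0 0 - - g 0 1 * - g 1 0 = 1.
Proof. by rewrite mulrNN -(sl2_det g); ring. Qed.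
Definition sl2V g : SL2Z := sl2 (sl2V_det g).

Lemma sl2P g h : g 0 0 = h 0 0 -> g 0 1 = h 0 1 -> g 1 0 = h 1 0 -> g 1 1 = h 1 1 -> g = h.
Proof.
move=> a b c d; apply: val_inj; apply/matrixP => i j.
have o2 (k : 'I_2) : k = 0 \/ k = 1.
  by case: k => [[|[|//]] hk]; [left|right]; apply: val_inj.
by case: (o2 i) => ->; case: (o2 j) => ->.
Qed.

Lemma intC (k : int) : (k%:~R : C) = (k%:~R : R)%:C.
Proof. by rewrite (rmorph_int (real_complex R)). Qed.
Lemma Im_intM (k : int) (x : C) : complex.Im (k%:~R * x) = k%:~R * complex.Im x.
Proof. by rewrite intC ImZ. Qed.
Lemma Im_int (k : int) : complex.Im (k%:~R : C) = 0.
Proof. by rewrite intC. Qed.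

Lemma cd_neq0 (c d : int) (x : C) : 0 < complex.Im x -> (c != 0) || (d != 0) ->
  c%:~R * x + d%:~R != 0.
Proof.
move=> x0 cd; apply/eqP => e; have := congr1 (@complex.Im R) e.
rewrite ImD Im_intM Im_int addr0 /= => /eqP; rewrite mulf_eq0 (gt_eqF x0) orbF intr_eq0 => /eqP c0.
by move: e cd; rewrite c0 mul0r add0r => /eqP; rewrite intr_eq0 => /eqP ->.
Qed.

Lemma autf_neq0 g z : autf g z != 0.
Proof.
apply: cd_neq0; first exact: (valP z).
apply/negPn/negP; rewrite negb_or !negbK => /andP[/eqP c0 /eqP d0].
by have := sl2_det g; rewrite c0 d0 !mulr0.
Qed.

Lemma autfM g h z : autf (sl2M g h) z = autf g (mobius h z) * autf h z.
Proof.
rewrite [autf g _]/autf /= mulrDl -mulrA divfK ?autf_neq0 //.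
rewrite /autf !sl2ME !(rmorphD, rmorphM) /=; move: (val z) => x; ring.
Qed.

Lemma mobiusM g h z : mobius (sl2M g h) z = mobius g (mobius h z).
Proof.
apply: val_inj => /=; have j0 := autf_neq0 h z; have := autf_neq0 (sl2M g h) z.
rewrite autfM mulf_eq0 negb_or => /andP[j1 _].
have n0 : (g 0 0)%:~R * (((h 0 0)%:~R * val z + (h 0 1)%:~R) / autf h z) + (g 0 1)%:~R =
    ((sl2M g h 0 0)%:~R * val z + (sl2M g h 0 1)%:~R) / autf h z :> C.
  apply: (mulIf j0); rewrite divfK // mulrDl -mulrA divfK // /autf !sl2ME !(rmorphD, rmorphM) /=.
  by move: (val z) => x; ring.
by rewrite n0 invfM mulrA mulrAC.
Qed.

Lemma slashM w f g h : slash w f (sl2M g h) = slash w (slash w f g) h.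
Proof.
apply: functional_extensionality_dep => z; rewrite /slash autfM mobiusM exprMn invfM.
by rewrite [_ * (autf h z ^- w)]mulrC mulrA.
Qed.

Lemma sl2VK g h : sl2M (sl2M h (sl2V g)) g = h.
Proof.
have [e00 e01 e10 e11] := sl2E (sl2V_det g); have d := sl2_det g.
apply: sl2P; rewrite !sl2ME e00 e01 e10 e11.
- transitivity (h 0 0 * (g 0 0 * g 1 1 - g 0 1 * g 1 0)); [ring | by rewrite d mulr1].
- transitivity (h 0 1 * (g 0 0 * g 1 1 - g 0 1 * g 1 0)); [ring | by rewrite d mulr1].
- transitivity (h 1 0 * (g 0 0 * g 1 1 - g 0 1 * g 1 0)); [ring | by rewrite d mulr1].
- transitivity (h 1 1 * (g 0 0 * g 1 1 - g 0 1 * g 1 0)); [ring | by rewrite d mulr1].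
Qed.

Lemma mobius_sl2VK g z : mobius g (mobius (sl2V g) z) = z.
Proof.
rewrite -mobiusM; apply: val_inj => /=; rewrite /autf !sl2ME.
have [-> -> -> ->] := sl2E (sl2V_det g).
have -> : g 0 0 * g 1 1 + g 0 1 * - g 1 0 = 1 by rewrite mulrN sl2_det.
have -> : g 1 0 * - g 0 1 + g 1 1 * g 0 0 = 1 by rewrite -(sl2_det g); ring.
have -> : g 0 0 * - g 0 1 + g 0 1 * g 0 0 = 0 by ring.
have -> : g 1 0 * g 1 1 + g 1 1 * - g 1 0 = 0 by ring.
by rewrite !mulr0z mul0r !mulr1z add0r mul1r addr0 divr1.
Qed.

Lemma Im_mob (a b c d : int) (x : C) : a * d - b * c = 1 -> 0 < complex.Im x ->
  0 < complex.Im ((a%:~R * x + b%:~R) / (c%:~R * x + d%:~R)).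
Proof.
move=> h x0; have [e00 e01 e10 e11] := sl2E h.
have := valP (mobius (sl2 h) (exist (fun x : C => is_true (0 < complex.Im x)) x x0)).
by rewrite /= /autf e00 e01 e10 e11.
Qed.

End SL2.

(** * Theta constants under SL_2(Z) *)

Section ThetaAction.
Variable R : realType.
Notation C := (cplx R).
Implicit Types (z x y : C) (r : bool) (a b c d m : int).

Definition par m : bool := odd `|m|%N.
Lemma parN m : par (- m) = par m. Proof. by rewrite /par abszN. Qed.
Lemma parM m n : par (m * n) = par m && par n. Proof. by rewrite /par abszM oddM. Qed.
Lemma parD m n : par (m + n) = par m (+) par n.
Proof. by rewrite /par; lia. Qed.

(* The three half-period values of the Weierstrass function, indexed by nonzero row
   vectors modulo 2 on which matrices act from the right. *)
Definition ee r1 r2 z : C := match r1, r2 with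
  | false, false => 0
  | false, true => (u3 z + u4 z) / 3
  | true, true => (u2 z - u4 z) / 3
  | true, false => - (u2 z + u3 z) / 3
  end.

Lemma eeT r1 r2 z : ee r1 r2 (z + 1) = ee r1 (r2 (+) r1) z.
Proof.
rewrite /ee; move: (u2T z) (u3T z) (u4T z).
move: (u2 (z + 1)) (u3 (z + 1)) (u4 (z + 1)) (u2 z) (u3 z) (u4 z) => x2 x3 x4 p q s -> -> ->.
by case: r1; case: r2 => /=; ring.
Qed.

Lemma eeS r1 r2 z : 0 < complex.Im z -> ee r1 r2 (- z^-1) = z ^+ 2 * ee r2 r1 z.
Proof.
move=> z0; rewrite /ee; move: (u2S z0) (u3S z0) (u4S z0).
move: (u2 (- z^-1)) (u3 (- z^-1)) (u4 (- z^-1)) (u2 z) (u3 z) (u4 z) => x2 x3 x4 p q s -> -> ->.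
by case: r1; case: r2; ring.
Qed.

Lemma eeTn r1 r2 (n : nat) z : ee r1 r2 (z + n%:R) = ee r1 (r2 (+) (r1 && odd n)) z.
Proof.
elim: n r2 => [|n IH] r2; first by rewrite addr0 andbF addbF.
rewrite -natr1 addrA eeT IH /=; congr (ee _ _ _).
by move: (odd n) => oo {IH}; move: oo r1 r2 => [] [] [].
Qed.

Lemma eeTz r1 r2 m z : ee r1 r2 (z + m%:~R) = ee r1 (r2 (+) (r1 && par m)) z.
Proof.
case: m => n; first exact: eeTn.
rewrite NegzE mulrNz parN; set s := _ (+) _.
have := eeTn r1 s n.+1 (z - n.+1%:~R); rewrite subrK => ->.
by rewrite {}/s /par absz_nat; congr (ee _ _ _); move: (odd _) r1 r2 => [] [] [].
Qed.

(** Euclid's algorithm on the first column: with a = q c + a', the image is q - 1/y, where y is the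
    image of z under a matrix with lower left entry -a', smaller than c in modulus. For c = 0 only a
    translation remains. *)
Lemma ee_act a b c d : a * d - b * c = 1 -> forall r1 r2 z, 0 < complex.Im z ->
  ee r1 r2 ((a%:~R * z + b%:~R) / (c%:~R * z + d%:~R)) =
  (c%:~R * z + d%:~R) ^+ 2 *
  ee (r1 && par a (+) r2 && par c) (r1 && par b (+) r2 && par d) z.
Proof.
have [n] := ubnP `|c|%N; elim: n => // n IH in a b c d *; rewrite ltnS => cn det r1 r2 z z0.
have [c0|cN0] := eqVneq c 0.
  have ad : a * d = 1 by move: det; rewrite c0 mulr0 subr0.
  have : (`|a| == 1)%N && (`|d| == 1)%N by rewrite -muln_eq1 -abszM ad.
  rewrite c0 mulr0z mul0r add0r.
  case/andP => /eqP a1 /eqP d1; have pa : par a by rewrite /par a1.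
  have pd : par d by rewrite /par d1.
  have d2 : d * d = 1 by move: d1; lia.
  have e : (a%:~R * z + b%:~R) / d%:~R = z + (b * d)%:~R :> C.
    have dn : d%:~R != 0 :> C by rewrite intr_eq0 -absz_eq0 d1.
    apply: (mulIf dn); rewrite divfK // mulrDl -intrM -mulrA d2 mulr1 mulrC; congr (_ * _ + _).
    by congr (_ %:~R); rewrite -[d]mul1r -ad -mulrA d2 mulr1.
  rewrite e eeTz -rmorphXn /= expr2 d2 mul1r pa pd parM pd.
  by congr (ee _ _ _); case: r1; case: r2; case: (par b).
pose q := (a %/ c)%Z; pose a' := (a %% c)%Z; pose b' := b - q * d.
have ea : a = q * c + a' by exact: divz_eq.
have eb : b = q * d + b' by rewrite /b' addrC subrK.
have det' : c * (- b') - d * (- a') = 1 by rewrite -det ea eb; ring.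
have la : (`| - a'| < n)%N.
  rewrite abszN; apply: leq_trans cn.
  by have := ltz_pmod a (d := `|c|); have := modz_ge0 a cN0; rewrite /a' -modz_abs; lia.
clearbody b' a' q.
have y0 := Im_mob det' z0; have cd : c%:~R * z + d%:~R != 0 :> C by rewrite cd_neq0 ?cN0.
have a'b' : (- a')%:~R * z + (- b')%:~R != 0 :> C.
  apply: cd_neq0 => //; rewrite -negb_and; apply/negP => /andP[/eqP ha /eqP hb].
  by move: det'; rewrite ha hb !mulr0 subr0.
set y := (_ / _) in y0.
have e : (a%:~R * z + b%:~R) / (c%:~R * z + d%:~R) = - y^-1 + q%:~R.
  apply: (mulIf cd); rewrite divfK // mulrDl /y invf_div mulNr divfK // ea eb.
  by rewrite !(rmorphD, rmorphM, rmorphN) /=; ring.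
rewrite e eeTz eeS // /y (IH _ _ _ _ la det') // mulrA -exprMn divfK //.
rewrite ea eb !parD !parM !parN; congr (_ * ee _ _ _).
  by case: r1; case: r2; case: (par q); case: (par c); case: (par a').
by case: r1; case: r2; case: (par q); case: (par d); case: (par b').
Qed.

Lemma u4_ee z : u4 z = ee false true z - ee true true z.
Proof. by rewrite /ee u3E; move: (u2 z) (u4 z) => p q; field. Qed.
Lemma u2_ee z : u2 z = ee true true z - ee true false z.
Proof. by rewrite /ee u3E; move: (u2 z) (u4 z) => p q; field. Qed.
Lemma u3_ee z : u3 z = ee false true z - ee true false z.
Proof. by rewrite /ee u3E; move: (u2 z) (u4 z) => p q; field. Qed.

Arguments ee : simpl never.

Section Act.
Variables (a b c d : int) (z : C).
Hypotheses (det : a * d - b * c = 1) (z0 : 0 < complex.Im z).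
Let J : C := c%:~R * z + d%:~R.
Let gz : C := (a%:~R * z + b%:~R) / J.

Lemma par_det : par a && par d (+) par b && par c.
Proof. by have := congr1 par det; rewrite parD parN !parM. Qed.

Lemma u4_act : u4 gz = J ^+ 2 * (ee (par c) (par d) z - ee (par a (+) par c) (par b (+) par d) z).
Proof. by rewrite u4_ee !(ee_act det) // -mulrBr. Qed.
Lemma u2_act : u2 gz = J ^+ 2 * (ee (par a (+) par c) (par b (+) par d) z - ee (par a) (par b) z).
Proof. by rewrite u2_ee !(ee_act det) // -mulrBr /= !addbF. Qed.

(** The theta action depends on the matrix modulo 2. The cases treated here, a and d even or b even,
    cover the matrices arising from the arguments 2z and 4z in [FF]. *)
Lemma u2_act_S : ~~ par a -> ~~ par d -> u2 gz = - J ^+ 2 * u4 z.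
Proof.
move=> pa pd; have := par_det; rewrite u2_act (negPf pa) (negPf pd) => /= /andP[-> ->] /=.
rewrite u4_ee; move: J (ee true true z) (ee false true z) => j p q. ring.
Qed.
Lemma u4_act_S : ~~ par a -> ~~ par d -> u4 gz = - J ^+ 2 * u2 z.
Proof.
move=> pa pd; have := par_det; rewrite u4_act (negPf pa) (negPf pd) => /= /andP[-> ->] /=.
rewrite u2_ee; move: J (ee true true z) (ee true false z) => j p q; ring.
Qed.
Lemma u2_act_L : ~~ par b -> u2 gz = J ^+ 2 * (if par c then u3 z else u2 z).
Proof.
move=> pb; have := par_det; rewrite u2_act (negPf pb) addbF => /andP[-> ->] /=.
by case: (par c) => /=; rewrite ?u3_ee ?u2_ee.
Qed.
Lemma u4_act_L : ~~ par b -> u4 gz = J ^+ 2 * ((if par c then -1 else 1) * u4 z).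
Proof.
move=> pb; have := par_det; rewrite u4_act (negPf pb) addbF => /andP[-> ->] /=.
by rewrite u4_ee; case: (par c); rewrite /= ?mul1r // mulN1r opprB.
Qed.
End Act.

End ThetaAction.

(** * Expansions of the cusp form at all cusps *)

Section FormF.
Variable R : realType.
Notation C := (cplx R).
Implicit Types (z x y w : C) (a b c d m : int) (U : C -> C).

(** Units among the functions analytic on the disc. Recording the inverse as analytic is what makes
    division by F|g possible on expansions. *)
Definition unita U := [/\ ana U, ana (fun w => (U w)^-1) & forall w, nm w < 1 -> U w != 0].

Lemma unitaM U1 U2 : unita U1 -> unita U2 -> unita (fun w => U1 w * U2 w).
Proof.
move=> [h1 h2 h3] [k1 k2 k3]; split; first exact: (anaM h1 k1).
  by apply: (ana_ext _ (anaM h2 k2)) => w _; rewrite invfM.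
by move=> w w1; rewrite mulf_neq0 ?h3 ?k3.
Qed.
Lemma unita_cst (k : C) : k != 0 -> unita (fun=> k).
Proof. by move=> k0; split=> //; exact: ana_cst. Qed.
Lemma unita_comp (k : C) n U : (0 < n)%N -> nm k <= 1 -> unita U -> unita (fun w => U (k * w ^+ n)).
Proof.
move=> n0 k1 [h1 h2 h3]; split; [exact: (ana_comp n0 k1 h1) | exact: (ana_comp n0 k1 h2) |].
move=> w w1; apply: h3; rewrite nmM mulrC; apply: le_lt_trans (nm_expr_lt1 w1 n0).
by rewrite ler_piMr ?nm_ge0.
Qed.
Lemma unita_vt : unita (@vt R).
Proof. by split; [exact: vt_ana | exact: vtV_ana | exact: vt_neq0]. Qed.
Lemma unita_t1 : unita (@t1 R).
Proof. by split; [exact: t1_ana | exact: t1V_ana | exact: t1_neq0]. Qed.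

(** F as theta_2(2z)^4 theta_4(4z)^4 / 16, with the theta constants taken in their usual
    variable. *)
Definition FF z : C := u2 (2 * z) * u4 (4 * z) / 16.

Lemma FF_theta z : FF z = nome 1 z * t1 (nome 1 z) * vt (nome 1 z ^+ 2).
Proof.
rewrite /FF u2_t1 /u4.
have -> : nome 2 (2 * z) = nome 1 z :> C by rewrite nomeMn (@nomeXn R 1 2).
have -> : nome 2 (4 * z) = nome 1 z ^+ 2 :> C by rewrite -(@nomeXn R 1 2) // -exprM nomeMn.
by move: (nome 1 z) => s; move: (t1 s) (vt (s ^+ 2)) => p q; field.
Qed.

Lemma par_odd m : par m -> exists s, m = 2 * s + 1.
Proof. by rewrite /par => h; exists (m %/ 2)%Z; lia. Qed.
Lemma par_even m : ~~ par m -> exists s, m = 2 * s.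
Proof. by rewrite /par => h; exists (m %/ 2)%Z; lia. Qed.
Lemma par2 m : par (2 * m) = false. Proof. by rewrite parM. Qed.
Lemma par_sqr m : par m -> exists j, m * m = 8 * j + 1.
Proof.
move=> /par_odd[s ->]; have : ~~ par (s * (s + 1)) by rewrite parM parD; case: (par s).
move=> /par_even[t e]; exists t.
transitivity (4 * (s * (s + 1)) + 1); first by ring.
by rewrite e; ring.
Qed.

Lemma nm_nome_real h (x : C) : complex.Im x = 0 -> nm (nome h x) = 1.
Proof. by move=> x0; rewrite nm_nome x0 mulr0 mul0r oppr0 expR0. Qed.

Lemma nome2_8 z : nome 2 z = nome 8 z ^+ 4 :> C. Proof. by rewrite (@nomeXn R 2 4). Qed.
Lemma nome1_8 z : nome 1 z = nome 8 z ^+ 8 :> C. Proof. by rewrite (@nomeXn R 1 8). Qed.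

Section Act.
Variables (a b c d : int) (z : C).
Hypotheses (det : a * d - b * c = 1) (z0 : 0 < complex.Im z).
Let J : C := c%:~R * z + d%:~R.
Let gz : C := (a%:~R * z + b%:~R) / J.

Lemma J_neq0 : J != 0.
Proof.
apply: cd_neq0 => //; rewrite -negb_and; apply/negP => /andP[/eqP ha /eqP hb].
by move: det; rewrite ha hb !mulr0 subr0.
Qed.

(** The matrices diag(2,1) g and diag(4,1) g are integral matrices of determinant 1 times a
    translation by c d followed by division by 2 or 4. The same translation serves both because c^2
    = 8j + 1. *)
Lemma FF_odd : par c -> FF gz = J ^+ 4 / 1024 * (u4 ((z + (c * d)%:~R) / 2) * u2 ((z + (c * d)%:~R) / 4)).
Proof.
move=> /par_sqr[j ej]; have J0 := J_neq0.
have Im_x (n : nat) : (0 < n)%N -> 0 < complex.Im ((z + (c * d)%:~R) / n%:R : C).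
  by move=> n0; rewrite ImVn ImD Im_int addr0 divr_gt0 ?ltr0n.
have ejC : c%:~R * c%:~R = 8 * j%:~R + 1 :> C.
  by rewrite -intrM ej rmorphD rmorphM.
have det2 : (2 * a) * (- (4 * j * d)) - (b - a * c * d) * c = 1.
  by transitivity (a * d * (c * c - 8 * j) - b * c); [ring | rewrite ej -[RHS]det; ring].
have det4 : (4 * a) * (- (2 * j * d)) - (b - a * c * d) * c = 1.
  by transitivity (a * d * (c * c - 8 * j) - b * c); [ring | rewrite ej -[RHS]det; ring].
have := u2_act_S det2 (Im_x 2 isT); have := u4_act_S det4 (Im_x 4 isT).
rewrite !(parN, parM) /= => /(_ isT isT) + /(_ isT isT).
rewrite !(rmorphD, rmorphN, rmorphM) /=.
have -> : c%:~R * ((z + c%:~R * d%:~R) / 4) - 2 * j%:~R * d%:~R = J / 4.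
  by rewrite /J; transitivity ((c%:~R * z + (c%:~R * c%:~R) * d%:~R - 8 * j%:~R * d%:~R) / 4); [field | rewrite ejC; field].
have -> : c%:~R * ((z + c%:~R * d%:~R) / 2) - 4 * j%:~R * d%:~R = J / 2.
  by rewrite /J; transitivity ((c%:~R * z + (c%:~R * c%:~R) * d%:~R - 8 * j%:~R * d%:~R) / 2); [field | rewrite ejC; field].
have -> : (2 * a%:~R * ((z + c%:~R * d%:~R) / 2) + (b%:~R - a%:~R * c%:~R * d%:~R)) / (J / 2) = 2 * gz.
  by rewrite /gz; field.
have -> : (4 * a%:~R * ((z + c%:~R * d%:~R) / 4) + (b%:~R - a%:~R * c%:~R * d%:~R)) / (J / 4) = 4 * gz.
  by rewrite /gz; field.
by rewrite /FF => -> ->; move: (u4 _) (u2 _) J => p q s; field.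
Qed.

(** For the factor at 2z, g is conjugated by diag(2,1), which leaves an odd lower left entry c' and
    turns theta_2 into theta_3. For the factor at 4z a translation by c' d / 2 is split off, again
    using that c' is odd. *)
Lemma FF_even c' : c = 2 * c' -> par c' ->
  FF gz = - J ^+ 4 / 64 * (u3 (2 * z) * u2 (z + (c' * d)%:~R / 2)).
Proof.
move=> ec pc; have [j ej] := par_sqr pc; have J0 := J_neq0.
have ejC : c'%:~R * c'%:~R = 8 * j%:~R + 1 :> C.
  by rewrite -intrM ej rmorphD rmorphM.
have x2 : 0 < complex.Im (2 * z) by rewrite ImMn mulr_gt0.
have x4 : 0 < complex.Im (z + (c' * d)%:~R / 2 : C) by rewrite ImD ImVn Im_int mul0r addr0.
have det2 : a * d - (2 * b) * c' = 1 by rewrite -[RHS]det ec; ring.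
have det4 : (2 * a) * (- (4 * j * d)) - (2 * b - a * c' * d) * c' = 1.
  transitivity (a * d * (c' * c' - 8 * j) - b * c); first by rewrite ec; ring.
  by rewrite ej -[RHS]det; ring.
have := u2_act_L det2 x2; have := u4_act_S det4 x4.
rewrite !(parN, parM) pc /= => /(_ isT isT) + /(_ isT).
rewrite !(rmorphD, rmorphN, rmorphM) /=.
have cE : c%:~R = 2 * c'%:~R :> C by rewrite ec rmorphM.
have -> : c'%:~R * (z + c'%:~R * d%:~R / 2) - 4 * j%:~R * d%:~R = J / 2.
  by rewrite /J cE; transitivity ((2 * c'%:~R * z + (c'%:~R * c'%:~R) * d%:~R - 8 * j%:~R * d%:~R) / 2); [field | rewrite ejC; field].
have -> : c'%:~R * (2 * z) + d%:~R = J by rewrite /J cE; ring.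
have -> : (a%:~R * (2 * z) + 2 * b%:~R) / J = 2 * gz by rewrite /gz; field.
have -> : (2 * a%:~R * (z + c'%:~R * d%:~R / 2) + (2 * b%:~R - a%:~R * c'%:~R * d%:~R)) / (J / 2) = 4 * gz.
  by rewrite /gz; field.
by rewrite /FF => -> ->; move: (u3 _) (u2 _) J => p q s; field.
Qed.

(** Conjugation by diag(2,1) and diag(4,1) keeps both matrices integral. The sign for odd c' shows
    that invariance holds at level 8, not at level 4. *)
Lemma FF_four c' : c = 4 * c' -> FF gz = J ^+ 4 * ((if par c' then -1 else 1) * FF z).
Proof.
move=> ec; have J0 := J_neq0.
have x2 : 0 < complex.Im (2 * z) by rewrite ImMn mulr_gt0.
have x4 : 0 < complex.Im (4 * z) by rewrite ImMn mulr_gt0.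
have det2 : a * d - (2 * b) * (2 * c') = 1 by rewrite -[RHS]det ec; ring.
have det4 : a * d - (4 * b) * c' = 1 by rewrite -[RHS]det ec; ring.
have := u2_act_L det2 x2; have := u4_act_L det4 x4.
rewrite !parM /= => /(_ isT) + /(_ isT).
rewrite !(rmorphD, rmorphN, rmorphM) /=.
have cE : c%:~R = 4 * c'%:~R :> C by rewrite ec rmorphM.
have -> : 2 * c'%:~R * (2 * z) + d%:~R = J by rewrite /J cE; ring.
have -> : c'%:~R * (4 * z) + d%:~R = J by rewrite /J cE; ring.
have -> : (a%:~R * (2 * z) + 2 * b%:~R) / J = 2 * gz by rewrite /gz; field.
have -> : (a%:~R * (4 * z) + 4 * b%:~R) / J = 4 * gz by rewrite /gz; field.
by rewrite /FF => -> ->; case: (par c'); move: (u4 _) (u2 _) J => p q s; field.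
Qed.

End Act.

(** The triples are (e, m) = (1, 8) for c odd, (4, 2) for c twice an odd number, (8, 1) for c
    divisible by 4. Here m is a period at the cusp, because 8 divides c^2 m, and [nome 8 ^ e] is
    [nome m]: the zero is simple in the local parameter. *)
Lemma FF_expansion a b c d : a * d - b * c = 1 -> exists (e m : nat) U,
  [/\ (e * m)%N = 8, (8 %| c * c * m%:Z)%Z, unita U &
   forall z, 0 < complex.Im z -> FF ((a%:~R * z + b%:~R) / (c%:~R * z + d%:~R)) =
     (c%:~R * z + d%:~R) ^+ 4 * (nome 8 z ^+ e * U (nome 8 z))].
Proof.
move=> det; have [pc|/par_even[c' ec]] := boolP (par c).
  pose k : C := nome 8 (c * d)%:~R.
  have k0 : k != 0 by exact: nome_neq0.
  have k1 : nm k = 1 by rewrite nm_nome_real // Im_int.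
  exists 1%N, 8%N, (fun w => k / 64 * (vt (k ^+ 2 * w ^+ 2) * t1 (k * w ^+ 1))); split => //.
  - by rewrite dvdz_mull.
  - apply: unitaM; first by apply: unita_cst; rewrite mulf_neq0 ?invr_eq0 ?pnatr_eq0.
    by apply: unitaM; [apply: unita_comp unita_vt | apply: unita_comp unita_t1]; rewrite ?nmX ?k1 ?expr1n.
  move=> z z0; rewrite (FF_odd det z0 pc) u2_t1 /u4.
  have -> : nome 2 ((z + (c * d)%:~R) / 4) = k * nome 8 z by rewrite nome_div nomeD mulrC.
  have -> : nome 2 ((z + (c * d)%:~R) / 2) = k ^+ 2 * nome 8 z ^+ 2.
    by rewrite nome_div -exprMn -(@nomeXn R 4 2) // nomeD mulrC.
  by rewrite !expr1; move: (nome 8 z) => w; move: (t1 _) (vt _) (_ + _) => p q s; field.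
have [pc|/par_even[c2 ec2]] := boolP (par c').
  pose k : C := nome 2 ((c' * d)%:~R / 2).
  have k0 : k != 0 by exact: nome_neq0.
  have k1 : nm k = 1 by rewrite nm_nome_real // ImVn Im_int mul0r.
  exists 4%N, 2%N, (fun w => - k / 4 * (vt (-1 * w ^+ 8) * t1 (k * w ^+ 4))); split => //.
  - by rewrite ec; apply/dvdzP; exists (c' * c'); rewrite -[(2%N : int)]/(2 : int); ring.
  - apply: unitaM; first by apply: unita_cst; rewrite mulf_neq0 ?oppr_eq0 ?invr_eq0 ?pnatr_eq0.
    by apply: unitaM; [apply: unita_comp unita_vt | apply: unita_comp unita_t1]; rewrite ?nmN ?nm1 ?k1.
  move=> z z0; rewrite (FF_even det z0 ec pc) u2_t1 /u3.
  have -> : nome 2 (2 * z) = nome 8 z ^+ 8 :> C by rewrite nomeMn (@nomeXn R 1 2) // nome1_8.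
  have -> : nome 2 (z + (c' * d)%:~R / 2) = k * nome 8 z ^+ 4 by rewrite nomeD mulrC (nome2_8 z).
  by rewrite mulN1r; move: (nome 8 z) => w; move: (t1 _) (vt _) (_ + _) => p q s; field.
pose k : C := if par c2 then -1 else 1.
have k0 : k != 0 by rewrite /k; case: ifP; rewrite ?oppr_eq0 oner_eq0.
exists 8%N, 1%N, (fun w => k * (vt (1 * w ^+ 16) * t1 (1 * w ^+ 8))); split => //.
- by rewrite ec ec2; apply/dvdzP; exists (2 * c2 * c2); rewrite -[(1%N : int)]/(1 : int); ring.
- apply: unitaM; first exact: unita_cst.
  by apply: unitaM; [apply: unita_comp unita_vt | apply: unita_comp unita_t1]; rewrite ?nm1.
move=> z z0; have e4 : c = 4 * c2 by rewrite ec ec2; ring.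
rewrite (FF_four det z0 e4) -/k FF_theta nome1_8 !mul1r.
have -> : (nome 8 z ^+ 8) ^+ 2 = nome 8 z ^+ 16 :> C by rewrite -exprM.
by move: (nome 8 z) => w; move: (t1 _) (vt _) (_ + _) => p q s; ring.
Qed.

Lemma FF_Gamma0 a b c d z : a * d - b * c = 1 -> 0 < complex.Im z -> (8 %| c)%Z ->
  FF ((a%:~R * z + b%:~R) / (c%:~R * z + d%:~R)) = (c%:~R * z + d%:~R) ^+ 4 * FF z.
Proof.
move=> det z0 /dvdzP[c' ec].
have e4 : c = 4 * (2 * c') by rewrite ec; ring.
by rewrite (FF_four det z0 e4) par2 mul1r.
Qed.

End FormF.

(** * Division by the cusp form of weight 4 *)

Section Division.
Variable R : realType.
Notation C := (cplx R).
Implicit Types (x y w : C) (z : uhp R) (g : SL2Z) (U A B : C -> C) (f b : uhp R -> C).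

Notation F := (@F4_8_1 R).

Lemma F_FF z : F z = FF (val z). Proof. by rewrite F_theta FF_theta. Qed.

Lemma F_slash g : exists (e m : nat) U,
  [/\ (e * m)%N = 8, (8 %| g 1%R 0%R * g 1%R 0%R * m%:Z)%Z, unita U &
   forall z, slash 4 F g z = nome 8 (val z) ^+ e * U (nome 8 (val z))].
Proof.
have [e [m [U [em dv hU EU]]]] := FF_expansion R (sl2_det g).
exists e, m, U; split => // z; have j0 := autf_neq0 g z.
rewrite /slash F_FF /= (EU _ (valP z)) -/(autf g z) mulrA mulVf ?mul1r //.
by rewrite expf_neq0.
Qed.

Lemma F_Gamma0 g : Gamma0 8 g -> slash 4 F g = F.
Proof.
move=> hg; apply: functional_extensionality_dep => z; have j0 := autf_neq0 g z.
rewrite /slash !F_FF /= (FF_Gamma0 (sl2_det g) (valP z) hg) -/(autf g z) mulrA mulVf ?mul1r //.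
by rewrite expf_neq0.
Qed.

Lemma F_neq0 z : F z != 0.
Proof.
have q1 := nm_nome_lt1 (ltn0Sn 0) (valP z).
rewrite F_theta; apply: mulf_neq0; last by rewrite vt_neq0 // nm_expr_lt1.
by apply: mulf_neq0; [exact: nome_neq0 | exact: t1_neq0].
Qed.

Lemma F_holo : holomorphic F.
Proof.
apply: (@holomorphic_ana R 1 F (fun w => w ^+ 1 * (t1 w * vt (w ^+ 2)))) => //.
  exact: (ana_monoM 1 (anaM (t1_ana R) (ana_compX (ltn0Sn 1) (vt_ana R)))).
by move=> z; rewrite F_theta expr1 mulrA.
Qed.

Lemma ana_eq_nome A B h : ana A -> ana B -> (0 < h)%N ->
  (forall x, 0 < complex.Im x -> A (nome h x) = B (nome h x)) -> forall w, nm w < 1 -> A w = B w.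
Proof.
move=> hA hB h0 E w w1; apply/eqP; rewrite -subr_eq0; apply/eqP.
apply: (ana_zero_real (anaB hA hB)) w1 => t t01.
have [s [s0 <-]] := nome_surj h0 t01.
by rewrite (E (0 +i* s)) // subrr.
Qed.

Lemma cexp_neq1 (t : R) : 0 < t < 2 * pi -> cexp (0 +i* t) != 1 :> C.
Proof.
move=> /andP[t0 t2]; apply/eqP => /(congr1 (@complex.Re R)) /=; rewrite expR0 mul1r => e.
have s0 : 0 < sin (t / 2) by rewrite sin_gt0_pi // divr_gt0 //= ltr_pdivrMr // mulrC.
move: e; rewrite [t](_ : _ = (t / 2) *+ 2); last by rewrite -mulr_natr divfK.
rewrite cos_mulr2n => e; have := cos2Dsin2 (t / 2).
move: (sin _) (cos _) s0 e => s c s0 e h; nra.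
Qed.

Lemma nome_neq1 h k : (0 < k < h)%N -> nome h k%:R != 1 :> C.
Proof.
move=> /andP[k0 kh]; have h0 : (0 < h)%N by exact: leq_trans kh.
rewrite nomeE Im_nat mulr0 mul0r oppr0; apply: cexp_neq1.
have -> : complex.Re (k%:R : C) = k%:R by rewrite natC.
have p0 := pi_gt0 R; have hR : 0 < h%:R :> R by rewrite ltr0n.
by rewrite divr_gt0 ?mulr_gt0 ?ltr0n //= ltr_pdivrMr // ltr_pM2l ?mulr_gt0 // ltr_nat.
Qed.

Lemma hasps_rot a A (k : C) : nm k = 1 -> hasps a A -> hasps (fun n => a n * k ^+ n) (fun w => A (k * w)).
Proof.
move=> k1 [ha hA]; split.
  move=> r r01; have [B HB] := ha r r01; exists B => n.
  by rewrite nmM nmX k1 expr1n mulr1.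
move=> w w1; have kw : nm (k * w) < 1 by rewrite nmM k1 mul1r.
apply: (cvgC_eq _ (hA _ kw)); exists 0%N => n _.
by rewrite !seriesCE; apply: eq_bigr => i _; rewrite exprMn mulrA.
Qed.

(* A translation by [m] multiplies the [n]-th coefficient by [nome (8 * h) (m * n)],
   which differs from 1 for [0 < n < e * h]. *)
Lemma period_order A h e m : ana A -> A 0 = 0 -> (0 < h)%N -> (e * m)%N = 8 ->
  (forall x, 0 < complex.Im x -> A (nome h (x + m%:R)) = A (nome h x)) ->
  exists B, ana B /\ forall w, nm w < 1 -> A (w ^+ 8) = w ^+ (e * h) * B w.
Proof.
move=> hA A0 h0 em per; pose H := (h * 8)%N; pose k : C := nome H m%:R.
have H0 : (0 < H)%N by rewrite muln_gt0 h0.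
have k1 : nm k = 1 by rewrite nm_nome_real // Im_nat.
have [b hb] := ana_compX (ltn0Sn 7) hA.
have E x : 0 < complex.Im x -> A (nome H (x + m%:R) ^+ 8) = A (nome H x ^+ 8).
  by move=> x0; rewrite !(@nomeXn R h 8) // per.
have rot := hasps_rot k1 hb.
have ek : (fun n => b n * k ^+ n) = b.
  have EN x : 0 < complex.Im x -> A ((k * nome H x) ^+ 8) = A (nome H x ^+ 8).
    by move=> x0; rewrite -(E x x0) nomeD mulrC.
  have h1 : ana (fun w => A ((k * w) ^+ 8)) by exists (fun n => b n * k ^+ n).
  have h2 : ana (fun w => A (w ^+ 8)) by exists b.
  exact: (hasps_uniq rot hb (@ana_eq_nome _ _ H h1 h2 H0 EN)).
have b0 n : (n < e * h)%N -> b n = 0.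
  move=> nl; have [->|n0] := posnP n; first by have := hasps0 hb; rewrite expr0n A0 => <-.
  have := congr1 (fun u => u n) ek => /= /eqP.
  rewrite -subr_eq0 -[X in _ - X]mulr1 -mulrBr mulf_eq0 => /orP[/eqP //|].
  rewrite subr_eq0 /k -nomeMn -natrM; have : nome H (n * m)%:R != 1 :> C.
    apply: nome_neq1; rewrite muln_gt0 n0 /=.
    case: m em {per k k1 rot ek E} => [|m] em; first by rewrite muln0 in em.
    have -> : H = (e * h * m.+1)%N by rewrite mulnAC em mulnC.
    by rewrite ltn_pmul2r.
  by move=> /negPf ->.
have [B [hB EB]] := hasps_shift hb b0.
by exists B; split; [exists (fun n => b (e * h + n)%N) | exact: EB].
Qed.

(** The conjugate of the translation by m under g has lower left entry - c^2 m, so it lies in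
    Gamma_0(8) and fixes f. *)
Lemma cusp_period (wt : nat) f g (m : nat) : (8 %| g 1%R 0%R * g 1%R 0%R * m%:Z)%Z ->
  (forall g, Gamma0 8 g -> slash wt f g = f) ->
  forall z z', val z' = val z + m%:R -> slash wt f g z' = slash wt f g z.
Proof.
move=> dv inv z z' zz'.
have hT : 1 * 1 - m%:Z * 0 = 1 :> int by rewrite mulr0 subr0.
have [t00 t01 t10 t11] := sl2E hT; have [v00 v01 v10 v11] := sl2E (sl2V_det g).
pose T := sl2 hT; pose ga := sl2M (sl2M g T) (sl2V g).
have hga : Gamma0 8 ga.
  rewrite /Gamma0 /= !sl2ME t00 t01 t10 t11 v00 v10.
  rewrite (_ : _ + _ = - (g 1 0 * g 1 0 * m%:Z)); last by ring.
  by rewrite rpredN.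
have e : slash wt (slash wt f g) T = slash wt f g.
  by rewrite -slashM -(sl2VK g (sl2M g T)) slashM (inv _ hga).
have := congr1 (fun f => f z) e; rewrite {1}/slash.
have -> : autf T z = 1 by rewrite /autf t10 t11 mul0r add0r.
have -> : mobius T z = z'.
  by apply: val_inj => /=; rewrite /autf t00 t01 t10 t11 zz' mul0r add0r mul1r divr1.
by rewrite expr1n invr1 mul1r.
Qed.

Lemma slash_mul (w1 w2 : nat) f b g z :
  slash (w1 + w2) (fun z => f z * b z) g z = slash w1 f g z * slash w2 b g z.
Proof. by rewrite /slash exprD invfM mulrACA. Qed.

Lemma ana_fourier h A f : (0 < h)%N -> ana A -> (forall z, f z = A (nome h (val z))) ->
  exists a, hasps a A /\ fourier h a f.
Proof. by move=> h0 [a ha] E; exists a; split => //; exact: (hasps_fourier h0 ha E). Qed.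

(** Both expansions are rewritten in [nome (h * 8)], which has powers equal to [nome h] and to
    [nome 8]. The factor from F|g has the positive exponent [h * e], so the product vanishes at the
    cusp. *)
Lemma cusp_mulF wt b : modular_forms 8 wt b -> cusp_forms 8 (4 + wt) (fun z => F z * b z).
Proof.
move=> [hb inv exp]; split.
- exact: holomorphicM F_holo hb.
- move=> g hg; apply: functional_extensionality_dep => z.
  by rewrite slash_mul F_Gamma0 // inv.
move=> g; have [h [a [h0 ha]]] := exp g; have [e [m [U [em _ [hU _ _] EU]]]] := F_slash g.
have [A [hA EA]] := fourier_hasps h0 ha; have anaA : ana A by exists a.
have e0 : (0 < e)%N by case: e em {EU}.
have hB := anaM (ana_monoM (h * e) (ana_compX h0 hU)) (ana_compX (ltn0Sn 7) anaA).
have H0 : (0 < h * 8)%N by rewrite muln_gt0 h0.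
have [|c [hc fc]] := @ana_fourier (h * 8) _ (slash (4 + wt) (fun z => F z * b z) g) H0 hB.
  move=> z; rewrite slash_mul EU EA.
  have -> : nome (h * 8) (val z) ^+ 8 = nome h (val z) :> C by rewrite nomeXn.
  by rewrite exprM mulnC nomeXn.
exists (h * 8)%N, c; split => //.
rewrite -(hasps0 hc) expr0n muln_eq0 !gtn_eqF //=; exact: (etrans (congr1 (fun x => x * _) (mul0r _)) (mul0r _)).
Qed.

(** In w = [nome (h * 8)] the form f|g is A(w^8), which [period_order] shows to be divisible by w^(e
    h), precisely the power of w in F|g; the unit U is then inverted. *)
Lemma cusp_divF wt f : cusp_forms 8 (4 + wt) f -> modular_forms 8 wt (fun z => f z / F z).
Proof.
move=> [hf inv exp].
have fE : (fun z => F z * (f z / F z)) = f.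
  by apply: functional_extensionality_dep => z; rewrite mulrC divfK // F_neq0.
have sE g z : slash wt (fun z => f z / F z) g z = slash (4 + wt) f g z / slash 4 F g z.
  have s0 : slash 4 F g z != 0.
    apply: mulf_neq0; [rewrite invr_eq0 expf_neq0 //; exact: autf_neq0 | exact: F_neq0].
  by have := slash_mul 4 wt F (fun z => f z / F z) g z; rewrite fE => ->; rewrite mulrC mulKf.
split.
- exact: holomorphicM hf (holomorphicV F_neq0 F_holo).
- move=> g hg; apply: functional_extensionality_dep => z.
  by rewrite sE F_Gamma0 // inv.
move=> g; have [h [a [h0 a0 ha]]] := exp g; have [e [m [U [em dv [hU hV U0] EU]]]] := F_slash g.
have [A [hA EA]] := fourier_hasps h0 ha; have anaA : ana A by exists a.
have A0 : A 0 = 0 by rewrite (hasps0 hA).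
have per x : 0 < complex.Im x -> A (nome h (x + m%:R)) = A (nome h x).
  move=> x0; have x0' : 0 < complex.Im (x + m%:R) by rewrite ImD Im_nat addr0.
  pose z : uhp R := exist (fun x : C => is_true (0 < complex.Im x)) x x0.
  pose z' : uhp R := exist (fun x : C => is_true (0 < complex.Im x)) _ x0'.
  by rewrite -(EA z) -(EA z'); exact: (cusp_period dv inv).
have [B [hB EB]] := period_order anaA A0 h0 em per.
have hD := anaM hB (ana_compX h0 hV).
have H0 : (0 < h * 8)%N by rewrite muln_gt0 h0.
have [|c [hc fc]] := @ana_fourier (h * 8) _ (slash wt (fun z => f z / F z) g) H0 hD; last first.
  by exists (h * 8)%N, c.
move=> z; have w1 := nm_nome_lt1 H0 (valP z).
have e8 : nome 8 (val z) = nome (h * 8) (val z) ^+ h :> C by rewrite mulnC nomeXn.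
have w0 : nome (h * 8) (val z) != 0 :> C by exact: nome_neq0.
rewrite sE EU EA -(@nomeXn R h 8) // (EB _ w1) e8 -exprM (mulnC e h) invfM mulrACA.
by rewrite divff ?mul1r // expf_neq0.
Qed.

End Division.

(** * Forms of weight zero *)

Section WeightZero.
Variable R : realType.
Notation C := (cplx R).
Implicit Types (x y w : C) (z : uhp R) (g : SL2Z) (A B : C -> C) (f : uhp R -> C).

Lemma dvdz_Zp (n : int) : n%:~R = 0 :> 'Z_8 -> (8 %| n)%Z.
Proof.
move=> n0; have e := divz_eq n 8; have r0 : 0 <= (n %% 8)%Z by rewrite modz_ge0.
have r8 : (n %% 8)%Z < 8 by rewrite (@ltz_pmod n 8).
case: (n %% 8)%Z e r0 r8 => // r e _ r8.
suff r0 : r = 0%N by rewrite e r0 addr0 dvdz_mull.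
move: n0; rewrite e rmorphD rmorphM /=.
have -> : (8 : int)%:~R = 0 :> 'Z_8 by apply: val_inj.
rewrite mulr0 add0r -pmulrn => /(congr1 val).
by rewrite /= Zp_nat /= modn_small.
Qed.

Lemma ana_prod_zero (I : Type) (s : seq I) (G : I -> C -> C) : (forall i, ana (G i)) ->
  (forall w, nm w < 1 -> \prod_(i <- s) G i w = 0) ->
  exists i, forall w, nm w < 1 -> G i w = 0.
Proof.
move=> hG; elim: s => [|i s IH] H.
  by have := H 0 (nm01 R); rewrite big_nil => /eqP; rewrite oner_eq0.
case: (@ana_mul_zero R (G i) (fun w => \prod_(j <- s) G j w) (hG i)) => [|w w1||].
- exact: ana_prod.
- by rewrite -(H w w1) big_cons.
- by exists i.
- exact: IH.
Qed.

(** Equal bottom rows modulo 8 imply equal cosets of Gamma_0(8), by [mrow_Gamma0]. Rows are finer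
    than cosets, which only repeats factors in the product below, and they form a ready-made finite
    index type. *)
Definition mrow g : 'Z_8 * 'Z_8 := ((g 1 0)%:~R, (g 1 1)%:~R).

Lemma mrow_Gamma0 f g g' : (forall g, Gamma0 8 g -> slash 0 f g = f) ->
  mrow g = mrow g' -> slash 0 f g = slash 0 f g'.
Proof.
move=> inv [e0 e1]; have [v00 v01 v10 v11] := sl2E (sl2V_det g).
suff h : (8 %| sl2M g' (sl2V g) 1%R 0%R)%Z by rewrite -[in RHS](sl2VK g g') slashM (inv _ h).
apply: dvdz_Zp; rewrite sl2ME v00 v10 rmorphD !rmorphM rmorphN /= -e0 -e1.
by rewrite mulrN [X in X - _]mulrC subrr.
Qed.

Lemma slash0E f g z : slash 0 f g z = f (mobius g z).
Proof. by rewrite /slash expr0 invr1 mul1r. Qed.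

(* [D p] represents f|g - a0 for any g whose bottom row is p modulo 8, and is 1 if
   there is no such g. *)
Section Orbit.
Variables (f : uhp R -> C) (a0 : C).
Variable D : 'Z_8 * 'Z_8 -> nat * (C -> C).
Let phi p x : C := (D p).2 (nome (D p).1 x).
Hypothesis D1 : forall g z, phi (mrow g) (val z) = f (mobius g z) - a0.
Hypothesis D2 : forall p, (forall g, mrow g != p) -> forall w, (D p).2 w = 1.

(** Right multiplication permutes the rows. The matrix [N] realizing the inverse permutation ensures
    that a row which is not a bottom row is sent to another such row, where both factors are 1. *)
Lemma phi_orbit (s t : 'Z_8 * 'Z_8 -> 'Z_8 * 'Z_8) (M N : SL2Z) :
  (forall g, mrow (sl2M g M) = s (mrow g)) -> (forall g, mrow (sl2M g N) = t (mrow g)) ->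
  cancel s t -> forall z, \prod_p phi p (val (mobius M z)) = \prod_p phi p (val z).
Proof.
move=> hs ht st z; rewrite [RHS](reindex_inj (can_inj st)); apply: eq_bigr => p _.
have [[g <-]|np] := pselect (exists g, mrow g = p).
  by rewrite -hs !D1 mobiusM.
have n1 g : mrow g != p by apply/eqP => e; apply: np; exists g.
have n2 g : mrow g != s p.
  by apply/eqP => e; apply: np; exists (sl2M g N); rewrite ht e st.
by rewrite /phi (D2 n1) (D2 n2).
Qed.

End Orbit.

(* The product over all cosets of f|g - a0 has level one and vanishes at infinity. *)
Lemma weight0_constant f : modular_forms 8 0 f -> exists c, forall z, f z = c.
Proof.
move=> [_ inv exp].
have ex g : exists h A, [/\ (0 < h)%N, ana A & forall z, f (mobius g z) = A (nome h (val z))].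
  have [h [a [h0 ha]]] := exp g; have [A [hA EA]] := fourier_hasps h0 ha.
  by exists h, A; split => //; [exists a | move=> z; rewrite -slash0E].
have det1 : 1 * 1 - 0 * 0 = 1 :> int by [].
have [h0 [A0 [h00 hA0 EA0]]] := ex (sl2 det1); pose a0 := A0 0.
pose Dspec (p : 'Z_8 * 'Z_8) (d : nat * (C -> C)) := [/\ (0 < d.1)%N, ana d.2,
  forall g, mrow g = p -> forall z, d.2 (nome d.1 (val z)) = f (mobius g z) - a0 &
  (forall g, mrow g != p) -> forall w, d.2 w = 1].
have [D HD] : {D | forall p, Dspec p (D p)}.
  suff /choice[D HD] : forall p, exists d, Dspec p d by exists D.
  move=> p; have [[g gp]|np] := pselect (exists g, mrow g = p).
    have [h [A [h1 hA EA]]] := ex g; exists (h, fun w => A w - a0); split.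
    - exact: h1.
    - exact: (anaB hA (ana_cst a0)).
    - move=> g' g'p z; rewrite -[LHS]/(A (nome h (val z)) - a0) -EA -!slash0E.
      by rewrite (mrow_Gamma0 inv (etrans gp (esym g'p))).
    - by move=> /(_ g); rewrite gp eqxx.
  exists (1%N, fun=> 1); split.
  - by [].
  - exact: ana_cst.
  - by move=> g gp; case: np; exists g.
  - by [].
(* A common multiple of all the periods, so that every factor becomes a power series in the single
   nome of period [H]. *)
pose H := \prod_p (D p).1.
have D0 p : (0 < (D p).1)%N by have [] := HD p.
have H0 : (0 < H)%N by rewrite prodn_gt0.
have HdE p : H = ((D p).1 * (H %/ (D p).1))%N.
  by rewrite mulnC divnK // /H (bigD1 p) //= dvdn_mulr.
have Hd0 p : (0 < H %/ (D p).1)%N.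
  by have := H0; rewrite {1}(HdE p) muln_gt0 => /andP[].
pose G p w := (D p).2 (w ^+ (H %/ (D p).1)).
have hG p : ana (G p) by have [_ h _ _] := HD p; exact: (ana_compX (Hd0 p) h).
have GE p x : G p (nome H x) = (D p).2 (nome (D p).1 x).
  by rewrite /G [in nome H x](HdE p) nomeXn.
have D1 g z : (D (mrow g)).2 (nome (D (mrow g)).1 (val z)) = f (mobius g z) - a0.
  by have [_ _ h _] := HD (mrow g); exact: h.
have D2 p : (forall g, mrow g != p) -> forall w, (D p).2 w = 1 by have [] := HD p.
have inT := phi_orbit D1 D2.
pose P x := \prod_p (D p).2 (nome (D p).1 x).
pose B w := \prod_p G p w.
have hB : ana B by exact: ana_prod.
have PB x : P x = B (nome H x) by apply: eq_bigr => p _; rewrite GE.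
pose mk x (x0 : 0 < complex.Im x) : uhp R := exist (fun x : C => is_true (0 < complex.Im x)) x x0.
have PT x : 0 < complex.Im x -> P (x + 1) = P x.
  move=> x0; have dT : 1 * 1 - 1 * 0 = 1 :> int by [].
  have dN : 1 * 1 - (-1) * 0 = 1 :> int by [].
  have [t00 t01 t10 t11] := sl2E dT; have [n00 n01 n10 n11] := sl2E dN.
  have := inT (fun p => (p.1, p.1 + p.2)) (fun p => (p.1, p.2 - p.1)) (sl2 dT) (sl2 dN) _ _ _ (mk x x0).
  have -> : val (mobius (sl2 dT) (mk x x0)) = x + 1.
    by rewrite /= /autf t00 t01 t10 t11 mul0r add0r mul1r divr1.
  apply.
  - by move=> g; rewrite /mrow !sl2ME t00 t01 t10 t11 !mulr1 mulr0 addr0 rmorphD.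
  - by move=> g; rewrite /mrow !sl2ME n00 n01 n10 n11 !mulr1 mulr0 addr0 mulrN1 rmorphD rmorphN addrC.
  - by case=> a b /=; rewrite addrAC subrr add0r.
have PS x : 0 < complex.Im x -> P (- x^-1) = P x.
  move=> x0; have dT : 0 * 0 - (-1) * 1 = 1 :> int by [].
  have dN : 0 * 0 - 1 * (-1) = 1 :> int by [].
  have [t00 t01 t10 t11] := sl2E dT; have [n00 n01 n10 n11] := sl2E dN.
  have := inT (fun p => (p.2, - p.1)) (fun p => (- p.2, p.1)) (sl2 dT) (sl2 dN) _ _ _ (mk x x0).
  have -> : val (mobius (sl2 dT) (mk x x0)) = - x^-1.
    by rewrite /= /autf t00 t01 t10 t11 mul0r add0r mul1r addr0 mulN1r.
  apply.
  - by move=> g; rewrite /mrow !sl2ME t00 t01 t10 t11 !mulr1 !mulr0 addr0 add0r mulrN1 rmorphN.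
  - by move=> g; rewrite /mrow !sl2ME n00 n01 n10 n11 !mulr1 !mulr0 addr0 add0r mulrN1 rmorphN.
  - by case=> a b /=; rewrite opprK.
(* The factor belonging to the identity is f - a0, and a0 is the constant term of f at infinity. *)
have G0 : G (mrow (sl2 det1)) 0 = 0.
  have hh : (0 < H * h0)%N by rewrite muln_gt0 H0.
  have h1 := ana_compX h00 (hG (mrow (sl2 det1))).
  have h2 := anaB (ana_compX H0 hA0) (ana_cst a0).
  have E x : 0 < complex.Im x ->
      G (mrow (sl2 det1)) (nome (H * h0) x ^+ h0) = A0 (nome (H * h0) x ^+ H) - a0.
    move=> x0; rewrite nomeXn // (mulnC H) nomeXn // GE.
    by rewrite (D1 (sl2 det1) (mk x x0)) (EA0 (mk x x0)).
  have := ana_eq_nome h1 h2 hh E (nm01 R).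
  by rewrite !expr0n !gtn_eqF // mulr0n subrr.
have B0 : B 0 = 0 by rewrite /B (bigD1 (mrow (sl2 det1))) //= G0 mul0r.
have [B1 [hB1 EB1]] := ana_factor0 hB B0.
have P0 : forall x, 0 < complex.Im x -> P x = 0.
  apply: (@level1_vanish R P B1 H 1 0 H0 isT _ hB1).
  - by rewrite mul0n.
  - by move=> x x0; rewrite PB EB1 ?expr1 // nm_nome_lt1.
  - by move=> x x0; rewrite PT.
  - by move=> x x0; rewrite PS // mul1r.
(* One factor vanishes identically. It cannot be a default factor, which is 1, so it is f|g - a0 for
   an actual g, and applying the inverse of g gives f = a0. *)
have [p hp] : exists p, forall w, nm w < 1 -> G p w = 0.
  apply: (ana_prod_zero (s := index_enum _) hG).
  apply: (@ana_eq_nome R B (fun=> 0) H hB (ana_cst 0) H0) => x x0.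
  by rewrite -PB P0.
have [[g gp]|np] := pselect (exists g, mrow g = p); last first.
  have n1 g : mrow g != p by apply/eqP => e; apply: np; exists g.
  by have := hp 0 (nm01 R); rewrite /G (D2 p n1) => /eqP; rewrite oner_eq0.
exists a0 => z; rewrite -(mobius_sl2VK g z); apply/eqP; rewrite -subr_eq0; apply/eqP.
by rewrite -D1 gp -GE hp // nm_nome_lt1 //; exact: (valP (mobius (sl2V g) z)).
Qed.

End WeightZero.

(** * Bases *)

Section Basis.
Variable R : realType.
Notation C := (cplx R).
Implicit Types (z : uhp R) (f b : uhp R -> C).
Notation F := (@F4_8_1 R).

Lemma cst_modular c : modular_forms 8 0 (fun=> c : C).
Proof.
have E g : slash 0 (fun=> c : C) g = fun=> c.
  by apply: functional_extensionality_dep => z; rewrite slash0E.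
have [a [_ fa]] := @ana_fourier R 1 (fun=> c) (fun=> c) isT (ana_cst c) (fun=> erefl).
split; first exact: (@holomorphic_ana R 1 _ (fun=> c) isT (ana_cst c)).
  by move=> g _.
by move=> g; exists 1%N, a; rewrite E.
Qed.

Lemma F_cusp : cusp_forms 8 4 F.
Proof.
have := cusp_mulF (cst_modular 1); rewrite addn0.
by rewrite (_ : (fun z => F z * 1) = F) //; apply: functional_extensionality_dep => z; rewrite mulr1.
Qed.

Lemma lincombE n (c : 'I_n -> C) (b : 'I_n -> uhp R -> C) z :
  (\sum_i c i *: b i) z = \sum_i c i * b i z.
Proof. by rewrite fct_sumE. Qed.

(** F is q times [t1 q * vt (q ^+ 2)], a series with constant term 1; so the valuation rises by
    exactly one and the leading coefficient is kept. With b = 1 this gives that F itself is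
    unitary. *)
Lemma fourier_mulF a v b : fourier 1 a b -> (forall m, (m < v)%N -> a m = 0) ->
  exists a', [/\ fourier 1 a' (fun z => F z * b z),
    forall m, (m < v.+1)%N -> a' m = 0 & a' v.+1 = a v].
Proof.
move=> fa av; have [A [hA EA]] := fourier_hasps (ltn0Sn 0) fa.
have [A1 [hA1 EA1]] := hasps_shift hA av.
have an1 : ana A1 by exists (fun k => a (v + k)%N).
have [c hc] := anaM (anaM (t1_ana R) (ana_compX (ltn0Sn 1) (vt_ana R))) an1.
exists (fun m => if (m < v.+1)%N then 0 else c (m - v.+1)%N); split.
- apply: (hasps_fourier (ltn0Sn 0) (hasps_unshift v.+1 hc)) => z.
  have q1 := nm_nome_lt1 (ltn0Sn 0) (valP z).
  rewrite F_theta EA EA1 // [_ ^+ v.+1]exprS; move: (nome 1 _) => q.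
  by move: (t1 q) (vt (q ^+ 2)) (A1 q) => x y w; ring.
- by move=> m ->.
- by rewrite ltnn subnn -(hasps0 hc) t1_0 expr0n vt0 !mul1r (hasps0 hA1) addn0.
Qed.

Lemma cst_fourier : fourier 1 (fun n => (n == 0)%:R) (fun=> 1 : C).
Proof.
move=> z; apply: (cvgC_eq (u := fun=> 1)); last exact: (@cvgC_cst R 1).
exists 1%N => [[|n]] // _; rewrite seriesCE big_ord_recl big1 ?expr0 ?mulr1 ?addr0 // => i _.
by rewrite mul0r.
Qed.

End Basis.

Theorem mainTheorem12 (R : realType) :
  [/\ is_basis (cusp_forms 8 4) (fun _ : 'I_1 => @F4_8_1 R),
      unitary (@F4_8_1 R)
    & forall (k : nat), (2 <= k)%N ->
      forall (n : nat) (b : 'I_n -> uhp R -> cplx R),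
        is_basis (modular_forms 8 (2 * k - 4)%N) b ->
        unitary_upper_triangular b ->
        is_basis (cusp_forms 8 (2 * k)%N) (fun i tau => F4_8_1 tau * b i tau) /\
        unitary_upper_triangular (fun i tau => F4_8_1 tau * b i tau)].
Proof.
have z0 : uhp R by exists (0 +i* 1); rewrite /= ltr01.
have mulF_lin n (c : 'I_n -> cplx R) (b : 'I_n -> uhp R -> cplx R) z :
    (\sum_i c i *: (fun tau => F4_8_1 tau * b i tau)) z = F4_8_1 z * (\sum_i c i *: b i) z.
  by rewrite !lincombE mulr_sumr; apply: eq_bigr => i _; rewrite mulrCA.
split.
- split=> [_|c c0 i|f hf]; first exact: F_cusp.
    have := congr1 (fun f => f z0) c0; rewrite lincombE big_ord1 => /eqP.
    by rewrite mulf_eq0 (negPf (F_neq0 z0)) orbF (ord1 i) => /eqP.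
  (* Dividing a cusp form of weight 4 by F leaves weight 0, hence a constant. *)
  have [c hc] := weight0_constant (cusp_divF (hf : cusp_forms 8 (4 + 0) f)).
  exists (fun=> c); apply: functional_extensionality_dep => z.
  by rewrite lincombE big_ord1 -(hc z) divfK // F_neq0.
- have a0 m : (m < 0)%N -> (m == 0)%:R = 0 :> cplx R by [].
  have [a [fa am av]] := fourier_mulF (@cst_fourier R) a0.
  have F1 : (fun z => F4_8_1 z * 1) = @F4_8_1 R.
    by apply: functional_extensionality_dep => z; rewrite mulr1.
  by exists a, 1%N; rewrite F1 in fa; split; [exact: fa | exact: am | exact: av].
move=> k k2 n b [bV bfree bspan] [bu [v [bv vmono]]].
have wt : (2 * k = 4 + (2 * k - 4))%N by rewrite subnKC // (leq_mul2l 2 2).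
split; first split.
- by move=> i; rewrite wt; exact: cusp_mulF (bV i).
- move=> c c0; apply: bfree; apply: functional_extensionality_dep => z.
  have := congr1 (fun f => f z) c0; rewrite mulF_lin => /eqP.
  by rewrite mulf_eq0 (negPf (F_neq0 z)) /= => /eqP.
- rewrite wt => f hf; have [c hc] := bspan _ (cusp_divF hf); exists c.
  apply: functional_extensionality_dep => z; rewrite mulF_lin -hc.
  by rewrite mulrC divfK // F_neq0.
split.
  move=> i; have [a [m [fa am a1]]] := bu i; have [a' [fa' am' a1']] := fourier_mulF fa am.
  by exists a', m.+1; split; [exact: fa' | exact: am' | rewrite a1'].
exists (fun i => (v i).+1); split => [i|i j ij]; last by rewrite ltnS; exact: vmono.
have [a [fa am a1]] := bv i; have [a' [fa' am' a1']] := fourier_mulF fa am.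
by exists a'; split; [exact: fa' | exact: am' | rewrite a1'].
Qed.
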